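(* Let $h\in C_0^\infty(\mathbb{R}_+)'$ be real, i.e. $\overline{\langle h,F\rangle}=\langle h,\overline F\rangle$ for all $F\in C_0^\infty(\mathbb{R}_+)$. Then $\sigma=(\mathsf{L}^* )^{-1}h\in\mathcal{Y}'$ and $$N_\pm(h;C_0^\infty(\mathbb{R}_+))=N_\pm(\sigma;\mathcal{Y}).$$ In particular, $\pm\langle h,\bar f\star f\rangle\ge0$ for all $f\in C_0^\infty(\mathbb{R}_+)$ if and only if $\pm\langle\sigma,w^*w\rangle\ge0$ for all $w\in\mathcal{Y}$.
   Context: $\mathbb{R}_+=(0,\infty)$. For a space of test functions $X$, $X'$ denotes the space of continuous antilinear functionals on $X$; the duality $\langle h,F\rangle$ is linear in the first and antilinear in the second argument, so that $\langle h,F\rangle=\int h(t)\overline{F(t)}\,dt$ when $h$ is a locally integrable function. The space $\mathcal{Y}$ consists of entire functions $\varphi(\lambda)$ satisfying, for all $\lambda\in\mathbb{C}$, the bounds $|\varphi(\lambda)|\le C_n(1+|\lambda|)^{-n}e^{r_\pm|\operatorname{Re}\lambda|}$ for $\pm\operatorname{Re}\lambda\ge 0$, for all $n$, with some $r_+=r_+(\varphi)<0$ and some $r_-=r_-(\varphi)\in\mathbb{R}$. By definition, $\varphi_k\to0$ in $\mathcal{Y}$ if all $\varphi_k$ satisfy these bounds with the same constants $r_\pm,C_n$ and $\varphi_k\to0$ uniformly on compact subsets of $\mathbb{C}$. For $\varphi\in\mathcal{Y}$, $\varphi^*(\lambda)=\overline{\varphi(\bar\lambda)}\in\mathcal{Y}$.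 The Laplace transform $(\mathsf{L}f)(\lambda)=\int_0^\infty e^{-t\lambda}f(t)\,dt$ is an isomorphism $\mathsf{L}:C_0^\infty(\mathbb{R}_+)\to\mathcal{Y}$ (Paley–Wiener), hence the adjoint $\mathsf{L}^*:\mathcal{Y}'\to C_0^\infty(\mathbb{R}_+)'$, $\langle \mathsf{L}^*\sigma,F\rangle=\langle\sigma,\mathsf{L}F\rangle$, is an isomorphism. If $h$ is real, then $\sigma=(\mathsf{L}^* )^{-1}h$ is real: $\overline{\langle\sigma,w\rangle}=\langle\sigma,w^*\rangle$ for $w\in\mathcal{Y}$. The Laplace convolution is $(\bar f_1\star f_2)(t)=\int_0^t\overline{f_1(s)}\,f_2(t-s)\,ds$. For a real quadratic form $\mathsf{h}[\varphi,\varphi]$ on a linear set $\mathsf{D}$, $N_\pm(\mathsf{h};\mathsf{D})\in\{0,1,2,\dots,\infty\}$ is the maximal dimension of linear sets $\mathcal{M}_\pm\subset\mathsf{D}$ such that $\pm\mathsf{h}[\varphi,\varphi]>0$ for all $\varphi\in\mathcal{M}_\pm$, $\varphi\ne0$. $N_\pm(h;C_0^\infty(\mathbb{R}_+))$ refers to the form $h[f,f]=\langle h,\bar f\star f\rangle$ on $C_0^\infty(\mathbb{R}_+)$, and $N_\pm(\sigma;\mathcal{Y})$ to the form $\sigma[w,w]=\langle\sigma,w^*w\rangle$ on $\mathcal{Y}$. *)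

(* Defs.v *)
From Stdlib Require Import Reals.
From Coquelicot Require Import Coquelicot.

Open Scope R_scope.

(** * Test functions and functionals

    A space of test functions is a set of functions [A -> C] together with the
    collection of its sequences converging to zero. *)

Record test_space (A : Type) := TestSpace {
  mem : (A -> C) -> Prop;
  cvg0 : (nat -> A -> C) -> Prop
}.
Arguments TestSpace {A} _ _.
Arguments mem {A} _ _.
Arguments cvg0 {A} _ _.

(** A functional is encoded as a total map [(A -> C) -> C] of which only the
    values on [mem X] matter: [h F] stands for the duality <h, F>, antilinear
    in [F].  For an antilinear functional, continuity is (sequential)
    continuity at zero. *)

Definition antilinear_on {A : Type} (X : (A -> C) -> Prop)
    (h : (A -> C) -> C) : Prop :=
  forall (c : C) (f g : A -> C), X f -> X g ->
    h (fun x => c * f x + g x)%C = (Cconj c * h f + h g)%C.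

Definition dual {A : Type} (X : test_space A) (h : (A -> C) -> C) : Prop :=
  antilinear_on (mem X) h /\
  forall F : nat -> A -> C, (forall k, mem X (F k)) -> cvg0 X F ->
    is_lim_seq (fun k => Cmod (h (F k))) 0.

(** * The space of smooth functions compactly supported in (0, oo)

    Functions on the half-line are extended by zero to the real line. *)

Definition smooth (f : R -> C) : Prop :=
  forall (n : nat) (t : R),
    ex_derive_n (fun s => Re (f s)) n t /\ ex_derive_n (fun s => Im (f s)) n t.

Definition Cderive_n (f : R -> C) (n : nat) (t : R) : C :=
  (Derive_n (fun s => Re (f s)) n t, Derive_n (fun s => Im (f s)) n t).

Definition supported_in (a b : R) (f : R -> C) : Prop :=
  forall t : R, f t <> RtoC 0 -> a <= t <= b.

Definition C0inf_mem (f : R -> C) : Prop :=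
  smooth f /\ exists a b : R, 0 < a /\ supported_in a b f.

Definition C0inf_cvg0 (F : nat -> R -> C) : Prop :=
  (exists a b : R, 0 < a /\ forall k, supported_in a b (F k)) /\
  forall (n : nat) (eps : R), 0 < eps ->
    eventually (fun k => forall t : R, Cmod (Cderive_n (F k) n t) < eps).

Definition C0inf : test_space R := TestSpace C0inf_mem C0inf_cvg0.

(** * The space Y of entire functions *)

Definition entire (phi : C -> C) : Prop :=
  forall z : C, ex_derive (K := C_AbsRing) (V := C_NormedModule) phi z.

Definition Y_bound (rp rm : R) (c : nat -> R) (phi : C -> C) : Prop :=
  forall (n : nat) (z : C),
    (0 <= Re z ->
       Cmod (phi z) <= c n * / (1 + Cmod z) ^ n * exp (rp * Rabs (Re z))) /\
    (Re z <= 0 ->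
       Cmod (phi z) <= c n * / (1 + Cmod z) ^ n * exp (rm * Rabs (Re z))).

Definition Y_mem (phi : C -> C) : Prop :=
  entire phi /\
  exists (rp rm : R) (c : nat -> R), rp < 0 /\ Y_bound rp rm c phi.

(** Closed discs suffice for uniform convergence on compact subsets of C. *)
Definition Y_cvg0 (phi : nat -> C -> C) : Prop :=
  (exists (rp rm : R) (c : nat -> R),
     rp < 0 /\ forall k, Y_bound rp rm c (phi k)) /\
  forall rho eps : R, 0 < eps ->
    eventually (fun k => forall z : C, Cmod z <= rho -> Cmod (phi k z) < eps).

Definition Y : test_space C := TestSpace Y_mem Y_cvg0.

Definition star (phi : C -> C) : C -> C := fun z => Cconj (phi (Cconj z)).

(** * Laplace transform and Laplace convolution *)

Definition Cexp (z : C) : C :=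
  (exp (Re z) * cos (Im z), exp (Re z) * sin (Im z)).

Definition Laplace (f : R -> C) (z : C) : C :=
  RInt_gen (V := C_R_CompleteNormedModule)
    (fun t => Cexp (- (RtoC t * z)) * f t)%C
    (at_point 0) (Rbar_locally p_infty).

Definition Laplace_adj (sigma : (C -> C) -> C) : (R -> C) -> C :=
  fun F => sigma (Laplace F).

(** [Laplace_adj_inv h sigma]: sigma belongs to Y' and its image under L* is h,
    that is, sigma is the preimage (L* )^-1 h. *)
Definition Laplace_adj_inv (h : (R -> C) -> C) (sigma : (C -> C) -> C) : Prop :=
  dual Y sigma /\ forall F, mem C0inf F -> Laplace_adj sigma F = h F.

Definition conj_fun (f : R -> C) : R -> C := fun t => Cconj (f t).

(** The convolution of [conj_fun f1] and [f2]. *)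
Definition Laplace_conv (f1 f2 : R -> C) : R -> C :=
  fun t => RInt (V := C_R_CompleteNormedModule)
    (fun s => Cconj (f1 s) * f2 (t - s)%R)%C 0 t.

Definition real_functional (h : (R -> C) -> C) : Prop :=
  forall F, mem C0inf F -> Cconj (h F) = h (conj_fun F).

(** * Quadratic forms *)

Definition h_form (h : (R -> C) -> C) (f : R -> C) : C :=
  h (Laplace_conv f f).

Definition sigma_form (sigma : (C -> C) -> C) (w : C -> C) : C :=
  sigma (fun z => star w z * w z)%C.

Definition Cpos (z : C) : Prop := Im z = 0 /\ 0 < Re z.
Definition Cnonneg (z : C) : Prop := Im z = 0 /\ 0 <= Re z.

Definition linear_set {A : Type} (M : (A -> C) -> Prop) : Prop :=
  M (fun _ => RtoC 0) /\
  forall (c : C) (f g : A -> C), M f -> M g -> M (fun x => c * f x + g x)%C.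

Definition lin_indep {A : Type} (n : nat) (e : nat -> A -> C) : Prop :=
  forall c : nat -> C,
    (forall x : A, sum_n_m (fun i => c i * e i x)%C 1 n = RtoC 0) ->
    forall i : nat, (1 <= i <= n)%nat -> c i = RtoC 0.

(** The dimension over C, in {0, 1, 2, ..., oo}. *)
Definition dim {A : Type} (M : (A -> C) -> Prop) : Rbar :=
  Rbar_lub (fun d => exists (n : nat) (e : nat -> A -> C),
    d = Finite (INR n) /\
    (forall i : nat, (1 <= i <= n)%nat -> M (e i)) /\ lin_indep n e).

Definition N_plus {A : Type} (q : (A -> C) -> C) (D : (A -> C) -> Prop) : Rbar :=
  Rbar_lub (fun d => exists M : (A -> C) -> Prop,
    linear_set M /\ (forall f, M f -> D f) /\
    (forall f, M f -> f <> (fun _ => RtoC 0) -> Cpos (q f)) /\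
    d = dim M).

Definition N_minus {A : Type} (q : (A -> C) -> C) (D : (A -> C) -> Prop) : Rbar :=
  N_plus (fun f => - q f)%C D.

(* Main.v *)
Require Import Defs.
From Stdlib Require Import Reals Lra Lia FunctionalExtensionality.
From Coquelicot Require Import Coquelicot.
Open Scope R_scope.

(** The Laplace transform L is a linear bijection from C_0^oo(0, oo) onto Y whose inverse is
    continuous and which turns the convolution of conj f and f into w^* w with w = L f.  Hence
    sigma = h o L^-1 is the only preimage of h, L carries the form of h to the form of sigma, and
    subspaces on which one form is definite correspond, with the same dimension, to subspaces on
    which the other is.

    The inverse of L is the Fourier integral f(t) = (1 / 2 pi) int w(iy) exp(ity) dy.  By Goursat's
    theorem the line of integration may be moved to Re z = x for any real x, and letting
    x -> +oo and x -> -oo shows that f vanishes for t < - r_+ and for t > r_-.  On each vertical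
    line L f = w is then an instance of Fourier inversion for a decaying function whose Fourier
    transform has compact support; applied to a test function with vanishing transform the same
    inversion theorem gives the injectivity of L.  It is proved by damping with exp(-e |x|), which
    produces the Poisson kernel 2 e / (e^2 + t^2). *)

(** * Integrals of continuous complex-valued functions *)

(** The obstacle in the inversion theorem is that integrating a Fourier transform over [-S, S] leads
    to the Dirichlet kernel, which is not absolutely integrable and asks for more than continuity of
    the function. Damping replaces it by a positive kernel of mass 2 pi. Since the transform has
    compact support, the damped integral over [-S, S] equals the one over every larger interval:
    integrals are exchanged over bounded rectangles only, and the interval is enlarged afterwards.

    Explicit rates take the place of dominated convergence. Functions on lines decay like M / (1 +
    t^2) with a known M, so that limits become inequalities with an error K / T, and two numbers are
    equal as soon as they differ by at most K / T for all large T.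

    Wherever supports allow it, integrals are taken over a fixed bounded interval, for the transform
    of a test function and for the convolution alike; differentiation under the integral sign is
    then a quadratic Taylor estimate. *)

Definition Ccont (f : R -> C) : Prop :=
  forall t, continuous (fun s => Re (f s)) t /\ continuous (fun s => Im (f s)) t.

(** Componentwise, so that each fact about it splits into two facts about real Riemann integrals;
    [is_RInt_Cint] identifies it with the integral in [C_R_NormedModule]. *)
Definition Cint (f : R -> C) (a b : R) : C :=
  (RInt (fun s => Re (f s)) a b, RInt (fun s => Im (f s)) a b).

Lemma C_ext (z w : C) : Re z = Re w -> Im z = Im w -> z = w.
Proof. destruct z, w; simpl; intros; subst; reflexivity. Qed.

Lemma im_le_Cmod (z : C) : Rabs (Im z) <= Cmod z.
Proof. eapply Rle_trans; [|apply Rmax_Cmod]. apply Rmax_r. Qed.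

Lemma Cmod_le_Re_Im (z : C) : Cmod z <= Rabs (Re z) + Rabs (Im z).
Proof.
  unfold Cmod. apply Rsqr_incr_0_var.
  - rewrite Rsqr_sqrt by nra.
    unfold Re, Im; generalize (fst z) (snd z); intros x y.
    unfold Rsqr. pose proof (Rabs_pos x); pose proof (Rabs_pos y).
    pose proof (Rsqr_abs x); pose proof (Rsqr_abs y); unfold Rsqr in *. nra.
  - pose proof (Rabs_pos (Re z)); pose proof (Rabs_pos (Im z)); lra.
Qed.

Lemma Ccont_const (c : C) : Ccont (fun _ => c).
Proof. intro t; split; apply continuous_const. Qed.

Lemma Ccont_RtoC (f : R -> R) : (forall t, continuous f t) -> Ccont (fun t => RtoC (f t)).
Proof. intros H t; split; [apply H | apply continuous_const]. Qed.

Lemma Ccont_plus (f g : R -> C) : Ccont f -> Ccont g -> Ccont (fun t => f t + g t)%C.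
Proof.
  intros Hf Hg t; destruct (Hf t), (Hg t); split;
  apply (continuous_plus (U := R_UniformSpace) (V := R_NormedModule)); assumption.
Qed.

Lemma Ccont_opp (f : R -> C) : Ccont f -> Ccont (fun t => - f t)%C.
Proof.
  intros Hf t; destruct (Hf t); split;
  apply (continuous_opp (U := R_UniformSpace) (V := R_NormedModule)); assumption.
Qed.

Lemma Ccont_minus (f g : R -> C) : Ccont f -> Ccont g -> Ccont (fun t => f t - g t)%C.
Proof. intros Hf Hg; apply Ccont_plus; [|apply Ccont_opp]; assumption. Qed.

Lemma Ccont_mult (f g : R -> C) : Ccont f -> Ccont g -> Ccont (fun t => f t * g t)%C.
Proof.
  intros Hf Hg t; destruct (Hf t), (Hg t); split.
  - apply (continuous_minus (U := R_UniformSpace) (V := R_NormedModule));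
    apply (continuous_mult (U := R_UniformSpace) (K := R_AbsRing)); assumption.
  - apply (continuous_plus (U := R_UniformSpace) (V := R_NormedModule));
    apply (continuous_mult (U := R_UniformSpace) (K := R_AbsRing)); assumption.
Qed.

Lemma Ccont_conj (f : R -> C) : Ccont f -> Ccont (fun t => Cconj (f t)).
Proof.
  intros Hf t; destruct (Hf t); split; [assumption|].
  apply (continuous_opp (U := R_UniformSpace) (V := R_NormedModule)); assumption.
Qed.

Lemma Ccont_pow (f : R -> C) (n : nat) : Ccont f -> Ccont (fun t => f t ^ n)%C.
Proof.
  intro Hf; induction n as [|n IH]; simpl; [apply Ccont_const | apply Ccont_mult; assumption].
Qed.

Lemma Ccont_comp (f : R -> C) (u : R -> R) :
  Ccont f -> (forall t, continuous u t) -> Ccont (fun t => f (u t)).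
Proof.
  intros Hf Hu t; destruct (Hf (u t)); split.
  - apply (continuous_comp u (fun s => Re (f s))); auto.
  - apply (continuous_comp u (fun s => Im (f s))); auto.
Qed.

Lemma Ccont_Cexp (f : R -> C) : Ccont f -> Ccont (fun t => Cexp (f t)).
Proof.
  intros Hf t; destruct (Hf t) as [H1 H2].
  split; apply (continuous_mult (U := R_UniformSpace) (K := R_AbsRing)).
  - apply (continuous_comp _ exp); [assumption|apply continuous_exp].
  - apply (continuous_comp _ cos); [assumption|apply continuous_cos].
  - apply (continuous_comp _ exp); [assumption|apply continuous_exp].
  - apply (continuous_comp _ sin); [assumption|apply continuous_sin].
Qed.

Lemma Ccont_Cmod (f : R -> C) : Ccont f -> forall t, continuous (fun s => Cmod (f s)) t.
Proof.
  intros Hf t; destruct (Hf t).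
  unfold Cmod. apply (continuous_comp _ sqrt); [|apply continuous_sqrt].
  apply (continuous_plus (U := R_UniformSpace) (V := R_NormedModule)); simpl;
  repeat (apply (continuous_mult (U := R_UniformSpace) (K := R_AbsRing));
    try assumption; try apply continuous_const).
Qed.

Lemma ex_RInt_cont (f : R -> R) (a b : R) : (forall t, continuous f t) -> ex_RInt f a b.
Proof. intro H; apply (ex_RInt_continuous (V := R_CompleteNormedModule)); intros; apply H. Qed.

Lemma Ccont_Re (f : R -> C) : Ccont f -> forall t, continuous (fun s => Re (f s)) t.
Proof. intros H t; exact (proj1 (H t)). Qed.

Lemma Ccont_Im (f : R -> C) : Ccont f -> forall t, continuous (fun s => Im (f s)) t.
Proof. intros H t; exact (proj2 (H t)). Qed.

Lemma ex_RInt_Re (f : R -> C) (a b : R) : Ccont f -> ex_RInt (fun s => Re (f s)) a b.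
Proof. intro H; exact (ex_RInt_cont _ a b (Ccont_Re f H)). Qed.

Lemma ex_RInt_Im (f : R -> C) (a b : R) : Ccont f -> ex_RInt (fun s => Im (f s)) a b.
Proof. intro H; exact (ex_RInt_cont _ a b (Ccont_Im f H)). Qed.

Lemma is_RInt_Cint (f : R -> C) (a b : R) :
  Ccont f -> is_RInt (V := C_R_NormedModule) f a b (Cint f a b).
Proof.
  intro Hf. apply is_RInt_fct_extend_pair.
  - exact (RInt_correct (V := R_CompleteNormedModule) _ a b (ex_RInt_Re f a b Hf)).
  - exact (RInt_correct (V := R_CompleteNormedModule) _ a b (ex_RInt_Im f a b Hf)).
Qed.

Lemma RInt_Cint (f : R -> C) (a b : R) :
  Ccont f -> RInt (V := C_R_CompleteNormedModule) f a b = Cint f a b.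
Proof. intro Hf. apply is_RInt_unique, is_RInt_Cint, Hf. Qed.

Lemma Cint_ext (f g : R -> C) (a b : R) :
  (forall t, Rmin a b < t < Rmax a b -> f t = g t) -> Cint f a b = Cint g a b.
Proof.
  intro H; unfold Cint; f_equal; apply (RInt_ext (V := R_CompleteNormedModule));
  intros t Ht; rewrite H by assumption; reflexivity.
Qed.

Lemma Cint_plus (f g : R -> C) (a b : R) : Ccont f -> Ccont g ->
  Cint (fun t => f t + g t)%C a b = (Cint f a b + Cint g a b)%C.
Proof.
  intros Hf Hg; apply C_ext.
  - exact (RInt_plus (V := R_CompleteNormedModule) _ _ a b (ex_RInt_Re f a b Hf) (ex_RInt_Re g a b Hg)).
  - exact (RInt_plus (V := R_CompleteNormedModule) _ _ a b (ex_RInt_Im f a b Hf) (ex_RInt_Im g a b Hg)).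
Qed.

Lemma Cint_scal (c : C) (f : R -> C) (a b : R) : Ccont f ->
  Cint (fun t => c * f t)%C a b = (c * Cint f a b)%C.
Proof.
  intro Hf.
  assert (HR := fun k => ex_RInt_scal (V := R_NormedModule) _ a b k
    (ex_RInt_Re f a b Hf)).
  assert (HI := fun k => ex_RInt_scal (V := R_NormedModule) _ a b k
    (ex_RInt_Im f a b Hf)).
  assert (ER := fun k => RInt_scal (V := R_CompleteNormedModule) _ a b k
    (ex_RInt_Re f a b Hf)).
  assert (EI := fun k => RInt_scal (V := R_CompleteNormedModule) _ a b k
    (ex_RInt_Im f a b Hf)).
  apply C_ext; simpl.
  - etransitivity; [apply (RInt_minus (V := R_CompleteNormedModule)); [apply HR|apply HI]|].
    rewrite ER, EI; reflexivity.
  - etransitivity; [apply (RInt_plus (V := R_CompleteNormedModule)); [apply HI|apply HR]|].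
    rewrite ER, EI; reflexivity.
Qed.

Lemma Cint_opp (f : R -> C) (a b : R) : Ccont f ->
  Cint (fun t => - f t)%C a b = (- Cint f a b)%C.
Proof.
  intro Hf.
  transitivity (Cint (fun t => (-1)%R * f t)%C a b).
  - apply Cint_ext; intros; ring_simplify. apply C_ext; simpl; ring.
  - rewrite Cint_scal by assumption. apply C_ext; simpl; ring.
Qed.

Lemma Cint_minus (f g : R -> C) (a b : R) : Ccont f -> Ccont g ->
  Cint (fun t => f t - g t)%C a b = (Cint f a b - Cint g a b)%C.
Proof.
  intros Hf Hg. unfold Cminus at 1. rewrite Cint_plus, Cint_opp; auto using Ccont_opp.
Qed.

Lemma Cint_Chasles (f : R -> C) (a b c : R) : Ccont f ->
  (Cint f a b + Cint f b c)%C = Cint f a c.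
Proof.
  intro Hf; apply C_ext.
  - exact (RInt_Chasles (V := R_CompleteNormedModule) _ a b c (ex_RInt_Re f a b Hf) (ex_RInt_Re f b c Hf)).
  - exact (RInt_Chasles (V := R_CompleteNormedModule) _ a b c (ex_RInt_Im f a b Hf) (ex_RInt_Im f b c Hf)).
Qed.

Lemma Cint_point (f : R -> C) (a : R) : Cint f a a = RtoC 0.
Proof. apply C_ext; simpl; apply (RInt_point (V := R_CompleteNormedModule)). Qed.

Lemma Cint_const (c : C) (a b : R) : Cint (fun _ => c) a b = (RtoC (b - a) * c)%C.
Proof.
  apply C_ext; unfold Cint, Re, Im; simpl fst; simpl snd; rewrite RInt_const; simpl; unfold scal; simpl; unfold mult; simpl; ring.
Qed.

Lemma Cint_zero (f : R -> C) (a b : R) :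
  (forall t, Rmin a b < t < Rmax a b -> f t = RtoC 0) -> Cint f a b = RtoC 0.
Proof.
  intro H. rewrite (Cint_ext _ (fun _ => RtoC 0)) by assumption.
  rewrite Cint_const; ring.
Qed.

Lemma Cint_le (f : R -> C) (g : R -> R) (a b : R) : Ccont f -> (forall t, continuous g t) ->
  a <= b -> (forall t, a <= t <= b -> Cmod (f t) <= g t) -> Cmod (Cint f a b) <= RInt g a b.
Proof.
  intros Hf Hg Hab H. rewrite Cmod_norm.
  apply (norm_RInt_le (V := C_R_NormedModule) f g a b); trivial.
  - intros x Hx. rewrite <- Cmod_norm; auto.
  - apply is_RInt_Cint, Hf.
  - apply (RInt_correct (V := R_CompleteNormedModule)), ex_RInt_cont, Hg.
Qed.

Lemma Cint_le_const (f : R -> C) (M a b : R) : Ccont f -> a <= b ->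
  (forall t, a <= t <= b -> Cmod (f t) <= M) -> Cmod (Cint f a b) <= M * (b - a).
Proof.
  intros Hf Hab H.
  eapply Rle_trans; [apply (Cint_le f (fun _ => M)); trivial; intro; apply continuous_const|].
  rewrite RInt_const; simpl; unfold scal; simpl; unfold mult; simpl; lra.
Qed.

Lemma Cint_comp_lin (f : R -> C) (u v a b : R) : Ccont f ->
  (RtoC u * Cint (fun t => f (u * t + v)%R) a b)%C = Cint f (u * a + v)%R (u * b + v)%R.
Proof.
  intro Hf.
  assert (Hl : forall t, continuous (fun t => u * t + v) t).
  { intro t. apply (continuous_plus (U := R_UniformSpace) (V := R_NormedModule)
      (fun t => u * t) (fun _ => v)); [|apply continuous_const].
    apply (continuous_mult (U := R_UniformSpace) (K := R_AbsRing));
    [apply continuous_const | apply continuous_id]. }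
  rewrite <- Cint_scal by (apply Ccont_comp; assumption).
  apply C_ext; simpl.
  - rewrite <- (RInt_comp_lin (V := R_CompleteNormedModule))
      by (apply ex_RInt_cont, Ccont_Re, Hf).
    apply RInt_ext; intros; unfold scal; simpl; unfold mult; simpl. unfold Re; ring.
  - rewrite <- (RInt_comp_lin (V := R_CompleteNormedModule))
      by (apply ex_RInt_cont, Ccont_Im, Hf).
    apply RInt_ext; intros; unfold scal; simpl; unfold mult; simpl. unfold Im; ring.
Qed.

Lemma Cint_derive (f df : R -> C) (a b : R) :
  (forall t, is_derive (fun s => Re (f s)) t (Re (df t))) ->
  (forall t, is_derive (fun s => Im (f s)) t (Im (df t))) ->
  Ccont df -> Cint df a b = (f b - f a)%C.
Proof.
  intros H1 H2 Hc; apply C_ext; simpl.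
  - apply is_RInt_unique, (is_RInt_derive (V := R_CompleteNormedModule) (fun s => Re (f s)));
    intros; [apply H1 | apply Ccont_Re, Hc].
  - apply is_RInt_unique, (is_RInt_derive (V := R_CompleteNormedModule) (fun s => Im (f s)));
    intros; [apply H2 | apply Ccont_Im, Hc].
Qed.

(** * The complex exponential *)

Lemma Cexp_plus (z w : C) : Cexp (z + w) = (Cexp z * Cexp w)%C.
Proof.
  unfold Cexp; apply C_ext; simpl; rewrite exp_plus.
  - rewrite cos_plus; unfold Re, Im; ring.
  - rewrite sin_plus; unfold Re, Im; ring.
Qed.

Lemma Cexp_0 : Cexp 0 = RtoC 1.
Proof. unfold Cexp; apply C_ext; simpl; rewrite exp_0, ?cos_0, ?sin_0; ring. Qed.

Lemma Cmod_Cexp (z : C) : Cmod (Cexp z) = exp (Re z).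
Proof.
  unfold Cmod, Cexp; simpl.
  replace (_ + _) with ((exp (Re z))²).
  - apply sqrt_Rsqr, Rlt_le, exp_pos.
  - unfold Rsqr. pose proof (sin2_cos2 (Im z)); unfold Rsqr in *.
    transitivity (exp (Re z) * exp (Re z) * (sin (Im z) * sin (Im z) + cos (Im z) * cos (Im z)));
    [rewrite H; ring | ring].
Qed.

Lemma Cexp_conj (z : C) : Cexp (Cconj z) = Cconj (Cexp z).
Proof. destruct z; unfold Cexp, Cconj, Re, Im; simpl; rewrite cos_neg, sin_neg; f_equal; ring. Qed.

Lemma Cexp_line (u : C) (t : R) :
  Cexp (RtoC t * u) = (exp (t * Re u) * cos (t * Im u), exp (t * Re u) * sin (t * Im u)).
Proof.
  unfold Cexp, Re, Im; simpl; f_equal; f_equal; f_equal; ring.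
Qed.

Lemma Cexp_line_Re (u : C) (t : R) :
  is_derive (fun s => Re (Cexp (RtoC s * u))) t (Re (u * Cexp (RtoC t * u))).
Proof.
  apply is_derive_ext with (fun s => exp (s * Re u) * cos (s * Im u)).
  - intro s; rewrite Cexp_line; reflexivity.
  - rewrite Cexp_line; destruct u; unfold Re, Im; simpl. auto_derive; trivial; ring.
Qed.

Lemma Cexp_line_Im (u : C) (t : R) :
  is_derive (fun s => Im (Cexp (RtoC s * u))) t (Im (u * Cexp (RtoC t * u))).
Proof.
  apply is_derive_ext with (fun s => exp (s * Re u) * sin (s * Im u)).
  - intro s; rewrite Cexp_line; reflexivity.
  - rewrite Cexp_line; destruct u; unfold Re, Im; simpl. auto_derive; trivial; ring.
Qed.

Lemma continuous_id_R (t : R) : continuous (fun s : R => s) t.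
Proof. apply continuous_id. Qed.

Lemma Ccont_id : Ccont RtoC.
Proof. apply (Ccont_RtoC (fun s => s)); apply continuous_id_R. Qed.

Ltac ccont :=
  lazymatch goal with
  | |- Ccont (fun _ => ?c) => apply (Ccont_const c)
  | |- Ccont RtoC => apply Ccont_id
  | |- Ccont (fun t => RtoC t) => apply Ccont_id
  | |- Ccont (fun t => Cplus (@?f t) (@?g t)) => apply (Ccont_plus f g); ccont
  | |- Ccont (fun t => Cminus (@?f t) (@?g t)) => apply (Ccont_minus f g); ccont
  | |- Ccont (fun t => Copp (@?f t)) => apply (Ccont_opp f); ccont
  | |- Ccont (fun t => Cmult (@?f t) (@?g t)) => apply (Ccont_mult f g); ccont
  | |- Ccont (fun t => Cexp (@?f t)) => apply (Ccont_Cexp f); ccont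
  | |- Ccont (fun t => Cconj (@?f t)) => apply (Ccont_conj f); ccont
  | |- Ccont (fun t => Cpow (@?f t) ?n) => apply (Ccont_pow f n); ccont
  | _ => try assumption
  end.

(** The function s -> exp(su) has derivative u exp(su). This integral form of the remainder yields
    the estimates of exp u - 1 and exp u - 1 - u below without power series. *)
Lemma Cexp_line_int (u : C) : (u * Cint (fun s => Cexp (RtoC s * u)) 0 1)%C = (Cexp u - 1)%C.
Proof.
  rewrite <- Cint_scal by ccont.
  rewrite (Cint_derive (fun s => Cexp (RtoC s * u))%C).
  - rewrite Cmult_0_l, Cexp_0, Cmult_1_l; reflexivity.
  - apply Cexp_line_Re.
  - apply Cexp_line_Im.
  - ccont.
Qed.

Lemma Cmod_RtoC_le (t : R) (z : C) : 0 <= t <= 1 -> Cmod (RtoC t * z) <= Cmod z.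
Proof.
  intro H. rewrite Cmod_mult, Cmod_R, Rabs_pos_eq by lra.
  pose proof (Cmod_ge_0 z); nra.
Qed.

Lemma Re_le_Cmod (z : C) : Re z <= Cmod z.
Proof. eapply Rle_trans; [apply Rle_abs | apply re_le_Cmod]. Qed.

Lemma exp_le (x y : R) : x <= y -> exp x <= exp y.
Proof. intros [H| ->]; [apply Rlt_le, exp_increasing, H | lra]. Qed.

Lemma Cexp_bound1 (u : C) : Cmod (Cexp u - 1) <= Cmod u * exp (Rabs (Re u)).
Proof.
  rewrite <- Cexp_line_int, Cmod_mult.
  apply Rmult_le_compat_l; [apply Cmod_ge_0|].
  replace (exp (Rabs (Re u))) with (exp (Rabs (Re u)) * (1 - 0)) by ring.
  apply Cint_le_const; [ccont | lra |].
  intros t Ht. rewrite Cmod_Cexp. apply exp_le.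
  replace (Re (RtoC t * u)) with (t * Re u) by (unfold Re; simpl; ring).
  pose proof (Rle_abs (Re u)). pose proof (Rabs_pos (Re u)). nra.
Qed.

(** The remainder is u times the integral of exp(su) - 1 over [0, 1], to which the first-order bound
    applies. All derivatives of exponentials below rest on this estimate. *)
Lemma Cexp_bound2 (u : C) : Cmod (Cexp u - 1 - u) <= Cmod u * (Cmod u * exp (Rabs (Re u))).
Proof.
  replace (Cexp u - 1 - u)%C with (u * Cint (fun s => Cexp (RtoC s * u) - 1) 0 1)%C.
  - rewrite Cmod_mult. apply Rmult_le_compat_l; [apply Cmod_ge_0|].
    replace (Cmod u * _) with (Cmod u * exp (Rabs (Re u)) * (1 - 0)) by ring.
    apply Cint_le_const; [ccont | lra |].
    intros t Ht. eapply Rle_trans; [apply Cexp_bound1|].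
    apply Rmult_le_compat; [apply Cmod_ge_0 | apply Rlt_le, exp_pos | | apply exp_le].
    + apply Cmod_RtoC_le, Ht.
    + replace (Re (RtoC t * u)) with (t * Re u) by (unfold Re; simpl; ring).
      rewrite Rabs_mult, (Rabs_pos_eq t) by lra. pose proof (Rabs_pos (Re u)). nra.
  - rewrite Cint_minus by ccont. rewrite Cint_const.
    transitivity (u * Cint (fun s => Cexp (RtoC s * u)) 0 1 - u * (RtoC (1 - 0) * 1))%C; [ring|].
    rewrite Cexp_line_int. rewrite Rminus_0_r. ring.
Qed.

(** * Exchange of integrals over rectangles *)

Definition Ccont2 (F : R -> R -> C) : Prop :=
  forall x y, continuity_2d_pt (fun u v => Re (F u v)) x y /\
              continuity_2d_pt (fun u v => Im (F u v)) x y.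

Lemma continuity_2d_swap (F : R -> R -> R) (x y : R) :
  continuity_2d_pt F x y -> continuity_2d_pt (fun u v => F v u) y x.
Proof.
  intros H eps. destruct (H eps) as [d Hd]. exists d. intros u v Hu Hv. apply Hd; assumption.
Qed.

Lemma continuity_2d_slice (F : R -> R -> R) (x y : R) :
  continuity_2d_pt F x y -> continuous (F x) y.
Proof.
  intro H. apply filterlim_locally. intro eps. destruct (H eps) as [d Hd].
  exists d. intros v Hv. apply Hd; [|exact Hv].
  replace (x - x) with 0 by ring. rewrite Rabs_R0. apply cond_pos.
Qed.

(** Continuity in the parameter is uniform over the compact interval of integration, hence survives
    integration; reversed limits only change the sign. *)
Lemma continuous_RInt_param (F : R -> R -> R) (a b : R) :
  (forall x y, continuity_2d_pt F x y) ->
  forall x, continuous (fun u => RInt (F u) a b) x.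
Proof.
  intros HF.
  assert (Hle : forall a b, a <= b -> forall x, continuous (fun u => RInt (F u) a b) x).
  { clear a b; intros a b Hab x. apply filterlim_locally. intro eps.
    (* The summand 1 covers the degenerate case a = b. *)
    assert (He : 0 < eps / (b - a + 1)) by (apply Rdiv_lt_0_compat; [apply cond_pos | lra]).
    destruct (uniform_continuity_2d_1d' F a b x (fun t _ => HF x t) (mkposreal _ He)) as [d Hd].
    exists d. intros u Hu.
    change (Rabs (RInt (F u) a b - RInt (F x) a b) < eps).
    assert (Hex : forall u, ex_RInt (F u) a b)
      by (intro; apply ex_RInt_cont; intro; apply continuity_2d_slice, HF).
    change (RInt (F u) a b - RInt (F x) a b) with (minus (RInt (F u) a b) (RInt (F x) a b)).
    rewrite <- (RInt_minus (V := R_CompleteNormedModule)) by apply Hex.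
    apply Rle_lt_trans with ((b - a) * (eps / (b - a + 1))).
    - apply abs_RInt_le_const; trivial.
      + apply (ex_RInt_minus (V := R_NormedModule)); apply Hex.
      + intros t Ht. apply Rlt_le.
        change (Rabs (u - x) < d) in Hu. apply Rabs_lt_between in Hu.
        pose proof (cond_pos d).
        apply (Hd t x t u); trivial; try lra.
        replace (t - t) with 0 by ring; rewrite Rabs_R0; lra.
    - apply Rmult_lt_reg_r with (b - a + 1); [lra|].
      replace ((b - a) * (eps / (b - a + 1)) * (b - a + 1)) with ((b - a) * eps) by (field; lra).
      pose proof (cond_pos eps). nra. }
  intro x. destruct (Rle_dec a b) as [Hab|Hab]; [apply Hle, Hab|].
  apply continuous_ext with (fun u => opp (RInt (F u) b a)).
  - intro u. apply (opp_RInt_swap (V := R_CompleteNormedModule)).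
    apply ex_RInt_cont; intro; apply continuity_2d_slice, HF.
  - apply (continuous_opp (U := R_UniformSpace) (V := R_NormedModule)). apply Hle; lra.
Qed.

(** As functions of the upper limit b, both sides vanish at b = a and have the same derivative; for
    the right side this is differentiation under the integral sign. *)
Lemma RInt_exchange (F : R -> R -> R) (a b c d : R) :
  (forall x y, continuity_2d_pt F x y) ->
  RInt (fun x => RInt (fun y => F x y) c d) a b = RInt (fun y => RInt (fun x => F x y) a b) c d.
Proof.
  intro HF.
  assert (HF' : forall x y, continuity_2d_pt (fun u v => F v u) x y)
    by (intros; apply continuity_2d_swap, HF).
  assert (Hd : forall u y, is_derive (fun z => RInt (fun x => F x y) a z) u (F u y)).
  { intros u y. apply (is_derive_RInt (V := R_CompleteNormedModule) (fun x => F x y) _ a).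
    - apply filter_forall; intro z. apply RInt_correct, ex_RInt_cont.
      intro t; apply (continuity_2d_slice (fun u v => F v u)), HF'.
    - apply (continuity_2d_slice (fun u v => F v u)), HF'. }
  set (Phi := fun u => RInt (fun y => RInt (fun x => F x y) a u) c d).
  assert (HPhi : forall u, is_derive Phi u (RInt (F u) c d)).
  { intro u.
    replace (RInt (F u) c d)
      with (RInt (fun y => Derive (fun z => RInt (fun x => F x y) a z) u) c d).
    - apply (is_derive_RInt_param (fun u y => RInt (fun x => F x y) a u) c d u).
      + apply filter_forall; intros z t _. eexists; apply Hd.
      + intros t _. apply continuity_2d_pt_ext with F; [|apply HF].
        intros x y; symmetry; apply is_derive_unique, Hd.
      + apply filter_forall; intro z. apply ex_RInt_cont. intro t.
        apply (continuous_RInt_param (fun y x => F x y)), HF'.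
    - apply RInt_ext; intros y _. apply is_derive_unique, Hd. }
  transitivity (minus (Phi b) (Phi a)).
  - apply is_RInt_unique, (is_RInt_derive (V := R_CompleteNormedModule) Phi).
    + intros; apply HPhi.
    + intros x _. apply continuous_RInt_param, HF.
  - replace (Phi a) with 0; [unfold minus, plus, opp; simpl; unfold Phi; ring|].
    unfold Phi. rewrite (RInt_ext _ (fun _ => 0)).
    + rewrite RInt_const; unfold scal; simpl; unfold mult; simpl; ring.
    + intros; apply (RInt_point (V := R_CompleteNormedModule)).
Qed.

Lemma Cint_exchange (F : R -> R -> C) (a b c d : R) : Ccont2 F ->
  Cint (fun x => Cint (fun y => F x y) c d) a b = Cint (fun y => Cint (fun x => F x y) a b) c d.
Proof.
  intro HF; apply C_ext.
  - exact (RInt_exchange (fun x y => Re (F x y)) a b c d (fun x y => proj1 (HF x y))).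
  - exact (RInt_exchange (fun x y => Im (F x y)) a b c d (fun x y => proj2 (HF x y))).
Qed.

Lemma Ccont_Cint_param (F : R -> R -> C) (a b : R) : Ccont2 F ->
  Ccont (fun x => Cint (F x) a b).
Proof.
  intros HF x; split.
  - exact (continuous_RInt_param (fun x y => Re (F x y)) a b (fun x y => proj1 (HF x y)) x).
  - exact (continuous_RInt_param (fun x y => Im (F x y)) a b (fun x y => proj2 (HF x y)) x).
Qed.

Lemma Ccont2_mult (F G : R -> R -> C) : Ccont2 F -> Ccont2 G ->
  Ccont2 (fun x y => F x y * G x y)%C.
Proof.
  intros HF HG x y; destruct (HF x y), (HG x y); split.
  - apply continuity_2d_pt_minus; apply continuity_2d_pt_mult; assumption.
  - apply continuity_2d_pt_plus; apply continuity_2d_pt_mult; assumption.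
Qed.

Lemma Ccont2_comp (f : R -> C) (u : R -> R -> R) : Ccont f ->
  (forall x y, continuity_2d_pt u x y) -> Ccont2 (fun x y => f (u x y)).
Proof.
  intros Hf Hu x y; split.
  - apply (continuity_1d_2d_pt_comp (fun t => Re (f t)) u); trivial.
    apply continuity_pt_filterlim, Ccont_Re, Hf.
  - apply (continuity_1d_2d_pt_comp (fun t => Im (f t)) u); trivial.
    apply continuity_pt_filterlim, Ccont_Im, Hf.
Qed.

Lemma Ccont2_l (f : R -> C) : Ccont f -> Ccont2 (fun x _ => f x).
Proof. intro Hf. apply (Ccont2_comp f (fun x _ => x)); trivial. apply continuity_2d_pt_id1. Qed.

Lemma Ccont2_r (f : R -> C) : Ccont f -> Ccont2 (fun _ y => f y).
Proof. intro Hf. apply (Ccont2_comp f (fun _ y => y)); trivial. apply continuity_2d_pt_id2. Qed.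

(** * Improper integrals of quadratically decaying functions *)

(** The bound behaves like M / t^2 at infinity, which gives tails of size M / T, and stays finite at
    0, so that it also bounds [g] by [M]. *)
Definition decays (M : R) (g : R -> C) : Prop := forall t, Cmod (g t) <= M / (1 + t ^ 2).

(* [Lim] is total, hence so is [LI]; the limit exists if [g] is continuous and decays. *)
Definition LI (g : R -> C) : C :=
  (real (Lim (fun T => RInt (fun s => Re (g s)) (- T) T) p_infty),
   real (Lim (fun T => RInt (fun s => Im (g s)) (- T) T) p_infty)).

Lemma one_plus_sqr_pos (t : R) : 0 < 1 + t ^ 2.
Proof. pose proof (pow2_ge_0 t); lra. Qed.

Lemma decays_pos (M : R) (g : R -> C) : decays M g -> 0 <= M.
Proof.
  intro H; specialize (H 0). pose proof (Cmod_ge_0 (g 0)).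
  replace (M / (1 + 0 ^ 2)) with M in H by field. lra.
Qed.

Lemma decays_weaken (M N : R) (g : R -> C) : decays M g -> M <= N -> decays N g.
Proof.
  intros H HMN t. eapply Rle_trans; [apply H|].
  apply Rmult_le_compat_r; trivial. apply Rlt_le, Rinv_0_lt_compat, one_plus_sqr_pos.
Qed.

Lemma decays_bounded (M : R) (g : R -> C) : decays M g -> forall t, Cmod (g t) <= M.
Proof.
  intros H t. pose proof (decays_pos M g H).
  eapply Rle_trans; [apply H|].
  apply Rle_div_l; nra.
Qed.

Lemma Cint_swap (f : R -> C) (a b : R) : Ccont f -> Cint f b a = (- Cint f a b)%C.
Proof.
  intro Hf. pose proof (Cint_Chasles f a b a Hf) as H. rewrite Cint_point in H.
  transitivity (Cint f a b + Cint f b a - Cint f a b)%C; [ring | rewrite H; ring].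
Qed.

Lemma RInt_inv_sqr (M a b : R) : 0 < a <= b ->
  RInt (fun t => M / t ^ 2) a b = M / a - M / b.
Proof.
  intro Hab. replace (M / a - M / b) with (minus (- M / b) (- M / a)).
  - apply is_RInt_unique, (is_RInt_derive (V := R_CompleteNormedModule) (fun t => - M / t));
    intros x Hx; rewrite Rmin_left, Rmax_right in Hx by lra.
    + auto_derive; [lra | field; lra].
    + apply (ex_derive_continuous (V := R_NormedModule)). auto_derive. nra.
  - unfold minus, plus, opp; simpl; field; lra.
Qed.

Lemma Cint_comp_opp (f : R -> C) (a b : R) : Ccont f ->
  Cint (fun t => f (- t)) a b = Cint f (- b) (- a).
Proof.
  intro Hf. pose proof (Cint_comp_lin f (-1) 0 a b Hf) as H.
  replace (fun t => f (-1 * t + 0)) with (fun t => f (- t)) in H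
    by (apply functional_extensionality; intro; f_equal; ring).
  replace (-1 * a + 0) with (- a) in H by ring.
  replace (-1 * b + 0) with (- b) in H by ring.
  rewrite (Cint_swap f (- a) (- b)) by assumption. rewrite <- H.
  replace (RtoC (-1)) with (- (1))%C by (apply C_ext; simpl; ring). ring.
Qed.

Lemma Cint_comp_plus (f : R -> C) (s a b : R) : Ccont f ->
  Cint (fun t => f (t + s)) a b = Cint f (a + s) (b + s).
Proof.
  intro Hf. pose proof (Cint_comp_lin f 1 s a b Hf) as H.
  replace (fun t => f (1 * t + s)) with (fun t => f (t + s)) in H
    by (apply functional_extensionality; intro; f_equal; ring).
  rewrite !Rmult_1_l in H. rewrite <- H. ring.
Qed.

Lemma continuous_opp_R (t : R) : continuous (fun s => - s) t.
Proof. apply (continuous_opp (V := R_NormedModule) (fun s : R => s)), continuous_id. Qed.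

Lemma continuous_shift (s t : R) : continuous (fun x => x + s) t.
Proof.
  apply (continuous_plus (V := R_NormedModule) (fun x : R => x) (fun _ => s));
  [apply continuous_id | apply continuous_const].
Qed.

Lemma Cint_tail_right (g : R -> C) (M a b : R) : Ccont g -> decays M g -> 0 < a <= b ->
  Cmod (Cint g a b) <= M / a.
Proof.
  intros Hg Hd Hab. pose proof (decays_pos M g Hd) as HM.
  apply Rle_trans with (RInt (fun t => M / t ^ 2) a b).
  - rewrite Cmod_norm. apply (norm_RInt_le (V := C_R_NormedModule) g (fun t => M / t ^ 2) a b).
    + lra.
    + intros x Hx. rewrite <- Cmod_norm. eapply Rle_trans; [apply Hd|].
      apply Rmult_le_compat_l; trivial. apply Rinv_le_contravar; nra.
    + apply is_RInt_Cint, Hg.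
    + apply (RInt_correct (V := R_CompleteNormedModule)).
      apply (ex_RInt_continuous (V := R_CompleteNormedModule)). intros x Hx.
      rewrite Rmin_left, Rmax_right in Hx by lra.
      apply (ex_derive_continuous (V := R_NormedModule)). auto_derive. nra.
  - rewrite RInt_inv_sqr by lra.
    assert (0 <= M / b) by (apply Rdiv_le_0_compat; lra). lra.
Qed.

Lemma Cint_tail_left (g : R -> C) (M a b : R) : Ccont g -> decays M g -> 0 < a <= b ->
  Cmod (Cint g (- b) (- a)) <= M / a.
Proof.
  intros Hg Hd Hab. rewrite <- Cint_comp_opp by assumption.
  apply Cint_tail_right; trivial.
  - apply Ccont_comp; [assumption | apply continuous_opp_R].
  - intro t. replace (t ^ 2) with ((- t) ^ 2) by ring. apply Hd.
Qed.

Lemma Cint_sym_tail (g : R -> C) (M T T' : R) : Ccont g -> decays M g -> 0 < T <= T' ->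
  Cmod (Cint g (- T') T' - Cint g (- T) T) <= 2 * M / T.
Proof.
  intros Hg Hd HT.
  replace (Cint g (- T') T' - Cint g (- T) T)%C with (Cint g (- T') (- T) + Cint g T T')%C.
  - eapply Rle_trans; [apply Cmod_triangle|].
    pose proof (Cint_tail_right g M T T' Hg Hd HT).
    pose proof (Cint_tail_left g M T T' Hg Hd HT). lra.
  - rewrite <- (Cint_Chasles g (- T') (- T) T'), <- (Cint_Chasles g (- T) T T') by assumption.
    ring.
Qed.

(** The hypothesis makes [phi] Cauchy at infinity, so [Lim] is a true finite limit and not a default
    value, and it inherits the estimate. *)
Lemma Lim_tail (phi : R -> R) (K : R) :
  (forall T T', 0 < T <= T' -> Rabs (phi T' - phi T) <= K / T) ->
  forall T, 0 < T -> Rabs (real (Lim phi p_infty) - phi T) <= K / T.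
Proof.
  intros H.
  assert (HK : 0 <= K).
  { specialize (H 1 1 ltac:(lra)). pose proof (Rabs_pos (phi 1 - phi 1)). lra. }
  assert (Hc : exists l, filterlim phi (Rbar_locally p_infty) (locally (l : R))).
  { apply (proj1 (filterlim_locally_cauchy (U := R_CompleteSpace)
      (F := Rbar_locally p_infty) phi)).
    (* Beyond this [T0] all values of [phi] lie within eps / 2 of [phi T0]. *)
    intro eps. set (T0 := 2 * K / eps + 1).
    pose proof (cond_pos eps).
    assert (HT0 : 0 < T0).
    { unfold T0. assert (0 <= 2 * K / eps) by (apply Rdiv_le_0_compat; lra). lra. }
    assert (Hb : K / T0 < eps / 2).
    { apply Rlt_div_l; [lra|]. unfold T0. field_simplify; lra. }
    exists (fun x => T0 < x). split; [exists T0; auto|].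
    intros u v Hu Hv.
    change (Rabs (phi v - phi u) < eps).
    replace (phi v - phi u) with ((phi v - phi T0) - (phi u - phi T0)) by ring.
    eapply Rle_lt_trans; [apply Rabs_triang|]. rewrite Rabs_Ropp.
    pose proof (H T0 u ltac:(lra)). pose proof (H T0 v ltac:(lra)). lra. }
  destruct Hc as [l Hl].
  assert (El : Lim phi p_infty = Finite l) by (apply is_lim_unique; exact Hl).
  rewrite El. simpl. intros T HT.
  apply Rle_plus_epsilon. intros eps Heps.
  destruct (proj1 (filterlim_locally _ _) Hl (mkposreal eps Heps)) as [B HB].
  set (x := Rmax (B + 1) T).
  assert (B < x) by (unfold x; pose proof (Rmax_l (B + 1) T); lra).
  specialize (HB x H0). change (Rabs (phi x - l) < eps) in HB.
  pose proof (H T x (conj HT (Rmax_r _ _))).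
  replace (l - phi T) with ((phi x - phi T) - (phi x - l)) by ring.
  eapply Rle_trans; [apply Rabs_triang|]. rewrite Rabs_Ropp. lra.
Qed.

(** The factor 4 counts two tails for each of the real and imaginary parts. *)
Lemma LI_tail (g : R -> C) (M T : R) : Ccont g -> decays M g -> 0 < T ->
  Cmod (LI g - Cint g (- T) T) <= 4 * M / T.
Proof.
  intros Hg Hd HT.
  eapply Rle_trans; [apply Cmod_le_Re_Im|].
  replace (4 * M / T) with (2 * M / T + 2 * M / T) by (field; lra).
  apply Rplus_le_compat; simpl.
  - refine (Lim_tail (fun T => RInt (fun s => Re (g s)) (- T) T) _ _ T HT).
    intros a b Hab. eapply Rle_trans; [|apply (Cint_sym_tail g M a b Hg Hd Hab)].
    eapply Rle_trans; [|apply re_le_Cmod]. apply Req_le; reflexivity.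
  - refine (Lim_tail (fun T => RInt (fun s => Im (g s)) (- T) T) _ _ T HT).
    intros a b Hab. eapply Rle_trans; [|apply (Cint_sym_tail g M a b Hg Hd Hab)].
    eapply Rle_trans; [|apply im_le_Cmod]. apply Req_le; reflexivity.
Qed.

Lemma le_0_of_le_div (x K T0 : R) : (forall T, T0 <= T -> 0 < T -> x <= K / T) -> x <= 0.
Proof.
  intro H. destruct (Rle_dec x 0) as [|Hx]; [assumption|exfalso].
  apply Rnot_le_lt in Hx.
  (* This choice gives x T > |K|, against x <= K / T. *)
  set (T := Rabs T0 + 1 + Rabs K / x).
  assert (0 <= Rabs K / x) by (apply Rdiv_le_0_compat; [apply Rabs_pos | lra]).
  pose proof (Rabs_pos T0). pose proof (Rle_abs T0). pose proof (Rle_abs K).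
  assert (HT : 0 < T) by (unfold T; lra).
  specialize (H T ltac:(unfold T; lra) HT).
  apply (Rmult_le_compat_r T) in H; [|lra].
  replace (K / T * T) with K in H by (field; lra).
  assert (x * T = x * (Rabs T0 + 1) + Rabs K) by (unfold T; field; lra).
  nra.
Qed.

Lemma eq_of_Cmod_le_div (z w : C) (K T0 : R) :
  (forall T, T0 <= T -> 0 < T -> Cmod (z - w) <= K / T) -> z = w.
Proof.
  intro H. apply le_0_of_le_div in H.
  assert (z - w = 0)%C by (apply Cmod_eq_0; pose proof (Cmod_ge_0 (z - w)); lra).
  transitivity (z - w + w)%C; [ring | rewrite H0; ring].
Qed.

(** The tool for computing [LI]: a candidate is the integral once the truncations approach it at
    some rate K / T. The threshold [T0] is for estimates that hold only for large T. *)
Lemma LI_unique (g : R -> C) (M K T0 : R) (l : C) : Ccont g -> decays M g ->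
  (forall T, T0 <= T -> 0 < T -> Cmod (l - Cint g (- T) T) <= K / T) -> LI g = l.
Proof.
  intros Hg Hd H. apply eq_of_Cmod_le_div with (4 * M + K) T0. intros T HT0 HT.
  replace (LI g - l)%C with ((LI g - Cint g (- T) T) - (l - Cint g (- T) T))%C by ring.
  eapply Rle_trans; [apply Cmod_triangle|]. rewrite Cmod_opp.
  pose proof (LI_tail g M T Hg Hd HT). pose proof (H T HT0 HT).
  replace ((4 * M + K) / T) with (4 * M / T + K / T) by (field; lra). lra.
Qed.

(** Truncation at 1 leaves tails of at most 4 M and an integral over [-1, 1] of at most 2 M. *)
Lemma LI_bound (g : R -> C) (M : R) : Ccont g -> decays M g -> Cmod (LI g) <= 6 * M.
Proof.
  intros Hg Hd.
  replace (LI g) with ((LI g - Cint g (- (1))%R 1) + Cint g (- (1))%R 1)%C by ring.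
  eapply Rle_trans; [apply Cmod_triangle|].
  pose proof (LI_tail g M 1 Hg Hd ltac:(lra)).
  pose proof (Cint_le_const g M (- (1)) 1 Hg ltac:(lra) (fun t _ => decays_bounded M g Hd t)). lra.
Qed.

Lemma decays_plus (M N : R) (f g : R -> C) : decays M f -> decays N g ->
  decays (M + N) (fun t => f t + g t)%C.
Proof.
  intros Hf Hg t. eapply Rle_trans; [apply Cmod_triangle|].
  specialize (Hf t); specialize (Hg t).
  replace ((M + N) / (1 + t ^ 2)) with (M / (1 + t ^ 2) + N / (1 + t ^ 2)) by (field; repeat split; apply Rgt_not_eq, one_plus_sqr_pos). lra.
Qed.

Lemma decays_scal (M : R) (c : C) (f : R -> C) : decays M f ->
  decays (Cmod c * M) (fun t => c * f t)%C.
Proof.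
  intros Hf t. rewrite Cmod_mult. specialize (Hf t).
  replace (Cmod c * M / (1 + t ^ 2)) with (Cmod c * (M / (1 + t ^ 2))) by (field; repeat split; apply Rgt_not_eq, one_plus_sqr_pos).
  apply Rmult_le_compat_l; [apply Cmod_ge_0 | assumption].
Qed.

Lemma LI_plus (M N : R) (f g : R -> C) : Ccont f -> Ccont g -> decays M f -> decays N g ->
  LI (fun t => f t + g t)%C = (LI f + LI g)%C.
Proof.
  intros Hf Hg HM HN.
  apply LI_unique with (M + N) (4 * M + 4 * N) 0;
  [apply Ccont_plus; assumption | apply decays_plus; assumption |].
  intros T _ HT. rewrite Cint_plus by assumption.
  replace (LI f + LI g - (Cint f (- T) T + Cint g (- T) T))%C
    with ((LI f - Cint f (- T) T) + (LI g - Cint g (- T) T))%C by ring.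
  eapply Rle_trans; [apply Cmod_triangle|].
  pose proof (LI_tail f M T Hf HM HT). pose proof (LI_tail g N T Hg HN HT).
  replace ((4 * M + 4 * N) / T) with (4 * M / T + 4 * N / T) by (field; lra). lra.
Qed.

Lemma LI_scal (M : R) (c : C) (f : R -> C) : Ccont f -> decays M f ->
  LI (fun t => c * f t)%C = (c * LI f)%C.
Proof.
  intros Hf HM.
  apply LI_unique with (Cmod c * M) (Cmod c * (4 * M)) 0;
  [apply Ccont_mult; [apply Ccont_const | assumption] | apply decays_scal; assumption |].
  intros T _ HT. rewrite Cint_scal by assumption.
  replace (c * LI f - c * Cint f (- T) T)%C with (c * (LI f - Cint f (- T) T))%C by ring.
  rewrite Cmod_mult. pose proof (LI_tail f M T Hf HM HT).
  replace (Cmod c * (4 * M) / T) with (Cmod c * (4 * M / T)) by (field; lra).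
  apply Rmult_le_compat_l; [apply Cmod_ge_0 | assumption].
Qed.

(** The constant is that of Peetre's inequality 1 + t^2 <= 2 (1 + s^2) (1 + (t + s)^2). *)
Lemma decays_shift (M s : R) (g : R -> C) : decays M g ->
  decays (M * (2 * (1 + s ^ 2))) (fun t => g (t + s)).
Proof.
  intros Hd t. pose proof (decays_pos M g Hd).
  eapply Rle_trans; [apply Hd|]. unfold Rdiv. rewrite Rmult_assoc.
  apply Rmult_le_compat_l; trivial.
  apply Rmult_le_reg_l with ((1 + (t + s) ^ 2) * (1 + t ^ 2));
  [apply Rmult_lt_0_compat; apply one_plus_sqr_pos|].
  replace ((1 + (t + s) ^ 2) * (1 + t ^ 2) * / (1 + (t + s) ^ 2)) with (1 + t ^ 2) by (field; repeat split; apply Rgt_not_eq, one_plus_sqr_pos).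
  replace ((1 + (t + s) ^ 2) * (1 + t ^ 2) * (2 * (1 + s ^ 2) * / (1 + t ^ 2)))
    with ((1 + (t + s) ^ 2) * (2 * (1 + s ^ 2))) by (field; repeat split; apply Rgt_not_eq, one_plus_sqr_pos).
  pose proof (pow2_ge_0 (t + 2 * s)). pose proof (pow2_ge_0 ((t + s) * s)). nra.
Qed.

(** The windows [-T + s, T + s] and [-T, T] differ by two strips. For T >= 2 s these lie in tails
    beyond T - s >= T / 2 and beyond T, so that 7 = 4 + 2 + 1. *)
Lemma LI_shift_pos (M s : R) (g : R -> C) : Ccont g -> decays M g -> 0 <= s ->
  LI (fun t => g (t + s)) = LI g.
Proof.
  intros Hg Hd Hs. pose proof (decays_pos M g Hd).
  apply LI_unique with (M * (2 * (1 + s ^ 2))) (7 * M) (2 * s).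
  - apply Ccont_comp; [assumption | apply continuous_shift].
  - apply decays_shift, Hd.
  - intros T HsT HT. rewrite Cint_comp_plus by assumption.
    replace (LI g - Cint g (- T + s) (T + s))%C
      with ((LI g - Cint g (- T) T) + (Cint g (- T) (- (T - s)) + - Cint g T (T + s)))%C.
    + eapply Rle_trans; [apply Cmod_triangle|].
      pose proof (Cmod_triangle (Cint g (- T) (- (T - s))) (- Cint g T (T + s))) as H1.
      rewrite Cmod_opp in H1.
      pose proof (LI_tail g M T Hg Hd HT).
      pose proof (Cint_tail_left g M (T - s) T Hg Hd ltac:(lra)).
      pose proof (Cint_tail_right g M T (T + s) Hg Hd ltac:(lra)).
      assert (M / (T - s) <= 2 * M / T).
      { apply Rle_div_l; [lra|].
        replace (2 * M / T * (T - s)) with (M + M * ((T - 2 * s) / T)) by (field; lra).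
        assert (0 <= (T - 2 * s) / T) by (apply Rdiv_le_0_compat; lra). nra. }
      replace (7 * M / T) with (4 * M / T + (2 * M / T + M / T)) by (field; lra). lra.
    + replace (- T + s) with (- (T - s)) by ring.
      rewrite <- (Cint_Chasles g (- T) (- (T - s)) T) by assumption.
      rewrite <- (Cint_Chasles g (- (T - s)) T (T + s)) by assumption. ring.
Qed.

Lemma LI_shift (M s : R) (g : R -> C) : Ccont g -> decays M g ->
  LI (fun t => g (t + s)) = LI g.
Proof.
  intros Hg Hd. destruct (Rle_dec 0 s) as [Hs|Hs]; [apply LI_shift_pos with M; assumption|].
  rewrite <- (LI_shift_pos (M * (2 * (1 + s ^ 2))) (- s) (fun t => g (t + s))).
  - f_equal. apply functional_extensionality; intro t. f_equal; ring.
  - apply Ccont_comp; [assumption | apply continuous_shift].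
  - apply decays_shift, Hd.
  - lra.
Qed.

(** * Fourier inversion *)

Definition cis (x : R) : C := (cos x, sin x).

Lemma Cmod_cis (x : R) : Cmod (cis x) = 1.
Proof.
  unfold Cmod, cis; simpl. rewrite !Rmult_1_r.
  pose proof (sin2_cos2 x) as H; unfold Rsqr in H.
  rewrite Rplus_comm, H; apply sqrt_1.
Qed.

Lemma cis_plus (x y : R) : cis (x + y) = (cis x * cis y)%C.
Proof. unfold cis; apply C_ext; simpl; rewrite ?cos_plus, ?sin_plus; ring. Qed.

Lemma Ccont_cis : Ccont cis.
Proof. intro t; split; [apply continuous_cos | apply continuous_sin]. Qed.

Lemma Ccont_cis_scal (x : R) : Ccont (fun t => cis (t * x)).
Proof.
  apply (Ccont_comp cis (fun t => t * x)); [apply Ccont_cis|].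
  intro t. apply (continuous_mult (K := R_AbsRing) (fun t : R => t) (fun _ => x));
  [apply continuous_id | apply continuous_const].
Qed.

Lemma Ccont_cis_scal_l (x : R) : Ccont (fun t => cis (x * t)).
Proof.
  replace (fun t => cis (x * t)) with (fun t => cis (t * x))
    by (apply functional_extensionality; intro; f_equal; ring).
  apply Ccont_cis_scal.
Qed.

Lemma decays_mult_cis (M x : R) (g : R -> C) : decays M g -> decays M (fun t => g t * cis (t * x))%C.
Proof. intros H t. rewrite Cmod_mult, Cmod_cis, Rmult_1_r. apply H. Qed.

Lemma LI_le (F : R -> C) (M B : R) : Ccont F -> decays M F ->
  (forall T, 0 < T -> Cmod (Cint F (- T) T) <= B) -> Cmod (LI F) <= B.
Proof.
  intros HF Hd H. apply Rminus_le, (le_0_of_le_div _ (4 * M) 1). intros T _ HT.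
  pose proof (LI_tail F M T HF Hd HT). pose proof (H T HT).
  pose proof (Cmod_triangle (LI F - Cint F (- T) T) (Cint F (- T) T)) as H2.
  replace (LI F - Cint F (- T) T + Cint F (- T) T)%C with (LI F) in H2 by ring. lra.
Qed.

Lemma Cint_Cexp_line (u : C) (a b : R) : u <> RtoC 0 ->
  Cint (fun x => Cexp (RtoC x * u)) a b = ((Cexp (RtoC b * u) - Cexp (RtoC a * u)) / u)%C.
Proof.
  intro Hu.
  assert (H : (u * Cint (fun x => Cexp (RtoC x * u)) a b)%C
              = (Cexp (RtoC b * u) - Cexp (RtoC a * u))%C).
  { rewrite <- Cint_scal by ccont.
    apply (Cint_derive (fun x => Cexp (RtoC x * u))%C);
    [apply Cexp_line_Re | apply Cexp_line_Im | ccont]. }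
  rewrite <- H. field. assumption.
Qed.

(** * The Poisson kernel as the Fourier transform of exponential damping *)

Definition poisson (e t : R) : R := 2 * e / (e ^ 2 + t ^ 2).

Lemma poisson_den_pos (e t : R) : 0 < e -> 0 < e ^ 2 + t ^ 2.
Proof. intro; pose proof (pow2_ge_0 t); nra. Qed.

Lemma poisson_pos (e t : R) : 0 < e -> 0 <= poisson e t.
Proof.
  intro He. apply Rdiv_le_0_compat; [lra | apply poisson_den_pos, He].
Qed.

Lemma continuous_poisson (e t : R) : 0 < e -> continuous (poisson e) t.
Proof.
  intro He. apply (ex_derive_continuous (V := R_NormedModule)). unfold poisson. auto_derive.
  pose proof (poisson_den_pos e t He); simpl in *; lra.
Qed.

Lemma RInt_poisson (e T : R) : 0 < e -> RInt (poisson e) (- T) T = 4 * atan (T / e).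
Proof.
  intro He.
  replace (4 * atan (T / e)) with (minus (2 * atan (T / e)) (2 * atan (- T / e))).
  - apply is_RInt_unique, (is_RInt_derive (V := R_CompleteNormedModule) (fun t => 2 * atan (t / e)));
    intros x _.
    + unfold poisson. auto_derive; trivial.
      pose proof (poisson_den_pos e x He). unfold Rsqr; field; simpl in *; lra.
    + apply continuous_poisson, He.
  - unfold minus, plus, opp; simpl. replace (- T / e) with (- (T / e)) by (field; lra).
    rewrite atan_opp; ring.
Qed.

Lemma poisson_sqr_le (e t : R) : 0 < e -> t ^ 2 * poisson e t <= 2 * e.
Proof.
  intro He. unfold poisson. pose proof (poisson_den_pos e t He).
  replace (t ^ 2 * (2 * e / (e ^ 2 + t ^ 2))) with (t ^ 2 * (2 * e) / (e ^ 2 + t ^ 2)) by (field; lra).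
  apply Rle_div_l; trivial. assert (0 < e ^ 3) by (apply pow_lt, He). nra.
Qed.

Lemma RInt_atan (T : R) : RInt (fun t => / (1 + t ^ 2)) (- T) T = 2 * atan T.
Proof.
  replace (2 * atan T) with (minus (atan T) (atan (- T))).
  - apply is_RInt_unique, (is_RInt_derive (V := R_CompleteNormedModule) atan); intros x _.
    + auto_derive; trivial. unfold Rsqr; field.
      pose proof (one_plus_sqr_pos x); simpl in *; lra.
    + apply (ex_derive_continuous (V := R_NormedModule)). auto_derive.
      pose proof (one_plus_sqr_pos x); simpl in *; lra.
  - unfold minus, plus, opp; simpl. rewrite atan_opp; ring.
Qed.

Lemma atan_lt_PI2 (x : R) : atan x < PI / 2.
Proof. apply atan_bound. Qed.

(** The left side is atan (1 / x), and atan has derivative at most 1. This supplies the rate at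
    which the mass of the Poisson kernel is exhausted. *)
Lemma atan_compl_le (x : R) : 0 < x -> PI / 2 - atan x <= / x.
Proof.
  intro Hx. rewrite <- (atan_inv x) by assumption.
  assert (Hy : 0 < / x) by (apply Rinv_0_lt_compat, Hx). set (y := / x) in *.
  destruct (MVT_gen atan 0 y (fun z => / (1 + z ^ 2))) as [c [Hc E]].
  - intros z _. auto_derive; trivial. unfold Rsqr; field.
    pose proof (one_plus_sqr_pos z); simpl in *; lra.
  - intros z _. apply derivable_continuous_pt, derivable_pt_atan.
  - rewrite atan_0, !Rminus_0_r in E. rewrite E.
    assert (/ (1 + c ^ 2) <= 1).
    { rewrite <- Rinv_1. apply Rinv_le_contravar; [lra|]. pose proof (pow2_ge_0 c); lra. }
    nra.
Qed.

(** For e <= 1 one has e^2 (1 + t^2) <= e^2 + t^2; the restriction on [e] in what follows comes from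
    here. *)
Lemma decays_poisson (e : R) : 0 < e <= 1 -> decays (2 / e) (fun t => RtoC (poisson e t)).
Proof.
  intros He t. rewrite Cmod_R, Rabs_pos_eq by (apply poisson_pos; lra).
  unfold poisson. pose proof (poisson_den_pos e t ltac:(lra)). pose proof (one_plus_sqr_pos t).
  apply (Rle_div_l (2 * e) (2 / e / (1 + t ^ 2)) (e ^ 2 + t ^ 2)); trivial.
  replace (2 / e / (1 + t ^ 2) * (e ^ 2 + t ^ 2))
    with (2 * (e ^ 2 + t ^ 2) / (e * (1 + t ^ 2))) by (field; lra).
  apply (Rle_div_r (2 * e) (2 * (e ^ 2 + t ^ 2)) (e * (1 + t ^ 2))); [apply Rmult_lt_0_compat; lra|].
  pose proof (pow2_ge_0 t). assert (e ^ 2 <= 1) by nra. nra.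
Qed.

Lemma LI_poisson (e : R) : 0 < e <= 1 -> LI (fun t => RtoC (poisson e t)) = RtoC (2 * PI).
Proof.
  intro He.
  assert (Hc : Ccont (fun t => RtoC (poisson e t)))
    by (apply Ccont_RtoC; intro; apply continuous_poisson; lra).
  apply LI_unique with (2 / e) (4 * e) 1; trivial.
  - apply decays_poisson, He.
  - intros T _ HT.
    replace (Cint (fun t => RtoC (poisson e t)) (- T) T) with (RtoC (4 * atan (T / e))).
    + rewrite <- RtoC_minus, Cmod_R. pose proof (atan_lt_PI2 (T / e)).
      rewrite Rabs_pos_eq by lra.
      pose proof (atan_compl_le (T / e) ltac:(apply Rdiv_lt_0_compat; lra)).
      replace (4 * e / T) with (4 * / (T / e)) by (field; lra). lra.
    + rewrite <- RInt_poisson by lra. apply C_ext; simpl; [reflexivity|].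
      rewrite RInt_const; unfold scal; simpl; unfold mult; simpl; ring.
Qed.

Definition damp (e x : R) : C := RtoC (exp (- e * Rabs x)).

Lemma Ccont_damp (e : R) : Ccont (damp e).
Proof.
  apply Ccont_RtoC. intro t.
  apply (continuous_comp (fun x => - e * Rabs x) exp); [|apply continuous_exp].
  apply (continuous_mult (K := R_AbsRing) (fun _ => - e) (fun x : R => Rabs x));
  [apply continuous_const | apply continuous_Rabs].
Qed.

Lemma Cmod_damp (e x : R) : Cmod (damp e x) = exp (- e * Rabs x).
Proof. unfold damp; rewrite Cmod_R. apply Rabs_pos_eq, Rlt_le, exp_pos. Qed.

Lemma Cmod_damp_le (e x : R) : 0 < e -> Cmod (damp e x) <= 1.
Proof.
  intro He. rewrite Cmod_damp, <- exp_0. apply exp_le. pose proof (Rabs_pos x). nra.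
Qed.

(** The Fourier integral of [damp e], truncated so that it can be exchanged with another integral
    over a bounded rectangle. *)
Definition kernel (e S t : R) : C := Cint (fun x => damp e x * cis (t * x))%C (- S) S.

(** With u = -e + it and v = e + it the integrand is exp(xu) for x > 0 and exp(xv) for x < 0. The
    end point 0 contributes -1/u + 1/v, the Poisson kernel; each of the ends S and -S contributes at
    most exp(-eS) / e <= 1 / (e^2 S). *)
Lemma kernel_poisson (e S t : R) : 0 < e -> 0 < S ->
  Cmod (RtoC (poisson e t) - kernel e S t) <= (2 / e ^ 2) / S.
Proof.
  intros He HS.
  set (u := (- e, t) : C). set (v := (e, t) : C).
  assert (Hv : v <> RtoC 0) by (intro H; injection H; intros; lra).
  assert (Hu : u <> RtoC 0) by (intro H; injection H; intros; lra).
  assert (Hc : Ccont (fun x => damp e x * cis (t * x))%C)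
    by (apply Ccont_mult; [apply Ccont_damp | apply Ccont_cis_scal_l]).
  assert (E : kernel e S t = ((Cexp (RtoC S * u) - 1) / u + (1 - Cexp (RtoC (- S) * v)) / v)%C).
  { unfold kernel. rewrite <- (Cint_Chasles _ (- S) 0 S) by assumption.
    rewrite Cplus_comm. f_equal.
    - rewrite (Cint_ext _ (fun x => Cexp (RtoC x * u))).
      + rewrite Cint_Cexp_line, Cmult_0_l, Cexp_0 by assumption. reflexivity.
      + intros x Hx. rewrite Rmin_left in Hx by lra.
        rewrite Cexp_line. unfold damp, cis. rewrite Rabs_pos_eq by lra.
        apply C_ext; unfold u; simpl; rewrite (Rmult_comm t x), (Rmult_comm x (- e)); ring.
    - rewrite (Cint_ext _ (fun x => Cexp (RtoC x * v))).
      + rewrite Cint_Cexp_line, Cmult_0_l, Cexp_0 by assumption. reflexivity.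
      + intros x Hx. rewrite Rmax_right in Hx by lra.
        rewrite Cexp_line. unfold damp, cis. rewrite Rabs_left by lra.
        replace (- e * - x) with (x * e) by ring.
        apply C_ext; unfold v; simpl; rewrite (Rmult_comm t x); ring. }
  assert (E' : RtoC (poisson e t) = (- / u + / v)%C).
  { apply C_ext; unfold poisson, u, v; simpl; field; pose proof (poisson_den_pos e t He); simpl in *; lra. }
  rewrite E, E'.
  replace (- / u + / v - ((Cexp (RtoC S * u) - 1) / u + (1 - Cexp (RtoC (- S) * v)) / v))%C
    with (- (Cexp (RtoC S * u) / u) + Cexp (RtoC (- S) * v) / v)%C by (field; split; assumption).
  assert (Hexp : exp (- (e * S)) <= / (e * S)).
  { rewrite exp_Ropp. apply Rinv_le_contravar; [nra|]. pose proof (exp_ineq1_le (e * S)); lra. }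
  assert (Hm : forall w z, w <> RtoC 0 -> e <= Cmod w -> Cmod z = exp (- (e * S)) ->
                 Cmod (z / w) <= / (e ^ 2 * S)).
  { intros w z Hw Hew Hz. rewrite Cmod_div, Hz by assumption.
    apply Rle_trans with (/ (e * S) * / e); [|apply Req_le; field; lra].
    apply Rmult_le_compat; trivial.
    - apply Rlt_le, exp_pos.
    - apply Rlt_le, Rinv_0_lt_compat; lra.
    - apply Rinv_le_contravar; lra. }
  eapply Rle_trans; [apply Cmod_triangle|]. rewrite Cmod_opp.
  replace (2 / e ^ 2 / S) with (/ (e ^ 2 * S) + / (e ^ 2 * S)) by (field; lra).
  apply Rplus_le_compat; apply Hm; trivial.
  - eapply Rle_trans; [|apply re_le_Cmod]. unfold u; simpl. rewrite Rabs_Ropp. apply Rle_abs.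
  - rewrite Cmod_Cexp. f_equal. unfold u; simpl; ring.
  - eapply Rle_trans; [|apply re_le_Cmod]. unfold v; simpl. apply Rle_abs.
  - rewrite Cmod_Cexp. f_equal. unfold v; simpl; ring.
Qed.

Lemma Ccont_kernel (e S : R) : Ccont (kernel e S).
Proof.
  apply (Ccont_Cint_param (fun t x => damp e x * cis (t * x))%C).
  apply (Ccont2_mult (fun _ x => damp e x) (fun t x => cis (t * x))).
  - apply Ccont2_r, Ccont_damp.
  - apply (Ccont2_comp cis (fun t x => t * x)); [apply Ccont_cis|].
    intros x y; apply continuity_2d_pt_mult; [apply continuity_2d_pt_id1 | apply continuity_2d_pt_id2].
Qed.

Lemma kernel_le (e S t : R) : 0 < e -> 0 < S -> Cmod (kernel e S t) <= 2 * S.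
Proof.
  intros He HS. replace (2 * S) with (1 * (S - - S)) by ring.
  apply Cint_le_const; [|lra|].
  - apply Ccont_mult; [apply Ccont_damp | apply Ccont_cis_scal_l].
  - intros x _. rewrite Cmod_mult, Cmod_cis, Rmult_1_r. apply Cmod_damp_le, He.
Qed.

Lemma decays_mult_bounded (M N : R) (f k : R -> C) : decays M f -> (forall t, Cmod (k t) <= N) ->
  decays (M * N) (fun t => f t * k t)%C.
Proof.
  intros Hf Hk t. rewrite Cmod_mult.
  replace (M * N / (1 + t ^ 2)) with (M / (1 + t ^ 2) * N)
    by (field; apply Rgt_not_eq, one_plus_sqr_pos).
  apply Rmult_le_compat; try apply Cmod_ge_0; [apply Hf | apply Hk].
Qed.

Lemma Rle_eps_lin (x a K : R) : 0 <= K -> (forall e, 0 < e <= 1 -> x <= a + e * K) -> x <= a.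
Proof.
  intros HK H. destruct (Rle_dec x a) as [|Hn]; [assumption|exfalso].
  set (e := Rmin 1 ((x - a) / (2 * (K + 1)))).
  assert (He : 0 < (x - a) / (2 * (K + 1))) by (apply Rdiv_lt_0_compat; lra).
  assert (0 < e <= 1) by (unfold e; split; [apply Rmin_glb_lt; lra | apply Rmin_l]).
  specialize (H e H0).
  assert (e * K <= (x - a) / (2 * (K + 1)) * (K + 1))
    by (apply Rmult_le_compat; try lra; apply Rmin_r).
  replace ((x - a) / (2 * (K + 1)) * (K + 1)) with ((x - a) / 2) in H1 by (field; lra). lra.
Qed.

(** * Inversion of compactly supported Fourier transforms *)

Section Inversion.
Variables (g G : R -> C) (M S : R).
Hypothesis Hg : Ccont g.
Hypothesis Hd : decays M g.
Hypothesis HG : Ccont G.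
Hypothesis HGE : forall x, G x = LI (fun t => g t * cis (t * x))%C.
Hypothesis HS : 0 < S.
Hypothesis HG0 : forall x, S < Rabs x -> G x = RtoC 0.

(** As [G] vanishes outside [-S, S], the right side may be taken over [-S', S']. There the two
    integrals are exchanged with t restricted to [-T, T]; the restriction costs at most 4 M / T for
    each x, uniformly in x. *)
Lemma damped_eq_LI_kernel (e S' : R) : 0 < e -> S <= S' ->
  LI (fun t => g t * kernel e S' t)%C = Cint (fun x => damp e x * G x)%C (- S) S.
Proof.
  intros He HS'.
  apply LI_unique with (M * (2 * S')) (4 * M * (2 * S')) 1.
  - apply Ccont_mult; [assumption | apply Ccont_kernel].
  - apply decays_mult_bounded; trivial. intro t; apply kernel_le; lra.
  - intros T _ HT.
    assert (HdG : Ccont (fun x => damp e x * G x)%C) by (apply Ccont_mult; [apply Ccont_damp | assumption]).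
    assert (EA : Cint (fun x => damp e x * G x)%C (- S) S = Cint (fun x => damp e x * G x)%C (- S') S').
    { rewrite <- (Cint_Chasles _ (- S') (- S) S') by assumption.
      rewrite <- (Cint_Chasles _ (- S) S S') by assumption.
      rewrite (Cint_zero _ (- S') (- S)), (Cint_zero _ S S'); [ring | |].
      - intros x Hx. rewrite Rmin_left in Hx by lra. rewrite HG0; [ring|].
        rewrite Rabs_pos_eq; lra.
      - intros x Hx. rewrite Rmax_right in Hx by lra. rewrite HG0; [ring|].
        rewrite Rabs_left; lra. }
    set (F := fun x t => (damp e x * (g t * cis (t * x)))%C).
    assert (HF : Ccont2 F).
    { apply (Ccont2_mult (fun x _ => damp e x) (fun x t => g t * cis (t * x))%C).
      - apply Ccont2_l, Ccont_damp.
      - apply (Ccont2_mult (fun _ t => g t) (fun x t => cis (t * x))).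
        + apply Ccont2_r, Hg.
        + apply (Ccont2_comp cis (fun x t => t * x)); [apply Ccont_cis|].
          intros x y; apply continuity_2d_pt_mult;
          [apply continuity_2d_pt_id2 | apply continuity_2d_pt_id1]. }
    assert (EB : Cint (fun t => g t * kernel e S' t)%C (- T) T
                 = Cint (fun x => Cint (F x) (- T) T) (- S') S').
    { rewrite (Cint_exchange F) by assumption.
      f_equal. apply functional_extensionality; intro t. unfold kernel.
      rewrite <- Cint_scal by (apply Ccont_mult; [apply Ccont_damp | apply Ccont_cis_scal_l]).
      f_equal. apply functional_extensionality; intro x. unfold F; ring. }
    rewrite EA, EB. rewrite <- Cint_minus by (trivial; apply Ccont_Cint_param, HF).
    replace (4 * M * (2 * S') / T) with ((4 * M / T) * (S' - - S')) by (field; lra).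
    apply Cint_le_const; [|lra|].
    + apply Ccont_minus; [assumption | apply Ccont_Cint_param, HF].
    + intros x _. unfold F.
      assert (Hgc : Ccont (fun t => g t * cis (t * x))%C)
        by (apply Ccont_mult; [assumption | apply Ccont_cis_scal]).
      rewrite Cint_scal by assumption. rewrite HGE.
      match goal with |- Cmod ?z <= _ =>
        replace z with (damp e x * (LI (fun t => g t * cis (t * x))
           - Cint (fun t => g t * cis (t * x)) (- T) T))%C by ring end.
      rewrite Cmod_mult. rewrite <- (Rmult_1_l (4 * M / T)).
      apply Rmult_le_compat; try apply Cmod_ge_0; [apply Cmod_damp_le, He|].
      apply LI_tail; trivial. apply decays_mult_cis, Hd.
Qed.

(** The left side does not depend on the truncation S' >= S, whereas the truncated kernel converges
    to the Poisson kernel uniformly in t at the rate 1 / S'. *)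
Lemma damped_eq_LI_poisson (e : R) : 0 < e <= 1 ->
  Cint (fun x => damp e x * G x)%C (- S) S = LI (fun t => g t * RtoC (poisson e t))%C.
Proof.
  intro He.
  assert (HP : Ccont (fun t => RtoC (poisson e t)))
    by (apply Ccont_RtoC; intro; apply continuous_poisson; lra).
  assert (HgP : Ccont (fun t => g t * RtoC (poisson e t))%C) by (apply Ccont_mult; assumption).
  assert (HPb : forall t, Cmod (RtoC (poisson e t)) <= 2 / e)
    by (apply decays_bounded, decays_poisson, He).
  symmetry. apply eq_of_Cmod_le_div with (6 * (M * (2 / e ^ 2))) S.
  intros S' HS' HS'0. rewrite <- (damped_eq_LI_kernel e S') by lra.
  assert (HgK : Ccont (fun t => g t * kernel e S' t)%C)
    by (apply Ccont_mult; [assumption | apply Ccont_kernel]).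
  assert (E : LI (fun t => g t * RtoC (poisson e t))%C =
    (LI (fun t => g t * (RtoC (poisson e t) - kernel e S' t)) + LI (fun t => g t * kernel e S' t))%C).
  { rewrite <- (LI_plus (M * (2 / e ^ 2 / S')) (M * (2 * S'))).
    - f_equal. apply functional_extensionality; intro t; ring.
    - apply Ccont_mult; [assumption|]. apply Ccont_minus; [assumption | apply Ccont_kernel].
    - assumption.
    - apply decays_mult_bounded; trivial. intro; apply kernel_poisson; lra.
    - apply decays_mult_bounded; trivial. intro; apply kernel_le; lra. }
  rewrite E.
  match goal with |- Cmod (?a + ?b - ?b) <= _ => replace (a + b - b)%C with a by ring end.
  replace (6 * (M * (2 / e ^ 2)) / S') with (6 * (M * (2 / e ^ 2 / S'))) by (field; lra).
  apply LI_bound.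
  - apply Ccont_mult; [assumption|]. apply Ccont_minus; [assumption | apply Ccont_kernel].
  - apply decays_mult_bounded; trivial. intro; apply kernel_poisson; lra.
Qed.

(* Together with [t ^ 2 * poisson e t <= 2 * e], a bound of this shape makes it unnecessary to
   split the integral against the Poisson kernel into small and large [t]. *)
Lemma continuous_at_0_bound (eta : R) : 0 < eta ->
  exists K, 0 <= K /\ forall t, Cmod (g t - g 0) <= eta + K * (t ^ 2 / (1 + t ^ 2)).
Proof.
  intro Heta. pose proof (decays_pos M g Hd) as HM.
  assert (Hc : continuous (fun t => Cmod (g t - g 0)) 0)
    by (apply Ccont_Cmod; apply Ccont_minus; [assumption | apply Ccont_const]).
  destruct (proj1 (filterlim_locally _ _) Hc (mkposreal eta Heta)) as [d Hdl].
  pose proof (cond_pos d) as Hd0.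
  (* For |t| >= d the difference is at most 2 M, and there (1 + 1 / d^2) t^2 / (1 + t^2) is at least
     1. *)
  exists (2 * M * (1 + / d ^ 2)). split.
  - assert (0 < / d ^ 2) by (apply Rinv_0_lt_compat; nra). nra.
  - intro t. pose proof (one_plus_sqr_pos t) as H1. pose proof (pow2_ge_0 t) as H2.
    assert (Hp : 0 <= t ^ 2 / (1 + t ^ 2)) by (apply Rdiv_le_0_compat; lra).
    assert (Hid : 0 < / d ^ 2) by (apply Rinv_0_lt_compat; nra).
    destruct (Rlt_dec (Rabs t) d) as [Ht|Ht].
    + assert (Hb : ball 0 d t) by (change (Rabs (t - 0) < d); rewrite Rminus_0_r; exact Ht).
      specialize (Hdl t Hb). change (Rabs (Cmod (g t - g 0) - Cmod (g 0 - g 0)) < eta) in Hdl.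
      replace (g 0 - g 0)%C with (RtoC 0) in Hdl by ring. rewrite Cmod_0, Rminus_0_r in Hdl.
      rewrite Rabs_pos_eq in Hdl by apply Cmod_ge_0.
      assert (0 <= 2 * M * (1 + / d ^ 2) * (t ^ 2 / (1 + t ^ 2)))
        by (apply Rmult_le_pos; [nra | assumption]). lra.
    + assert (Hb : Cmod (g t - g 0) <= 2 * M).
      { eapply Rle_trans; [apply Cmod_triangle|]. rewrite Cmod_opp.
        pose proof (decays_bounded M g Hd t). pose proof (decays_bounded M g Hd 0). lra. }
      assert (Ht2 : d ^ 2 <= t ^ 2).
      { rewrite <- (pow2_abs t). apply pow_incr. lra. }
      assert (1 <= (1 + / d ^ 2) * (t ^ 2 / (1 + t ^ 2))).
      { apply Rmult_le_reg_r with (d ^ 2 * (1 + t ^ 2)); [nra|].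
        replace ((1 + / d ^ 2) * (t ^ 2 / (1 + t ^ 2)) * (d ^ 2 * (1 + t ^ 2)))
          with ((d ^ 2 + 1) * t ^ 2) by (field; lra). nra. }
      rewrite Rmult_assoc. nra.
Qed.

(** The mass 2 pi of the kernel accounts for [eta]. In the other term the kernel absorbs t^2 at the
    price 2 e, and the remaining factor 1 / (1 + t^2) has integral pi. *)
Lemma LI_poisson_approx (e eta K : R) : 0 < e <= 1 -> 0 < eta -> 0 <= K ->
  (forall t, Cmod (g t - g 0) <= eta + K * (t ^ 2 / (1 + t ^ 2))) ->
  Cmod (LI (fun t => g t * RtoC (poisson e t))%C - RtoC (2 * PI) * g 0) <= 2 * PI * (eta + e * K).
Proof.
  intros He Heta HK H.
  assert (HP : Ccont (fun t => RtoC (poisson e t)))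
    by (apply Ccont_RtoC; intro; apply continuous_poisson; lra).
  assert (HPd := decays_poisson e He).
  assert (Hb : forall t, Cmod (g t - g 0) <= 2 * M).
  { intro t. eapply Rle_trans; [apply Cmod_triangle|]. rewrite Cmod_opp.
    pose proof (decays_bounded M g Hd t). pose proof (decays_bounded M g Hd 0). lra. }
  assert (Hcd : Ccont (fun t => (g t - g 0%R) * RtoC (poisson e t))%C)
    by (apply Ccont_mult; [apply Ccont_minus; [assumption | apply Ccont_const] | assumption]).
  assert (Hdd : decays (2 * M * (2 / e)) (fun t => (g t - g 0%R) * RtoC (poisson e t))%C).
  { intro t. rewrite Cmod_mult.
    replace (2 * M * (2 / e) / (1 + t ^ 2)) with (2 * M * (2 / e / (1 + t ^ 2)))
      by (field; pose proof (one_plus_sqr_pos t); simpl in *; lra).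
    apply Rmult_le_compat; try apply Cmod_ge_0; [apply Hb | apply HPd]. }
  replace (LI (fun t => g t * RtoC (poisson e t)) - RtoC (2 * PI) * g 0%R)%C
    with (LI (fun t => (g t - g 0%R) * RtoC (poisson e t)))%C.
  - apply LI_le with (2 * M * (2 / e)); trivial. intros T HT.
    apply Rle_trans with (RInt (fun t => eta * poisson e t + 2 * e * K * / (1 + t ^ 2)) (- T) T).
    + assert (Hci : forall t, continuous (fun t => / (1 + t ^ 2)) t).
      { intro t. apply (ex_derive_continuous (V := R_NormedModule)). auto_derive.
        pose proof (one_plus_sqr_pos t); simpl in *; lra. }
      apply Cint_le; trivial; [|lra|].
      * intro t. apply (continuous_plus (V := R_NormedModule));
        apply (continuous_mult (K := R_AbsRing)); try apply continuous_const.
        -- apply continuous_poisson; lra.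
        -- apply Hci.
      * intros t _. rewrite Cmod_mult, Cmod_R, Rabs_pos_eq by (apply poisson_pos; lra).
        pose proof (poisson_pos e t ltac:(lra)) as Hp. pose proof (poisson_sqr_le e t ltac:(lra)) as Hs.
        eapply Rle_trans; [apply Rmult_le_compat_r; [exact Hp | apply H]|].
        rewrite Rmult_plus_distr_r. apply Rplus_le_compat_l.
        replace (K * (t ^ 2 / (1 + t ^ 2)) * poisson e t)
          with ((t ^ 2 * poisson e t) * (K * / (1 + t ^ 2)))
          by (field; apply Rgt_not_eq, one_plus_sqr_pos).
        rewrite (Rmult_assoc (2 * e)). apply Rmult_le_compat_r; trivial.
        apply Rmult_le_pos; trivial. apply Rlt_le, Rinv_0_lt_compat, one_plus_sqr_pos.
    + assert (E : RInt (fun t => eta * poisson e t + 2 * e * K * / (1 + t ^ 2)) (- T) T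
                  = eta * (4 * atan (T / e)) + 2 * e * K * (2 * atan T)).
      { assert (Hc1 : ex_RInt (poisson e) (- T) T)
          by (apply ex_RInt_cont; intro; apply continuous_poisson; lra).
        assert (Hc2 : ex_RInt (fun t => / (1 + t ^ 2)) (- T) T).
        { apply ex_RInt_cont; intro t. apply (ex_derive_continuous (V := R_NormedModule)). auto_derive.
          pose proof (one_plus_sqr_pos t); simpl in *; lra. }
        rewrite <- RInt_poisson, <- RInt_atan by lra.
        rewrite (RInt_plus (V := R_CompleteNormedModule) (fun t => eta * poisson e t)
          (fun t => 2 * e * K * / (1 + t ^ 2))).
        - exact (f_equal2 Rplus
            (RInt_scal (V := R_CompleteNormedModule) (poisson e) (- T) T eta Hc1)
            (RInt_scal (V := R_CompleteNormedModule) _ (- T) T (2 * e * K) Hc2)).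
        - exact (ex_RInt_scal (V := R_NormedModule) _ _ _ eta Hc1).
        - exact (ex_RInt_scal (V := R_NormedModule) _ _ _ (2 * e * K) Hc2). }
      rewrite E. pose proof (atan_lt_PI2 T). pose proof (atan_lt_PI2 (T / e)).
      assert (0 <= 2 * e * K) by nra.
      assert (eta * (4 * atan (T / e)) <= eta * (2 * PI)) by (apply Rmult_le_compat_l; lra).
      assert (2 * e * K * (2 * atan T) <= 2 * e * K * PI) by (apply Rmult_le_compat_l; lra).
      lra.
  - assert (E : LI (fun t => g t * RtoC (poisson e t))%C =
      (LI (fun t => (g t - g 0%R) * RtoC (poisson e t)) + LI (fun t => g 0%R * RtoC (poisson e t)))%C).
    { rewrite <- (LI_plus (2 * M * (2 / e)) (Cmod (g 0) * (2 / e))); trivial.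
      - f_equal. apply functional_extensionality; intro t; ring.
      - apply Ccont_mult; [apply Ccont_const | assumption].
      - apply decays_scal, HPd. }
    rewrite E, (LI_scal (2 / e)), LI_poisson by trivial. ring.
Qed.

(** Since 1 - exp(-e |x|) <= e S on [-S, S] and |G| <= 6 M, removing the damping costs a multiple of
    e. For fixed [eta] the constant [K] is fixed, so e tends to 0 before [eta] does. The value at 0
    suffices: other points are reached by translating [g], which multiplies [G] by a factor of
    modulus 1 and keeps its support. *)
Lemma fourier_inversion : Cint G (- S) S = (RtoC (2 * PI) * g 0)%C.
Proof.
  pose proof (decays_pos M g Hd) as HM.
  assert (HGb : forall x, Cmod (G x) <= 6 * M).
  { intro x. rewrite HGE. apply LI_bound; [|apply decays_mult_cis, Hd].
    apply Ccont_mult; [assumption | apply Ccont_cis_scal]. }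
  assert (HA : forall e, 0 < e <= 1 ->
    Cmod (Cint G (- S) S - Cint (fun x => damp e x * G x)%C (- S) S) <= e * (6 * M * S * (2 * S))).
  { intros e He.
    assert (HdG : Ccont (fun x => damp e x * G x)%C) by (apply Ccont_mult; [apply Ccont_damp | assumption]).
    rewrite <- Cint_minus by assumption.
    replace (e * (6 * M * S * (2 * S))) with (e * S * (6 * M) * (S - - S)) by ring.
    apply Cint_le_const; [apply Ccont_minus; assumption | lra |].
    intros x Hx.
    replace (G x - damp e x * G x)%C with ((1 - damp e x) * G x)%C by ring.
    rewrite Cmod_mult. apply Rmult_le_compat; try apply Cmod_ge_0; [|apply HGb].
    unfold damp. rewrite <- RtoC_minus, Cmod_R.
    assert (Rabs x <= S) by (apply Rabs_le; lra). pose proof (Rabs_pos x).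
    pose proof (exp_ineq1_le (- e * Rabs x)).
    assert (exp (- e * Rabs x) <= 1) by (rewrite <- exp_0; apply exp_le; nra).
    rewrite Rabs_pos_eq by lra. nra. }
  assert (HF : forall eta, 0 < eta ->
    Cmod (Cint G (- S) S - RtoC (2 * PI) * g 0) <= 2 * PI * eta).
  { intros eta Heta. destruct (continuous_at_0_bound eta Heta) as [K [HK HKb]].
    pose proof PI_RGT_0.
    apply Rle_eps_lin with (6 * M * S * (2 * S) + 2 * PI * K); [|].
    - assert (0 <= 2 * PI * K) by nra. assert (0 <= M * S * S) by (repeat apply Rmult_le_pos; lra). lra.
    - intros e He.
      pose proof (HA e He) as H1. rewrite (damped_eq_LI_poisson e He) in H1.
      pose proof (LI_poisson_approx e eta K He Heta HK HKb) as H2.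
      match type of H1 with Cmod (?a - ?b) <= _ => match type of H2 with Cmod (_ - ?c) <= _ =>
        replace (a - c)%C with ((a - b) + (b - c))%C by ring;
        pose proof (Cmod_triangle (a - b) (b - c)) end end.
      lra. }
  assert (H0 : Cmod (Cint G (- S) S - RtoC (2 * PI) * g 0) <= 0).
  { apply Rle_eps_lin with (2 * PI); [pose proof PI_RGT_0; lra|].
    intros e He. pose proof (HF e ltac:(lra)). lra. }
  assert (E : (Cint G (- S) S - RtoC (2 * PI) * g 0)%C = 0).
  { apply Cmod_eq_0. pose proof (Cmod_ge_0 (Cint G (- S) S - RtoC (2 * PI) * g 0)). lra. }
  rewrite <- (Cplus_0_r (RtoC (2 * PI) * g 0)), <- E. ring.
Qed.

End Inversion.

(** * Goursat's theorem and vertical shifts of contours *)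

(** The epsilon-delta form of [filterdiff], whose remainder estimate is what Goursat's argument
    consumes. *)
Lemma is_derive_C_iff (F : C -> C) (z D : C) :
  is_derive (K := C_AbsRing) (V := C_NormedModule) F z D <->
  forall eps, 0 < eps -> exists d, 0 < d /\ forall w, Cmod (w - z) < d ->
    Cmod (F w - F z - (w - z) * D) <= eps * Cmod (w - z).
Proof.
  split.
  - intros [_ H] eps Heps.
    specialize (H z (fun P HP => HP) (mkposreal eps Heps)).
    destruct H as [d Hd]. exists d. split; [apply cond_pos|].
    intros w Hw. exact (Hd w Hw).
  - intro H. split.
    + apply is_linear_scal_l.
    + intros x Hx. apply (is_filter_lim_locally_unique (V := AbsRing_NormedModule C_AbsRing) z x) in Hx. subst x.
      intro eps. destruct (H eps (cond_pos eps)) as [d [Hd Hw]].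
      exists (mkposreal d Hd). exact Hw.
Qed.

Lemma entire_continuous (F : C -> C) (z : C) : entire F ->
  forall eps, 0 < eps -> exists d, 0 < d /\ forall w, Cmod (w - z) < d -> Cmod (F w - F z) < eps.
Proof.
  intros HF eps Heps. destruct (HF z) as [D HD].
  destruct (proj1 (is_derive_C_iff F z D) HD 1 ltac:(lra)) as [d [Hd H]].
  pose proof (Cmod_ge_0 D) as H0.
  exists (Rmin d (eps / (2 + Cmod D))). split.
  - apply Rmin_glb_lt; trivial. apply Rdiv_lt_0_compat; lra.
  - intros w Hw.
    assert (Hw1 : Cmod (w - z) < d) by (eapply Rlt_le_trans; [exact Hw | apply Rmin_l]).
    assert (Hw2 : Cmod (w - z) < eps / (2 + Cmod D)) by (eapply Rlt_le_trans; [exact Hw | apply Rmin_r]).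
    apply Rlt_div_r in Hw2; [|lra].
    specialize (H w Hw1). pose proof (Cmod_ge_0 (w - z)).
    replace (F w - F z)%C with ((F w - F z - (w - z) * D) + (w - z) * D)%C by ring.
    eapply Rle_lt_trans; [apply Cmod_triangle|]. rewrite Cmod_mult. nra.
Qed.

Lemma Ccont_entire_line (F : C -> C) (p : R -> C) : entire F ->
  (forall s t, Cmod (p s - p t) <= Rabs (s - t)) -> Ccont (fun t => F (p t)).
Proof.
  intros HF Hp t.
  assert (H : forall eps : posreal, exists d : posreal, forall s, Rabs (s - t) < d ->
    Cmod (F (p s) - F (p t)) < eps).
  { intro eps. destruct (entire_continuous F (p t) HF eps (cond_pos eps)) as [d [Hd H]].
    exists (mkposreal d Hd). intros s Hs. apply H.
    eapply Rle_lt_trans; [apply Hp | exact Hs]. }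
  split; apply filterlim_locally; intro eps; destruct (H eps) as [d Hd]; exists d; intros s Hs;
  (eapply Rle_lt_trans; [|apply (Hd s Hs)]).
  - change (Rabs (Re (F (p s) - F (p t))) <= Cmod (F (p s) - F (p t))). apply re_le_Cmod.
  - change (Rabs (Im (F (p s) - F (p t))) <= Cmod (F (p s) - F (p t))). apply im_le_Cmod.
Qed.

Lemma Ccont_horizontal (F : C -> C) (y : R) : entire F -> Ccont (fun u => F (u, y)).
Proof.
  intro HF. apply (Ccont_entire_line F (fun u => (u, y))); trivial.
  intros s t. replace ((s, y) - (t, y))%C with (RtoC (s - t)) by (apply C_ext; simpl; ring).
  rewrite Cmod_R; lra.
Qed.

Lemma Ccont_vertical (F : C -> C) (x : R) : entire F -> Ccont (fun v => F (x, v)).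
Proof.
  intro HF. apply (Ccont_entire_line F (fun v => (x, v))); trivial.
  intros s t. replace ((x, s) - (x, t))%C with (Ci * RtoC (s - t))%C by (apply C_ext; simpl; ring).
  rewrite Cmod_mult, Cmod_R, Cmod_Ci; lra.
Qed.

(** The contour integral around the rectangle, counterclockwise; the factor [Ci] is dz = i dv on the
    vertical sides. *)
Definition boundary_int (F : C -> C) (x1 x2 y1 y2 : R) : C :=
  (Cint (fun u => F (u, y1)) x1 x2 + Ci * Cint (fun v => F (x2, v)) y1 y2
   - Cint (fun u => F (u, y2)) x1 x2 - Ci * Cint (fun v => F (x1, v)) y1 y2)%C.

Definition line_cont (F : C -> C) : Prop :=
  (forall y, Ccont (fun u => F (u, y))) /\ (forall x, Ccont (fun v => F (x, v))).

(** Every inner side is traversed twice, in opposite directions. *)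
Lemma boundary_int_split (F : C -> C) (x1 x2 x3 y1 y2 y3 : R) : line_cont F ->
  boundary_int F x1 x3 y1 y3 =
  (boundary_int F x1 x2 y1 y2 + boundary_int F x2 x3 y1 y2 +
   boundary_int F x1 x2 y2 y3 + boundary_int F x2 x3 y2 y3)%C.
Proof.
  intros [Hh Hv]; unfold boundary_int.
  rewrite <- !(Cint_Chasles _ x1 x2 x3) by apply Hh.
  rewrite <- !(Cint_Chasles _ y1 y2 y3) by apply Hv. ring.
Qed.

Lemma boundary_int_minus (F H : C -> C) (x1 x2 y1 y2 : R) : line_cont F -> line_cont H ->
  boundary_int (fun z => F z - H z)%C x1 x2 y1 y2 =
  (boundary_int F x1 x2 y1 y2 - boundary_int H x1 x2 y1 y2)%C.
Proof.
  intros [Fh Fv] [Hh Hv]; unfold boundary_int.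
  rewrite (Cint_minus (fun u => F (u, y1)) (fun u => H (u, y1))),
    (Cint_minus (fun u => F (u, y2)) (fun u => H (u, y2))),
    (Cint_minus (fun u => F (x1, u)) (fun u => H (x1, u))),
    (Cint_minus (fun u => F (x2, u)) (fun u => H (x2, u))) by auto. ring.
Qed.

Lemma line_cont_affine (A D : C) : line_cont (fun z => A + z * D)%C.
Proof.
  split; intro c.
  - replace (fun u => A + (u, c) * D)%C with (fun u : R => A + (RtoC u + RtoC c * Ci) * D)%C; [ccont|].
    apply functional_extensionality; intro u. f_equal. f_equal. apply C_ext; simpl; ring.
  - replace (fun u => A + (c, u) * D)%C with (fun u : R => A + (RtoC c + RtoC u * Ci) * D)%C; [ccont|].
    apply functional_extensionality; intro u. f_equal. f_equal. apply C_ext; simpl; ring.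
Qed.

(** An affine function has the primitive [P], so each side contributes a difference of two corner
    values, and these cancel around the rectangle. *)
Lemma boundary_int_affine (A D : C) (x1 x2 y1 y2 : R) :
  boundary_int (fun z => A + z * D)%C x1 x2 y1 y2 = RtoC 0.
Proof.
  set (P := fun z : C => (A * z + D * (z * z) * RtoC (/ 2))%C).
  assert (Hh : forall y, Cint (fun u => A + (u, y) * D)%C x1 x2 = (P (x2, y) - P (x1, y))%C).
  { intro y. apply (Cint_derive (fun u => P (u, y))).
    - intro t. destruct A, D; unfold P, Re, Im; simpl. auto_derive; trivial. field.
    - intro t. destruct A, D; unfold P, Re, Im; simpl. auto_derive; trivial. field.
    - apply (proj1 (line_cont_affine A D)). }
  assert (Hv : forall x, (Ci * Cint (fun v => A + (x, v) * D) y1 y2)%C = (P (x, y2) - P (x, y1))%C).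
  { intro x. rewrite <- Cint_scal by apply (proj2 (line_cont_affine A D)).
    apply (Cint_derive (fun v => P (x, v))).
    - intro t. destruct A, D; unfold P, Re, Im; simpl. auto_derive; trivial. field.
    - intro t. destruct A, D; unfold P, Re, Im; simpl. auto_derive; trivial. field.
    - apply Ccont_mult; [apply Ccont_const | apply (proj2 (line_cont_affine A D))]. }
  unfold boundary_int. rewrite !Hh, !Hv. ring.
Qed.

Lemma boundary_int_le (F : C -> C) (B x1 x2 y1 y2 : R) : line_cont F -> x1 <= x2 -> y1 <= y2 ->
  (forall x y, x1 <= x <= x2 -> y1 <= y <= y2 -> Cmod (F (x, y)) <= B) ->
  Cmod (boundary_int F x1 x2 y1 y2) <= 2 * B * ((x2 - x1) + (y2 - y1)).
Proof.
  intros [Fh Fv] Hx Hy HB. unfold boundary_int.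
  pose proof (Cint_le_const (fun u => F (u, y1)) B x1 x2 (Fh y1) Hx
    (fun t Ht => HB t y1 Ht ltac:(lra))) as H1.
  pose proof (Cint_le_const (fun u => F (u, y2)) B x1 x2 (Fh y2) Hx
    (fun t Ht => HB t y2 Ht ltac:(lra))) as H2.
  pose proof (Cint_le_const (fun u => F (x1, u)) B y1 y2 (Fv x1) Hy
    (fun t Ht => HB x1 t ltac:(lra) Ht)) as H3.
  pose proof (Cint_le_const (fun u => F (x2, u)) B y1 y2 (Fv x2) Hy
    (fun t Ht => HB x2 t ltac:(lra) Ht)) as H4.
  assert (Htri : forall a b c d : C,
    Cmod (a + Ci * b - c - Ci * d) <= Cmod a + Cmod b + Cmod c + Cmod d).
  { intros a b c d. unfold Cminus.
    pose proof (Cmod_triangle (a + Ci * b + - c) (- (Ci * d))) as K1.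
    pose proof (Cmod_triangle (a + Ci * b) (- c)) as K2.
    pose proof (Cmod_triangle a (Ci * b)) as K3.
    rewrite Cmod_opp, Cmod_mult, Cmod_Ci in K1. rewrite Cmod_opp in K2.
    rewrite Cmod_mult, Cmod_Ci in K3. lra. }
  eapply Rle_trans; [apply Htri|]. lra.
Qed.

Lemma line_cont_entire (H : C -> C) : entire H -> line_cont H.
Proof. split; intro; [apply Ccont_horizontal | apply Ccont_vertical]; assumption. Qed.

Lemma half_pow (X : R) (n : nat) : X / 2 ^ n = X / 2 ^ S n + X / 2 ^ S n.
Proof. simpl. field. apply pow_nonzero; lra. Qed.

(** The intervals [u n, u n + L / 2^n] are nested, and the supremum of their left ends belongs to
    all of them. *)
Lemma nested_limit (u : nat -> R) (L : R) :
  (forall n, u n <= u (S n) <= u n + L / 2 ^ S n) ->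
  exists l, forall n, u n <= l <= u n + L / 2 ^ n.
Proof.
  intro H.
  set (v := fun n => u n + L / 2 ^ n).
  assert (Hv : forall n, v (S n) <= v n).
  { intro n. unfold v. rewrite (half_pow L n). specialize (H n). lra. }
  assert (HL : 0 <= L).
  { specialize (H O). replace L with (L / 2 ^ 1 * 2) by (simpl; field). lra. }
  assert (Huv : forall n, u n <= v n).
  { intro n. unfold v. assert (0 <= L / 2 ^ n) by (apply Rdiv_le_0_compat; [lra | apply pow_lt; lra]). lra. }
  assert (Hu0 : forall n m, (n <= m)%nat -> u n <= u m).
  { intros n m Hnm; induction Hnm; [lra|]. specialize (H m). lra. }
  assert (Hv0 : forall n m, (n <= m)%nat -> v m <= v n).
  { intros n m Hnm; induction Hnm; [lra|]. specialize (Hv m). lra. }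
  assert (Hcross : forall n m, u n <= v m).
  { intros n m. apply Rle_trans with (u (Nat.max n m)); [apply Hu0; lia|].
    apply Rle_trans with (v (Nat.max n m)); [apply Huv | apply Hv0; lia]. }
  destruct (completeness (fun x => exists n, x = u n)) as [l [Hl1 Hl2]].
  - exists (v O). intros x [n ->]. apply Hcross.
  - exists (u O); exists O; reflexivity.
  - exists l. intro n. split.
    + apply Hl1. exists n; reflexivity.
    + apply Hl2. intros x [m ->]. apply Hcross.
Qed.

Lemma pow2_small (X d : R) : 0 < d -> exists n, X / 2 ^ n < d.
Proof.
  intro Hd. destruct (nfloor_ex (Rmax 0 (X / d))) as [n [_ Hn]]; [apply Rmax_l|].
  exists (S n).
  assert (H2 : INR (S n) < 2 ^ S n).
  { clear. induction n as [|n IH]; [simpl; lra|].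
    rewrite S_INR. change (2 ^ S (S n)) with (2 * 2 ^ S n).
    assert (1 <= 2 ^ S n) by (apply pow_R1_Rle; lra). lra. }
  apply Rlt_div_l; [apply pow_lt; lra|].
  assert (X / d < 2 ^ S n).
  { eapply Rle_lt_trans; [apply Rmax_r|]. eapply Rlt_trans; [|exact H2]. rewrite S_INR. exact Hn. }
  apply (proj1 (Rlt_div_l X (2 ^ S n) d Hd)) in H. lra.
Qed.

Section Goursat.
Variables (F : C -> C) (x0 y0 A B K : R).
Hypothesis HF : entire F.
Hypothesis HA : 0 <= A.
Hypothesis HB : 0 <= B.
Hypothesis HK : 0 < K.

Let bd (n : nat) (p : R * R) : R :=
  Cmod (boundary_int F (fst p) (fst p + A / 2 ^ n) (snd p) (snd p + B / 2 ^ n)).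

(** The lower left corner of a quarter whose boundary integral exceeds K / 4^(n+1). The upper right
    quarter is taken by default: if the whole rectangle exceeds K / 4^n and the other three quarters
    fail, this one must succeed, because the four integrals add up to that of the whole. *)
Definition bisect (n : nat) (p : R * R) : R * R :=
  let a := A / 2 ^ S n in let b := B / 2 ^ S n in
  if Rlt_dec (K / 4 ^ S n) (bd (S n) p) then p
  else if Rlt_dec (K / 4 ^ S n) (bd (S n) (fst p + a, snd p)) then (fst p + a, snd p)
  else if Rlt_dec (K / 4 ^ S n) (bd (S n) (fst p, snd p + b)) then (fst p, snd p + b)
  else (fst p + a, snd p + b).

Fixpoint corner (n : nat) : R * R :=
  match n with O => (x0, y0) | S n => bisect n (corner n) end.

Lemma bisect_large (n : nat) (p : R * R) :
  K / 4 ^ n < bd n p -> K / 4 ^ S n < bd (S n) (bisect n p).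
Proof.
  intro H. unfold bisect.
  destruct (Rlt_dec _ _) as [H1|H1]; [assumption|].
  destruct (Rlt_dec _ _) as [H2|H2]; [assumption|].
  destruct (Rlt_dec _ _) as [H3|H3]; [assumption|].
  apply Rnot_lt_le in H1, H2, H3. apply Rnot_le_lt; intro H4.
  apply (Rlt_irrefl (bd n p)). eapply Rle_lt_trans; [|exact H].
  replace (K / 4 ^ n) with (K / 4 ^ S n + K / 4 ^ S n + K / 4 ^ S n + K / 4 ^ S n)
    by (simpl; field; apply pow_nonzero; lra).
  unfold bd in *. rewrite (half_pow A n), (half_pow B n), <- !Rplus_assoc.
  rewrite (boundary_int_split F _ (fst p + A / 2 ^ S n) _ _ (snd p + B / 2 ^ S n))
    by (apply line_cont_entire, HF).
  cbn [fst snd] in *.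
  eapply Rle_trans; [apply Cmod_triangle|]. apply Rplus_le_compat; [|exact H4].
  eapply Rle_trans; [apply Cmod_triangle|]. apply Rplus_le_compat; [|exact H3].
  eapply Rle_trans; [apply Cmod_triangle|]. apply Rplus_le_compat; [exact H1 | exact H2].
Qed.

Lemma corner_large (n : nat) : K < bd 0 (x0, y0) -> K / 4 ^ n < bd n (corner n).
Proof.
  intro H. induction n as [|n IH].
  - simpl corner. replace (K / 4 ^ 0) with K by (simpl; field). exact H.
  - apply bisect_large, IH.
Qed.

Lemma corner_step (n : nat) :
  (fst (corner n) <= fst (corner (S n)) <= fst (corner n) + A / 2 ^ S n) /\
  (snd (corner n) <= snd (corner (S n)) <= snd (corner n) + B / 2 ^ S n).
Proof.
  assert (0 <= A / 2 ^ S n) by (apply Rdiv_le_0_compat; [lra | apply pow_lt; lra]).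
  assert (0 <= B / 2 ^ S n) by (apply Rdiv_le_0_compat; [lra | apply pow_lt; lra]).
  change (corner (S n)) with (bisect n (corner n)). unfold bisect; cbv zeta.
  repeat destruct (Rlt_dec _ _); cbn [fst snd]; lra.
Qed.

(** The corners converge to a point p of all the rectangles. Near p, F differs from its first-order
    Taylor polynomial, which integrates to 0, by at most eps |z - p|; side lengths and distances are
    both of order 2^(-n), so the boundary integral is at most K / 4^n for some n, against the choice
    of the corners. *)
Lemma goursat_aux : ~ K < bd 0 (x0, y0).
Proof.
  intro HL.
  destruct (nested_limit (fun n => fst (corner n)) A (fun n => proj1 (corner_step n))) as [px Hpx].
  destruct (nested_limit (fun n => snd (corner n)) B (fun n => proj2 (corner_step n))) as [py Hpy].
  set (p := (px, py) : C).
  destruct (HF p) as [D HD].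
  (* The estimate below is 2 eps (A + B)^2 / 4^n, to be kept within K / 4^n; the summand 1 avoids a
     zero denominator for a degenerate rectangle. *)
  set (eps := K / (2 * (A + B) ^ 2 + 1)).
  assert (Heps : 0 < eps).
  { apply Rdiv_lt_0_compat; trivial. pose proof (pow2_ge_0 (A + B)); lra. }
  destruct (proj1 (is_derive_C_iff F p D) HD eps Heps) as [d [Hd Hapx]].
  destruct (pow2_small (A + B) d Hd) as [n Hn].
  pose proof (corner_large n HL) as HLn. revert HLn. apply Rle_not_lt.
  unfold bd. specialize (Hpx n); specialize (Hpy n).
  set (x := fst (corner n)) in *. set (y := snd (corner n)) in *.
  assert (HAn : 0 <= A / 2 ^ n) by (apply Rdiv_le_0_compat; [lra | apply pow_lt; lra]).
  assert (HBn : 0 <= B / 2 ^ n) by (apply Rdiv_le_0_compat; [lra | apply pow_lt; lra]).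
  set (L := fun z => (F p - p * D + z * D)%C).
  assert (EL : boundary_int F x (x + A / 2 ^ n) y (y + B / 2 ^ n)
    = boundary_int (fun z => F z - L z)%C x (x + A / 2 ^ n) y (y + B / 2 ^ n)).
  { rewrite boundary_int_minus by (apply line_cont_entire, HF || apply line_cont_affine).
    unfold L. rewrite boundary_int_affine. ring. }
  rewrite EL.
  assert (Hlc : line_cont (fun z => F z - L z)%C).
  { destruct (line_cont_entire F HF), (line_cont_affine (F p - p * D)%C D).
    split; intro; apply Ccont_minus; unfold L; auto. }
  eapply Rle_trans; [apply (boundary_int_le _ (eps * ((A + B) / 2 ^ n))); trivial; try lra|].
  - intros u v Hu Hv.
    assert (Hz : Cmod ((u, v) - p) <= (A + B) / 2 ^ n).
    { eapply Rle_trans; [apply Cmod_le_Re_Im|].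
      replace ((A + B) / 2 ^ n) with (A / 2 ^ n + B / 2 ^ n) by (field; apply pow_nonzero; lra).
      unfold p; simpl. apply Rplus_le_compat; apply Rabs_le; lra. }
    replace (F (u, v) - L (u, v))%C with (F (u, v) - F p - ((u, v) - p) * D)%C by (unfold L; ring).
    eapply Rle_trans; [apply Hapx; lra|].
    apply Rmult_le_compat_l; lra.
  - assert (H4 : 4 ^ n = 2 ^ n * 2 ^ n) by (rewrite <- Rpow_mult_distr; f_equal; lra).
    assert (H2 : 0 < 2 ^ n) by (apply pow_lt; lra).
    replace (2 * (eps * ((A + B) / 2 ^ n)) * (x + A / 2 ^ n - x + (y + B / 2 ^ n - y)))
      with (eps * (2 * (A + B) ^ 2) * / 4 ^ n) by (rewrite H4; field; lra).
    unfold Rdiv. apply Rmult_le_compat_r.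
    + apply Rlt_le, Rinv_0_lt_compat, pow_lt; lra.
    + unfold eps. pose proof (pow2_ge_0 (A + B)).
      apply Rle_trans with (K / (2 * (A + B) ^ 2 + 1) * (2 * (A + B) ^ 2 + 1)).
      * apply Rmult_le_compat_l; [apply Rlt_le, Heps | lra].
      * apply Req_le. field. lra.
Qed.

End Goursat.

Lemma goursat (F : C -> C) (x1 x2 y1 y2 : R) : entire F -> x1 <= x2 -> y1 <= y2 ->
  boundary_int F x1 x2 y1 y2 = RtoC 0.
Proof.
  intros HF Hx Hy. apply Cmod_eq_0. apply Rle_antisym; [|apply Cmod_ge_0].
  apply Rnot_lt_le. intro Hpos.
  (* Half of the modulus, because the descent starts from a strict inequality. *)
  set (K := Cmod (boundary_int F x1 x2 y1 y2) / 2).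
  apply (goursat_aux F x1 y1 (x2 - x1) (y2 - y1) K HF); try lra.
  - unfold K; lra.
  - simpl fst; simpl snd. replace (x1 + (x2 - x1) / 2 ^ 0) with x2 by (simpl; field).
    replace (y1 + (y2 - y1) / 2 ^ 0) with y2 by (simpl; field). unfold K; lra.
Qed.

(** Goursat's theorem on the rectangle of height 2 T: each horizontal side contributes at most N (x2
    - x1) / T, since 1 + T^2 >= T. *)
Lemma LI_vertical_shift (F : C -> C) (N x1 x2 : R) : entire F -> x1 <= x2 ->
  (forall x, x1 <= x <= x2 -> decays N (fun y => F (x, y))) ->
  LI (fun y => F (x1, y)) = LI (fun y => F (x2, y)).
Proof.
  intros HF Hx Hd.
  pose proof (decays_pos N _ (Hd x1 ltac:(lra))) as HN.
  apply LI_unique with N (4 * N + 2 * N * (x2 - x1)) 1.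
  - apply Ccont_vertical, HF.
  - apply Hd; lra.
  - intros T HT1 HT.
    pose proof (goursat F x1 x2 (- T) T HF Hx ltac:(lra)) as HG. unfold boundary_int in HG.
    assert (Hhor : forall y, Rabs y = T -> Cmod (Cint (fun u => F (u, y)) x1 x2) <= N * (x2 - x1) / T).
    { intros y Hy. replace (N * (x2 - x1) / T) with (N / T * (x2 - x1)) by (field; lra).
      apply Cint_le_const; trivial; [apply Ccont_horizontal, HF|].
      intros u Hu. eapply Rle_trans; [apply (Hd u Hu)|].
      apply Rmult_le_compat_l; trivial. apply Rinv_le_contravar; trivial.
      rewrite <- pow2_abs, Hy. nra. }
    pose proof (Hhor T (Rabs_pos_eq T ltac:(lra))) as H1.
    pose proof (Hhor (- T) ltac:(rewrite Rabs_Ropp; apply Rabs_pos_eq; lra)) as H2.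
    pose proof (LI_tail (fun y => F (x2, y)) N T (Ccont_vertical F x2 HF) (Hd x2 ltac:(lra)) HT) as H3.
    set (I1 := Cint (fun v => F (x1, v)) (- T) T) in *.
    set (I2 := Cint (fun v => F (x2, v)) (- T) T) in *.
    set (J1 := Cint (fun u => F (u, - T)) x1 x2) in *.
    set (J2 := Cint (fun u => F (u, T)) x1 x2) in *.
    assert (E : (I2 - I1)%C = (Ci * (J1 - J2))%C).
    { transitivity (- Ci * (Ci * I2 - Ci * I1))%C; [apply C_ext; simpl; ring|].
      replace (Ci * I2 - Ci * I1)%C with (J2 - J1 + (J1 + Ci * I2 - J2 - Ci * I1))%C by ring.
      rewrite HG. ring. }
    replace (LI (fun y => F (x2, y)) - I1)%C with ((LI (fun y => F (x2, y)) - I2) + (I2 - I1))%C by ring.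
    eapply Rle_trans; [apply Cmod_triangle|].
    rewrite E, Cmod_mult, Cmod_Ci, Rmult_1_l.
    pose proof (Cmod_triangle J1 (- J2)) as H4. rewrite Cmod_opp in H4.
    replace ((4 * N + 2 * N * (x2 - x1)) / T)
      with (4 * N / T + (N * (x2 - x1) / T + N * (x2 - x1) / T)) by (field; lra).
    unfold Cminus at 2. lra.
Qed.

(** * Derivatives of complex-valued functions *)

(** Restricting w to the unit disc around z allows exponential factors of the remainder to be
    absorbed in the constant [K]. *)
Lemma is_derive_C_quadratic (F : C -> C) (z D : C) (K : R) :
  (forall w, Cmod (w - z) <= 1 ->
     Cmod (F w - F z - (w - z) * D) <= K * (Cmod (w - z) * Cmod (w - z))) ->
  is_derive (K := C_AbsRing) (V := C_NormedModule) F z D.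
Proof.
  intro H. apply is_derive_C_iff. intros eps Heps.
  pose proof (Rabs_pos K) as HK.
  exists (Rmin 1 (eps / (Rabs K + 1))). split.
  - apply Rmin_glb_lt; [lra|]. apply Rdiv_lt_0_compat; lra.
  - intros w Hw.
    assert (H1 : Cmod (w - z) < 1) by (eapply Rlt_le_trans; [exact Hw | apply Rmin_l]).
    assert (H2 : Cmod (w - z) < eps / (Rabs K + 1)) by (eapply Rlt_le_trans; [exact Hw | apply Rmin_r]).
    apply (proj2 (Rlt_div_r (Cmod (w - z)) eps (Rabs K + 1) ltac:(lra))) in H2.
    eapply Rle_trans; [apply H; lra|].
    rewrite <- Rmult_assoc. apply Rmult_le_compat_r; [apply Cmod_ge_0|].
    pose proof (Rle_abs K). pose proof (Cmod_ge_0 (w - z)). nra.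
Qed.

Lemma is_derive_quadratic (f : R -> R) (t d K : R) :
  (forall h, Rabs (f (t + h) - f t - h * d) <= K * h ^ 2) -> is_derive f t d.
Proof.
  intro H. apply is_derive_Reals. intros eps Heps.
  pose proof (Rabs_pos K) as HK.
  assert (Hd : 0 < eps / (Rabs K + 1)) by (apply Rdiv_lt_0_compat; lra).
  exists (mkposreal _ Hd). intros h Hh0 Hh. simpl in Hh.
  apply (proj2 (Rlt_div_r _ eps (Rabs K + 1) ltac:(lra))) in Hh.
  replace ((f (t + h) - f t) / h - d) with ((f (t + h) - f t - h * d) / h) by (field; assumption).
  pose proof (Rabs_pos_lt h Hh0) as Hp.
  rewrite Rabs_div by assumption.
  apply (proj2 (Rlt_div_l _ eps (Rabs h) Hp)).
  eapply Rle_lt_trans; [apply H|]. rewrite <- pow2_abs.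
  pose proof (Rle_abs K). nra.
Qed.

Definition is_Cder (f : R -> C) (t : R) (d : C) : Prop :=
  is_derive (fun s => Re (f s)) t (Re d) /\ is_derive (fun s => Im (f s)) t (Im d).

Lemma is_Cder_mult (f g : R -> C) (t : R) (df dg : C) : is_Cder f t df -> is_Cder g t dg ->
  is_Cder (fun s => f s * g s)%C t (df * g t + f t * dg)%C.
Proof.
  intros [H1 H2] [H3 H4]; split; simpl.
  - replace (_ + _) with
      ((Re df * Re (g t) + Re (f t) * Re dg) - (Im df * Im (g t) + Im (f t) * Im dg))
      by (unfold Re, Im; ring).
    apply (is_derive_minus (V := R_NormedModule) (fun s => Re (f s) * Re (g s)) (fun s => Im (f s) * Im (g s)));
    apply (is_derive_mult (K := R_AbsRing)); trivial; intros; apply Rmult_comm.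
  - replace (_ + _) with
      ((Re df * Im (g t) + Re (f t) * Im dg) + (Im df * Re (g t) + Im (f t) * Re dg))
      by (unfold Re, Im; ring).
    apply (is_derive_plus (V := R_NormedModule) (fun s => Re (f s) * Im (g s)) (fun s => Im (f s) * Re (g s)));
    apply (is_derive_mult (K := R_AbsRing)); trivial; intros; apply Rmult_comm.
Qed.

Lemma is_Cder_Cexp (u : C) (t : R) :
  is_Cder (fun s => Cexp (RtoC s * u)) t (u * Cexp (RtoC t * u)).
Proof. split; [apply Cexp_line_Re | apply Cexp_line_Im]. Qed.

Lemma is_Cder_quadratic (f : R -> C) (t K : R) (d : C) :
  (forall h, Cmod (f (t + h)%R - f t - RtoC h * d) <= K * h ^ 2) -> is_Cder f t d.
Proof.
  intro H; split; apply is_derive_quadratic with K; intro h;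
  (eapply Rle_trans; [|apply H]).
  - eapply Rle_trans; [|apply re_le_Cmod]. apply Req_le. f_equal. unfold Re; simpl; ring.
  - eapply Rle_trans; [|apply im_le_Cmod]. apply Req_le. f_equal. unfold Im; simpl; ring.
Qed.

Lemma is_Cder_Ccont (f df : R -> C) : (forall t, is_Cder f t (df t)) -> Ccont f.
Proof.
  intros H t; destruct (H t) as [H1 H2].
  split; apply (ex_derive_continuous (V := R_NormedModule)); eexists; eassumption.
Qed.

(** Smoothness is established below by exhibiting all derivatives at once as a sequence; this also
    identifies [Cderive_n], which convergence of test functions refers to. *)
Lemma smooth_of_Cder (D : nat -> R -> C) : (forall n t, is_Cder (D n) t (D (S n) t)) ->
  smooth (D O) /\ forall n t, Cderive_n (D O) n t = D n t.
Proof.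
  intro H.
  assert (ER : forall n t, Derive_n (fun s => Re (D O s)) n t = Re (D n t)).
  { induction n as [|n IH]; intro t; [reflexivity|].
    simpl. rewrite (Derive_ext _ (fun s => Re (D n s))) by exact IH.
    apply is_derive_unique; exact (proj1 (H n t)). }
  assert (EI : forall n t, Derive_n (fun s => Im (D O s)) n t = Im (D n t)).
  { induction n as [|n IH]; intro t; [reflexivity|].
    simpl. rewrite (Derive_ext _ (fun s => Im (D n s))) by exact IH.
    apply is_derive_unique; exact (proj2 (H n t)). }
  split.
  - intros [|n] t; [split; exact I|]. simpl. split.
    + apply (ex_derive_ext (fun s => Re (D n s))); [intro; symmetry; apply ER|].
      exists (Re (D (S n) t)); exact (proj1 (H n t)).
    + apply (ex_derive_ext (fun s => Im (D n s))); [intro; symmetry; apply EI|].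
      exists (Im (D (S n) t)); exact (proj2 (H n t)).
  - intros n t. apply C_ext; [apply ER | apply EI].
Qed.

Lemma is_Cder_Cderive_n (f : R -> C) (n : nat) (t : R) : smooth f ->
  is_Cder (Cderive_n f n) t (Cderive_n f (S n) t).
Proof.
  intro H. destruct (H (S n) t) as [H1 H2].
  split; apply Derive_correct; assumption.
Qed.

Lemma smooth_Ccont (f : R -> C) (n : nat) : smooth f -> Ccont (Cderive_n f n).
Proof. intro H. apply is_Cder_Ccont with (Cderive_n f (S n)). intro; apply is_Cder_Cderive_n, H. Qed.

Lemma Cderive_n_0 (f : R -> C) : Cderive_n f 0 = f.
Proof. apply functional_extensionality; intro t. unfold Cderive_n; simpl. destruct (f t); reflexivity. Qed.

Lemma Ccont_smooth (f : R -> C) : smooth f -> Ccont f.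
Proof. intro H. rewrite <- (Cderive_n_0 f). apply smooth_Ccont, H. Qed.

Lemma is_derive_Cexp_scal (t : R) (z : C) :
  is_derive (K := C_AbsRing) (V := C_NormedModule) (fun z => Cexp (RtoC t * z)) z
    (RtoC t * Cexp (RtoC t * z))%C.
Proof.
  apply is_derive_C_quadratic with (exp (Re (RtoC t * z)) * (Rabs t * Rabs t * exp (Rabs t))).
  intros w Hw. set (h := (w - z)%C) in *.
  replace w with (z + h)%C by (unfold h; ring).
  rewrite Cmult_plus_distr_l, Cexp_plus.
  replace (_ - _)%C with (Cexp (RtoC t * z) * (Cexp (RtoC t * h) - 1 - RtoC t * h))%C by ring.
  rewrite Cmod_mult, Cmod_Cexp, Rmult_assoc.
  apply Rmult_le_compat_l; [apply Rlt_le, exp_pos|].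
  eapply Rle_trans; [apply Cexp_bound2|].
  rewrite Cmod_mult, Cmod_R.
  replace (Rabs t * Rabs t * exp (Rabs t) * (Cmod h * Cmod h))
    with (Rabs t * Cmod h * (Rabs t * Cmod h * exp (Rabs t))) by ring.
  pose proof (Rabs_pos t). pose proof (Cmod_ge_0 h).
  assert (0 <= Rabs t * Cmod h) by (apply Rmult_le_pos; lra).
  repeat (apply Rmult_le_compat_l; [assumption|]).
  apply exp_le. replace (Re (RtoC t * h)) with (t * Re h) by (unfold Re; simpl; ring).
  rewrite Rabs_mult. pose proof (re_le_Cmod h). nra.
Qed.

(* Coquelicot states the product rule for the codomain [AbsRing_NormedModule C_AbsRing], whose
   uniform structure differs from that of [C_NormedModule]. *)
Lemma is_derive_C_AbsRing (F : C -> C) (z D : C) :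
  is_derive (K := C_AbsRing) (V := AbsRing_NormedModule C_AbsRing) F z D <->
  is_derive (K := C_AbsRing) (V := C_NormedModule) F z D.
Proof.
  split; intros [_ H]; (split; [apply is_linear_scal_l | exact H]).
Qed.

Lemma entire_mult_Cexp (w : C -> C) (t : R) : entire w ->
  entire (fun z => w z * Cexp (RtoC t * z))%C.
Proof.
  intros Hw z. destruct (Hw z) as [D HD].
  eexists. apply is_derive_C_AbsRing.
  apply (is_derive_mult (K := C_AbsRing) w (fun z => Cexp (RtoC t * z))).
  - apply is_derive_C_AbsRing, HD.
  - apply is_derive_C_AbsRing, is_derive_Cexp_scal.
  - intros; apply Cmult_comm.
Qed.

Lemma cis_Cexp (x : R) : Cexp (RtoC x * Ci) = cis x.
Proof. unfold Cexp, cis; apply C_ext; simpl; replace (x * 0 - 0 * 1) with 0 by ring;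
  replace (x * 1 + 0 * 0) with x by ring; rewrite exp_0; ring. Qed.

Lemma cis_bound2 (x : R) : Cmod (cis x - 1 - RtoC x * Ci) <= x ^ 2.
Proof.
  rewrite <- cis_Cexp. eapply Rle_trans; [apply Cexp_bound2|].
  rewrite Cmod_mult, Cmod_Ci, Cmod_R.
  replace (Re (RtoC x * Ci)) with 0 by (unfold Re; simpl; ring).
  rewrite Rabs_R0, exp_0, <- pow2_abs. apply Req_le; ring.
Qed.

Lemma Cexp_line_cis (t c y : R) : Cexp (RtoC t * (c, y)) = (RtoC (exp (t * c)) * cis (y * t))%C.
Proof.
  rewrite Cexp_line. unfold cis, Re, Im; simpl. rewrite (Rmult_comm y t). apply C_ext; simpl; ring.
Qed.

(** * The inverse Laplace transform on Y *)

(* [(0, y)] is the point [iy] of the imaginary axis, so that this is the [n]-th derivative of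
   the inverse Fourier integral of [w] along that axis. *)
Definition iLaplace_n (w : C -> C) (n : nat) (t : R) : C :=
  (RtoC (/ (2 * PI)) * LI (fun y => (0, y) ^ n * w (0, y) * cis (y * t)))%C.

Definition iLaplace (w : C -> C) : R -> C := iLaplace_n w 0.

Lemma Im_sqr_le_Cmod (x y : R) : 1 + y ^ 2 <= (1 + Cmod (x, y)) ^ 2.
Proof.
  pose proof (im_le_Cmod (x, y)) as H. simpl in H. rewrite <- (pow2_abs y).
  pose proof (Rabs_pos y). nra.
Qed.

(* The two extra powers of [1 + Cmod z] in the hypothesis pay for integrability on vertical lines. *)
Lemma pow_mult_bound (E B : R) (z v : C) (n : nat) :
  0 <= E -> Cmod v <= B * / (1 + Cmod z) ^ (n + 2) * E ->
  Cmod (z ^ n * v) <= B * E / (1 + Im z ^ 2).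
Proof.
  intros HE H. pose proof (Cmod_ge_0 z) as Hz. pose proof (Cmod_ge_0 v) as Hv.
  assert (Hn : 0 < (1 + Cmod z) ^ n) by (apply pow_lt; lra).
  assert (H2 : 0 < (1 + Cmod z) ^ 2) by (apply pow_lt; lra).
  assert (Hi : 0 < 1 + Im z ^ 2) by apply one_plus_sqr_pos.
  (* The sign of B E is read off from the bound itself, whose left side is nonnegative. *)
  assert (HBE : 0 <= B * E).
  { rewrite pow_add in H.
    apply Rmult_le_reg_r with (/ ((1 + Cmod z) ^ n * (1 + Cmod z) ^ 2)).
    - apply Rinv_0_lt_compat, Rmult_lt_0_compat; assumption.
    - rewrite Rmult_0_l. lra. }
  rewrite Cmod_mult, Cmod_pow.
  apply Rle_trans with ((1 + Cmod z) ^ n * (B * / (1 + Cmod z) ^ (n + 2) * E)).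
  - apply Rmult_le_compat; trivial; [apply pow_le, Hz|]. apply pow_incr; lra.
  - rewrite pow_add.
    replace ((1 + Cmod z) ^ n * (B * / ((1 + Cmod z) ^ n * (1 + Cmod z) ^ 2) * E))
      with (B * E * / (1 + Cmod z) ^ 2) by (field; split; lra).
    apply Rmult_le_compat_l; trivial. apply Rinv_le_contravar; trivial.
    destruct z as [x y]. apply Im_sqr_le_Cmod.
Qed.

Lemma inv_2PI_pos : 0 < / (2 * PI).
Proof. apply Rinv_0_lt_compat. pose proof PI_RGT_0; lra. Qed.

(** Weakens exponential decay to the rate K / X expected by [eq_of_Cmod_le_div]. *)
Lemma exp_decay_le (d X : R) : 0 < d -> 0 < X -> exp (- d * X) <= / d / X.
Proof.
  intros Hd HX. replace (/ d / X) with (/ (d * X)) by (field; lra).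
  replace (- d * X) with (- (d * X)) by ring. rewrite exp_Ropp.
  assert (0 < d * X) by (apply Rmult_lt_0_compat; assumption).
  apply Rinv_le_contravar; trivial. pose proof (exp_ineq1_le (d * X)); lra.
Qed.

Section InverseTransform.
Variables (w : C -> C) (rp rm : R) (c : nat -> R).
Hypothesis Hw : entire w.
Hypothesis Hrp : rp < 0.
Hypothesis Hb : Y_bound rp rm c w.

Lemma decays_right (n : nat) (x : R) : 0 <= x ->
  decays (c (n + 2)%nat * exp (rp * x)) (fun y => (x, y) ^ n * w (x, y))%C.
Proof.
  intros Hx y. destruct (Hb (n + 2)%nat (x, y)) as [H _]. specialize (H Hx).
  simpl Re in H. rewrite Rabs_pos_eq in H by assumption.
  exact (pow_mult_bound _ _ (x, y) _ n (Rlt_le _ _ (exp_pos _)) H).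
Qed.

Lemma decays_left (n : nat) (x : R) : x <= 0 ->
  decays (c (n + 2)%nat * exp (rm * - x)) (fun y => (x, y) ^ n * w (x, y))%C.
Proof.
  intros Hx y. destruct (Hb (n + 2)%nat (x, y)) as [_ H]. specialize (H Hx).
  simpl Re in H. rewrite Rabs_left1 in H by assumption.
  exact (pow_mult_bound _ _ (x, y) _ n (Rlt_le _ _ (exp_pos _)) H).
Qed.

Lemma decays_right_0 (x : R) : 0 <= x -> decays (c 2%nat * exp (rp * x)) (fun y => w (x, y)).
Proof.
  intros Hx y. pose proof (decays_right 0 x Hx y) as H. cbv beta in H.
  replace ((x, y) ^ 0 * w (x, y))%C with (w (x, y)) in H by (simpl; ring). exact H.
Qed.

Lemma decays_left_0 (x : R) : x <= 0 -> decays (c 2%nat * exp (rm * - x)) (fun y => w (x, y)).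
Proof.
  intros Hx y. pose proof (decays_left 0 x Hx y) as H. cbv beta in H.
  replace ((x, y) ^ 0 * w (x, y))%C with (w (x, y)) in H by (simpl; ring). exact H.
Qed.

Lemma decays_axis (n : nat) : decays (c (n + 2)%nat) (fun y => (0, y) ^ n * w (0, y))%C.
Proof.
  pose proof (decays_right n 0 (Rle_refl 0)) as H.
  rewrite Rmult_0_r, exp_0, Rmult_1_r in H. exact H.
Qed.

Lemma Ccont_axis_pow (x : R) (n : nat) : Ccont (fun y => (x, y) ^ n * w (x, y))%C.
Proof.
  apply Ccont_mult; [|apply Ccont_vertical, Hw]. apply Ccont_pow.
  intro t; split; [apply continuous_const | apply continuous_id].
Qed.

Lemma Ccont_axis_cis (n : nat) (t : R) : Ccont (fun y => (0, y) ^ n * w (0, y) * cis (y * t))%C.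
Proof. apply Ccont_mult; [apply Ccont_axis_pow | apply Ccont_cis_scal]. Qed.

Lemma decays_axis_cis (n : nat) (t : R) :
  decays (c (n + 2)%nat) (fun y => (0, y) ^ n * w (0, y) * cis (y * t))%C.
Proof. apply decays_mult_cis, decays_axis. Qed.

(** Under the integral, cis (yh) = 1 + ihy + O((hy)^2). The linear term produces the integrand of
    order n + 1, and the factor y^2 of the remainder [r] is paid for by the decay of the integrand
    of order n + 2. *)
Lemma is_Cder_iLaplace_n (n : nat) (t : R) :
  is_Cder (iLaplace_n w n) t (iLaplace_n w (S n) t).
Proof.
  apply is_Cder_quadratic with (/ (2 * PI) * (6 * c (S (S n) + 2)%nat)). intro h.
  unfold iLaplace_n.
  set (f := fun n t y => ((0, y) ^ n * w (0, y) * cis (y * t))%C).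
  assert (Hf : forall n t, Ccont (f n t)) by (intros; apply Ccont_axis_cis).
  assert (Hd : forall n t, decays (c (n + 2)%nat) (f n t)) by (intros; apply decays_axis_cis).
  change (Cmod (RtoC (/ (2 * PI)) * LI (f n (t + h)%R) - RtoC (/ (2 * PI)) * LI (f n t)
    - RtoC h * (RtoC (/ (2 * PI)) * LI (f (S n) t))) <= / (2 * PI) * (6 * c (S (S n) + 2)%nat) * h ^ 2).
  set (r := fun y => ((0, y) ^ n * w (0, y) * cis (y * t) * (cis (y * h) - 1 - RtoC (y * h) * Ci))%C).
  assert (Hrc : Ccont r).
  { apply Ccont_mult; [apply Ccont_axis_cis|].
    apply Ccont_minus; [apply Ccont_minus; [apply Ccont_cis_scal | apply Ccont_const]|].
    apply Ccont_mult; [|apply Ccont_const]. apply Ccont_RtoC. intro s.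
    apply (continuous_mult (K := R_AbsRing) (fun t : R => t) (fun _ => h));
    [apply continuous_id | apply continuous_const]. }
  assert (Hrd : decays (h ^ 2 * c (S (S n) + 2)%nat) r).
  { intro y. unfold r. rewrite Cmod_mult.
    eapply Rle_trans; [apply Rmult_le_compat_l; [apply Cmod_ge_0 | apply cis_bound2]|].
    pose proof (Hd (S (S n)) t y) as H. unfold f in H. simpl Cpow in H.
    rewrite !Cmod_mult in *.
    assert (E : Cmod (0, y) = Rabs y).
    { replace (0, y) with (Ci * RtoC y)%C by (apply C_ext; simpl; ring).
      rewrite Cmod_mult, Cmod_Ci, Cmod_R; ring. }
    rewrite !E in H.
    replace (h ^ 2 * c (S (S n) + 2)%nat / (1 + y ^ 2))
      with (h ^ 2 * (c (S (S n) + 2)%nat / (1 + y ^ 2)))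
      by (field; apply Rgt_not_eq, one_plus_sqr_pos).
    eapply Rle_trans; [|apply Rmult_le_compat_l; [apply pow2_ge_0 | exact H]].
    apply Req_le. rewrite Rpow_mult_distr, <- (pow2_abs y). simpl. ring. }
  assert (E : LI (f n (t + h)) = (LI (f n t) + RtoC h * LI (f (S n) t) + LI r)%C).
  { assert (Hs : Ccont (fun y => RtoC h * f (S n) t y)%C) by (apply Ccont_mult; [apply Ccont_const | apply Hf]).
    assert (Hsd := decays_scal _ (RtoC h) _ (Hd (S n) t)).
    rewrite <- (LI_scal _ _ _ (Hf (S n) t) (Hd (S n) t)).
    rewrite <- (LI_plus _ _ _ _ (Hf n t) Hs (Hd n t) Hsd).
    rewrite <- (LI_plus _ _ _ _ (Ccont_plus _ _ (Hf n t) Hs) Hrc (decays_plus _ _ _ _ (Hd n t) Hsd) Hrd).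
    f_equal. apply functional_extensionality; intro y. unfold f, r.
    rewrite Rmult_plus_distr_l, cis_plus.
    replace (RtoC (y * h) * Ci)%C with (RtoC h * (0, y))%C by (apply C_ext; simpl; ring).
    simpl Cpow. ring. }
  rewrite E.
  match goal with |- Cmod ?z <= _ => replace z with (RtoC (/ (2 * PI)) * LI r)%C by ring end.
  rewrite Cmod_mult, Cmod_R, Rabs_pos_eq by (apply Rlt_le, inv_2PI_pos).
  rewrite Rmult_assoc. apply Rmult_le_compat_l; [apply Rlt_le, inv_2PI_pos|].
  eapply Rle_trans; [apply (LI_bound r _ Hrc Hrd)|]. apply Req_le; ring.
Qed.

Lemma smooth_iLaplace : smooth (iLaplace w).
Proof. apply smooth_of_Cder. apply is_Cder_iLaplace_n. Qed.

Lemma Cderive_n_iLaplace (n : nat) (t : R) : Cderive_n (iLaplace w) n t = iLaplace_n w n t.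
Proof. apply smooth_of_Cder. apply is_Cder_iLaplace_n. Qed.

Lemma Ccont_shift_integrand (x t : R) : Ccont (fun y => w (x, y) * Cexp (RtoC t * (x, y)))%C.
Proof. apply (Ccont_vertical (fun z => w z * Cexp (RtoC t * z))%C), entire_mult_Cexp, Hw. Qed.

Lemma decays_shift_right (x t : R) : 0 <= x ->
  decays (c 2%nat * exp ((rp + t) * x)) (fun y => w (x, y) * Cexp (RtoC t * (x, y)))%C.
Proof.
  intros Hx y. pose proof (decays_right_0 x Hx y) as H.
  rewrite Cmod_mult, Cexp_line_cis, Cmod_mult, Cmod_cis, Cmod_R, Rmult_1_r.
  rewrite Rabs_pos_eq by (apply Rlt_le, exp_pos).
  rewrite Rmult_plus_distr_r, exp_plus.
  replace (c 2%nat * (exp (rp * x) * exp (t * x)) / (1 + y ^ 2))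
    with (c 2%nat * exp (rp * x) / (1 + y ^ 2) * exp (t * x))
    by (field; apply Rgt_not_eq, one_plus_sqr_pos).
  apply Rmult_le_compat_r; [apply Rlt_le, exp_pos | exact H].
Qed.

Lemma decays_shift_left (x t : R) : x <= 0 ->
  decays (c 2%nat * exp ((rm - t) * - x)) (fun y => w (x, y) * Cexp (RtoC t * (x, y)))%C.
Proof.
  intros Hx y. pose proof (decays_left_0 x Hx y) as H.
  rewrite Cmod_mult, Cexp_line_cis, Cmod_mult, Cmod_cis, Cmod_R, Rmult_1_r.
  rewrite Rabs_pos_eq by (apply Rlt_le, exp_pos).
  replace ((rm - t) * - x) with (rm * - x + t * x) by ring. rewrite exp_plus.
  replace (c 2%nat * (exp (rm * - x) * exp (t * x)) / (1 + y ^ 2))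
    with (c 2%nat * exp (rm * - x) / (1 + y ^ 2) * exp (t * x))
    by (field; apply Rgt_not_eq, one_plus_sqr_pos).
  apply Rmult_le_compat_r; [apply Rlt_le, exp_pos | exact H].
Qed.

Lemma c2_pos : 0 <= c 2%nat.
Proof. exact (decays_pos _ _ (decays_axis 0)). Qed.

(** The bounds of Y depend on the abscissa; replacing the exponent by the product of absolute values
    at the farther line makes them uniform over the strip. *)
Lemma vertical_shift (x t : R) :
  LI (fun y => w (x, y) * Cexp (RtoC t * (x, y)))%C =
  LI (fun y => w (0, y) * Cexp (RtoC t * (0, y)))%C.
Proof.
  set (F := fun z => (w z * Cexp (RtoC t * z))%C).
  assert (HF : entire F) by (apply entire_mult_Cexp, Hw).
  assert (He : forall a b, exp (a * b) <= exp (Rabs a * Rabs b)).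
  { intros a b. apply exp_le. rewrite <- Rabs_mult. apply Rle_abs. }
  pose proof c2_pos as Hc.
  destruct (Rle_dec 0 x) as [Hx|Hx].
  - symmetry. apply (LI_vertical_shift F (c 2%nat * exp (Rabs (rp + t) * Rabs x)) 0 x HF Hx).
    intros x' Hx'. apply decays_weaken with (c 2%nat * exp ((rp + t) * x')).
    + apply decays_shift_right; lra.
    + apply Rmult_le_compat_l; trivial. eapply Rle_trans; [apply He|]. apply exp_le.
      apply Rmult_le_compat_l; [apply Rabs_pos|]. rewrite !Rabs_pos_eq; lra.
  - apply (LI_vertical_shift F (c 2%nat * exp (Rabs (rm - t) * Rabs x)) x 0 HF); [lra|].
    intros x' Hx'. apply decays_weaken with (c 2%nat * exp ((rm - t) * - x')).
    + apply decays_shift_left; lra.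
    + apply Rmult_le_compat_l; trivial. eapply Rle_trans; [apply He|]. apply exp_le.
      apply Rmult_le_compat_l; [apply Rabs_pos|]. rewrite Rabs_pos_eq, Rabs_left; lra.
Qed.

Lemma LI_axis_iLaplace (t : R) :
  LI (fun y => w (0, y) * Cexp (RtoC t * (0, y)))%C = (RtoC (2 * PI) * iLaplace w t)%C.
Proof.
  unfold iLaplace, iLaplace_n. rewrite Cmult_assoc, <- RtoC_mult.
  replace (2 * PI * / (2 * PI)) with 1 by (field; apply Rgt_not_eq, PI_RGT_0).
  rewrite Cmult_1_l. f_equal. apply functional_extensionality; intro y.
  rewrite Cexp_line_cis, Rmult_0_r, exp_0. simpl Cpow. ring.
Qed.

Lemma iLaplace_eq_0 (t : R) : LI (fun y => w (0, y) * Cexp (RtoC t * (0, y)))%C = RtoC 0 ->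
  iLaplace w t = RtoC 0.
Proof.
  rewrite LI_axis_iLaplace. intro H. pose proof PI_RGT_0.
  apply Cmod_eq_0. apply (f_equal Cmod) in H. rewrite Cmod_mult, Cmod_R, Cmod_0 in H.
  apply Rmult_integral in H. destruct H as [H|H]; [|assumption].
  rewrite Rabs_pos_eq in H; lra.
Qed.

(** On the line Re z = X > 0 the integral is at most 6 c_2 exp((rp + t) X), where rp + t < 0, while
    its value does not depend on X. *)
Lemma iLaplace_left (t : R) : t < - rp -> iLaplace w t = RtoC 0.
Proof.
  intro Ht. apply iLaplace_eq_0.
  apply eq_of_Cmod_le_div with (6 * (c 2%nat * / (- (rp + t)))) 1. intros X _ HX.
  rewrite <- (vertical_shift X).
  match goal with |- Cmod (?a - RtoC 0) <= _ => replace (a - RtoC 0)%C with a by ring end.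
  eapply Rle_trans; [apply LI_bound; [apply Ccont_shift_integrand | apply decays_shift_right; lra]|].
  pose proof (exp_decay_le (- (rp + t)) X ltac:(lra) HX) as H. rewrite Ropp_involutive in H.
  pose proof c2_pos.
  replace (6 * (c 2%nat * / - (rp + t)) / X) with (6 * (c 2%nat * (/ - (rp + t) / X))) by (field; lra).
  apply Rmult_le_compat_l; [lra|]. apply Rmult_le_compat_l; trivial.
Qed.

Lemma iLaplace_right (t : R) : rm < t -> iLaplace w t = RtoC 0.
Proof.
  intro Ht. apply iLaplace_eq_0.
  apply eq_of_Cmod_le_div with (6 * (c 2%nat * / (- (rm - t)))) 1. intros X _ HX.
  rewrite <- (vertical_shift (- X)).
  match goal with |- Cmod (?a - RtoC 0) <= _ => replace (a - RtoC 0)%C with a by ring end.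
  eapply Rle_trans; [apply LI_bound; [apply Ccont_shift_integrand | apply decays_shift_left; lra]|].
  pose proof (exp_decay_le (- (rm - t)) X ltac:(lra) HX) as H. rewrite Ropp_involutive in H.
  pose proof c2_pos. rewrite Ropp_involutive.
  replace (6 * (c 2%nat * / - (rm - t)) / X) with (6 * (c 2%nat * (/ - (rm - t) / X))) by (field; lra).
  apply Rmult_le_compat_l; [lra|]. apply Rmult_le_compat_l; trivial.
Qed.

Lemma supported_iLaplace : supported_in (- rp) rm (iLaplace w).
Proof.
  intros t Ht. split; apply Rnot_lt_le; intro H; apply Ht;
  [apply iLaplace_left | apply iLaplace_right]; assumption.
Qed.

(** Fourier inversion on the vertical line through z = x + ie, parametrised so that z sits at the
    origin. The transform of y -> w(x + i(y + e)) at t is 2 pi exp(-tz) times [iLaplace w t]: the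
    translation by e and the return to the imaginary axis produce the exponential factor. *)
Lemma Cint_iLaplace (z : C) (S : R) : 0 < S -> rm <= S ->
  Cint (fun t => Cexp (- (RtoC t * z)) * iLaplace w t)%C (- S) S = w z.
Proof.
  intros HS HrS. destruct z as [x e].
  set (g := fun y => w (x, (y + e)%R)).
  set (G := fun t => (RtoC (2 * PI) * (Cexp (- (RtoC t * (x, e))) * iLaplace w t))%C).
  assert (Hgc : Ccont g).
  { apply (Ccont_comp (fun y => w (x, y)) (fun y => y + e));
    [apply Ccont_vertical, Hw | intro; apply continuous_shift]. }
  assert (Hf : Ccont (iLaplace w)) by apply Ccont_smooth, smooth_iLaplace.
  assert (HfG : Ccont (fun t => Cexp (- (RtoC t * (x, e))) * iLaplace w t)%C) by ccont.
  assert (HG : Ccont G) by (unfold G; ccont).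
  assert (Hwd : exists M, decays M (fun y => w (x, y))).
  { destruct (Rle_dec 0 x) as [Hx|Hx].
    - exists (c 2%nat * exp (rp * x)). apply decays_right_0, Hx.
    - exists (c 2%nat * exp (rm * - x)). apply decays_left_0; lra. }
  destruct Hwd as [M HM].
  assert (HGE : forall t, G t = LI (fun y => g y * cis (y * t))%C).
  { intro t.
    transitivity (Cexp (- (RtoC t * (x, e))) * LI (fun y => w (x, y) * Cexp (RtoC t * (x, y))))%C.
    - rewrite vertical_shift, LI_axis_iLaplace. unfold G. ring.
    - assert (Hex : exists N, decays N (fun y => w (x, y) * Cexp (RtoC t * (x, y)))%C).
      { destruct (Rle_dec 0 x) as [Hx|Hx]; eexists;
        [apply decays_shift_right, Hx | apply decays_shift_left; lra]. }
      destruct Hex as [N HN].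
      rewrite <- (LI_scal N) by (trivial; apply Ccont_shift_integrand).
      rewrite <- (LI_shift (Cmod (Cexp (- (RtoC t * (x, e)))) * N) e).
      + f_equal. apply functional_extensionality; intro y. unfold g.
        transitivity (w (x, (y + e)%R) *
          (Cexp (- (RtoC t * (x, e))) * Cexp (RtoC t * (x, (y + e)%R))))%C; [ring|].
        rewrite <- Cexp_plus. f_equal.
        replace (- (RtoC t * (x, e)) + RtoC t * (x, (y + e)%R))%C with (RtoC t * (0, y))%C
          by (apply C_ext; simpl; ring).
        rewrite Cexp_line_cis, Rmult_0_r, exp_0. ring.
      + apply Ccont_mult; [apply Ccont_const | apply Ccont_shift_integrand].
      + apply decays_scal, HN. }
  assert (HG0 : forall t, S < Rabs t -> G t = RtoC 0).
  { intros t Ht. unfold G. replace (iLaplace w t) with (RtoC 0); [ring|].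
    destruct (Rle_dec 0 t) as [H0|H0].
    - rewrite Rabs_pos_eq in Ht by assumption. symmetry; apply iLaplace_right; lra.
    - symmetry; apply iLaplace_left; lra. }
  pose proof (fourier_inversion g G (M * (2 * (1 + e ^ 2))) S Hgc (decays_shift M e _ HM) HG HGE HS HG0) as H.
  unfold G in H. rewrite Cint_scal in H by assumption.
  unfold g in H. rewrite Rplus_0_l in H.
  pose proof PI_RGT_0 as HPI.
  assert (HPI0 : RtoC (2 * PI) <> RtoC 0) by (intro E; apply RtoC_inj in E; lra).
  apply (f_equal (fun u => / RtoC (2 * PI) * u)%C) in H.
  rewrite !Cmult_assoc, Cinv_l, !Cmult_1_l in H by assumption. exact H.
Qed.

End InverseTransform.

(** * The Laplace transform of test functions *)

Lemma supported_out (a b t : R) (f : R -> C) : supported_in a b f -> t < a \/ b < t -> f t = RtoC 0.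
Proof.
  intros H Ht. destruct (Req_dec (Cmod (f t)) 0) as [H0|H0]; [apply Cmod_eq_0, H0|].
  assert (Hn : f t <> RtoC 0) by (intro E; apply H0; rewrite E; apply Cmod_0).
  apply H in Hn. lra.
Qed.

Lemma supported_Cderive_n (a b : R) (f : R -> C) (n : nat) :
  supported_in a b f -> supported_in a b (Cderive_n f n).
Proof.
  intros H t Ht.
  assert (Hout : t < a \/ b < t -> Cderive_n f n t = RtoC 0).
  { intro Hab.
    assert (Hloc : locally t (fun s => f s = RtoC 0)).
    { destruct Hab as [Hab|Hab].
      - exists (mkposreal (a - t) ltac:(lra)). intros s Hs.
        change (Rabs (s - t) < a - t) in Hs. apply Rabs_lt_between in Hs.
        apply (supported_out a b s f H). lra.
      - exists (mkposreal (t - b) ltac:(lra)). intros s Hs.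
        change (Rabs (s - t) < t - b) in Hs. apply Rabs_lt_between in Hs.
        apply (supported_out a b s f H). lra. }
    assert (H0 : Derive_n (fun _ => 0) n t = 0) by (destruct n; [reflexivity | apply Derive_n_const]).
    apply C_ext; simpl; rewrite (Derive_n_ext_loc _ (fun _ => 0)); trivial;
    (eapply filter_imp; [|exact Hloc]); intros s Hs; simpl; rewrite Hs; reflexivity. }
  destruct (Rlt_dec t a) as [H1|H1]; [exfalso; apply Ht, Hout; lra|].
  destruct (Rlt_dec b t) as [H2|H2]; [exfalso; apply Ht, Hout; lra|]. lra.
Qed.

Lemma decays_compact (a b : R) (f : R -> C) : Ccont f -> supported_in a b f -> exists M, decays M f.
Proof.
  intros Hf Hs. destruct (Rle_dec a b) as [Hab|Hab].
  - destruct (continuity_ab_maj (fun t => Cmod (f t) * (1 + t ^ 2)) a b Hab) as [m [Hm _]].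
    + intros c _. apply continuity_pt_filterlim.
      apply (continuous_mult (K := R_AbsRing) (fun t => Cmod (f t)) (fun t => 1 + t ^ 2)).
      * apply Ccont_Cmod, Hf.
      * apply (ex_derive_continuous (V := R_NormedModule)). auto_derive; trivial.
    + exists (Cmod (f m) * (1 + m ^ 2)). intro t.
      apply Rle_div_r; [apply one_plus_sqr_pos|].
      destruct (Rlt_dec t a) as [H1|H1]; [|destruct (Rlt_dec b t) as [H2|H2]].
      * rewrite (supported_out a b t f Hs) by lra. rewrite Cmod_0, Rmult_0_l.
        apply Rmult_le_pos; [apply Cmod_ge_0 | apply Rlt_le, one_plus_sqr_pos].
      * rewrite (supported_out a b t f Hs) by lra. rewrite Cmod_0, Rmult_0_l.
        apply Rmult_le_pos; [apply Cmod_ge_0 | apply Rlt_le, one_plus_sqr_pos].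
      * apply Hm; lra.
  - exists 0. intro t. rewrite (supported_out a b t f Hs) by lra. rewrite Cmod_0. lra.
Qed.

Lemma Cint_supported (g : R -> C) (a b u v : R) : Ccont g ->
  u <= a -> a <= b -> b <= v -> (forall t, t < a \/ b < t -> g t = RtoC 0) ->
  Cint g u v = Cint g a b.
Proof.
  intros Hg Hua Hab Hbv H0.
  rewrite <- (Cint_Chasles g u a v), <- (Cint_Chasles g a b v) by assumption.
  rewrite (Cint_zero g u a), (Cint_zero g b v); [ring | |];
  intros t; rewrite Rmin_left, Rmax_right by lra; intro Ht; apply H0; lra.
Qed.

Lemma LI_compact (g : R -> C) (M S : R) : Ccont g -> decays M g -> 0 <= S ->
  (forall t, t < 0 \/ S < t -> g t = RtoC 0) -> LI g = Cint g 0 S.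
Proof.
  intros Hg HM HS H0. apply LI_unique with M M S; trivial.
  intros T HST HT. rewrite (Cint_supported g 0 S (- T) T) by (trivial; lra).
  replace (Cint g 0 S - Cint g 0 S)%C with (RtoC 0) by ring. rewrite Cmod_0.
  apply Rdiv_le_0_compat; [apply (decays_pos M g HM) | assumption].
Qed.

Definition Laplace_kernel (f : R -> C) (z : C) (t : R) : C := (Cexp (- (RtoC t * z)) * f t)%C.

Lemma Ccont_Laplace_kernel (f : R -> C) (z : C) : Ccont f -> Ccont (Laplace_kernel f z).
Proof. intro Hf. unfold Laplace_kernel. ccont. Qed.

Lemma Laplace_kernel_out (f : R -> C) (z : C) (t : R) : f t = RtoC 0 -> Laplace_kernel f z t = RtoC 0.
Proof. intro H. unfold Laplace_kernel. rewrite H. ring. Qed.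

Lemma Laplace_Cint (f : R -> C) (a b S : R) (z : C) : Ccont f -> supported_in a b f ->
  0 < a -> 0 <= S -> b <= S -> Laplace f z = Cint (Laplace_kernel f z) 0 S.
Proof.
  intros Hf Hs Ha HS HbS. unfold Laplace.
  apply (is_RInt_gen_unique (V := C_R_CompleteNormedModule)).
  intros P HP.
  (* For upper limits beyond [S] the integral is constant, because the integrand vanishes there. *)
  exists (fun x => x = 0) (fun x => S < x).
  - reflexivity.
  - exists S; auto.
  - intros x y -> Hy. exists (Cint (Laplace_kernel f z) 0 S). split.
    + simpl. rewrite <- (Cint_supported (Laplace_kernel f z) 0 S 0 y); try lra.
      * apply is_RInt_Cint, Ccont_Laplace_kernel, Hf.
      * apply Ccont_Laplace_kernel, Hf.
      * intros t Ht. apply Laplace_kernel_out, (supported_out a b t f Hs). lra.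
    + apply locally_singleton, HP.
Qed.

Lemma C0inf_Laplace_Cint (f : R -> C) : mem C0inf f ->
  exists a b S, 0 < a /\ supported_in a b f /\ 0 < S /\ b < S /\
    forall z, Laplace f z = Cint (Laplace_kernel f z) 0 S.
Proof.
  intros [Hf [a [b [Ha Hs]]]]. exists a, b, (Rmax 0 b + 1).
  pose proof (Rmax_l 0 b). pose proof (Rmax_r 0 b).
  split; [exact Ha|]. split; [exact Hs|]. split; [lra|]. split; [lra|].
  intro z. apply Laplace_Cint with a b; trivial; try lra. apply Ccont_smooth, Hf.
Qed.

Lemma C0inf_mem_Ccont (f : R -> C) : mem C0inf f -> Ccont f.
Proof. intros [Hf _]. apply Ccont_smooth, Hf. Qed.

Lemma C0inf_lin (c : C) (f g : R -> C) : mem C0inf f -> mem C0inf g ->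
  mem C0inf (fun t => c * f t + g t)%C.
Proof.
  intros [Hf [a [b [Ha Hs]]]] [Hg [a' [b' [Ha' Hs']]]]. split.
  - set (D := fun n t => (c * Cderive_n f n t + Cderive_n g n t)%C).
    replace (fun t => c * f t + g t)%C with (D O).
    + apply smooth_of_Cder. intros n t.
      destruct (is_Cder_Cderive_n f n t Hf) as [F1 F2].
      destruct (is_Cder_Cderive_n g n t Hg) as [G1 G2].
      split.
      * apply (is_derive_plus (V := R_NormedModule)
          (fun s => Re (c * Cderive_n f n s)) (fun s => Re (Cderive_n g n s))); trivial.
        apply (is_derive_minus (V := R_NormedModule)
          (fun s => Re c * Re (Cderive_n f n s)) (fun s => Im c * Im (Cderive_n f n s)));
        apply is_derive_scal; assumption.
      * apply (is_derive_plus (V := R_NormedModule)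
          (fun s => Im (c * Cderive_n f n s)) (fun s => Im (Cderive_n g n s))); trivial.
        apply (is_derive_plus (V := R_NormedModule)
          (fun s => Re c * Im (Cderive_n f n s)) (fun s => Im c * Re (Cderive_n f n s)));
        apply is_derive_scal; assumption.
    + unfold D. rewrite !Cderive_n_0. reflexivity.
  - exists (Rmin a a'), (Rmax b b'). split; [apply Rmin_glb_lt; assumption|].
    intros t Ht. pose proof (Rmin_l a a'). pose proof (Rmin_r a a').
    pose proof (Rmax_l b b'). pose proof (Rmax_r b b').
    assert (H3 : forall u v, u <= a -> b <= v -> u <= a' -> b' <= v -> u <= t <= v).
    { intros u v Hu1 Hv1 Hu2 Hv2.
      split; apply Rnot_lt_le; intro Hn; apply Ht;
      rewrite (supported_out a b t f Hs), (supported_out a' b' t g Hs') by lra; ring. }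
    apply H3; assumption.
Qed.

Lemma Laplace_lin (c : C) (f g : R -> C) : mem C0inf f -> mem C0inf g ->
  Laplace (fun t => c * f t + g t)%C = (fun z => c * Laplace f z + Laplace g z)%C.
Proof.
  intros Hf Hg. apply functional_extensionality; intro z.
  pose proof (C0inf_lin c f g Hf Hg) as Hfg.
  pose proof (C0inf_mem_Ccont f Hf) as Cf. pose proof (C0inf_mem_Ccont g Hg) as Cg.
  pose proof (C0inf_mem_Ccont _ Hfg) as Cfg.
  destruct Hf as [_ [a [b [Ha Hs]]]], Hg as [_ [a' [b' [Ha' Hs']]]], Hfg as [_ [a'' [b'' [Ha'' Hs'']]]].
  set (S := Rmax 0 (Rmax b (Rmax b' b''))).
  assert (0 <= S) by apply Rmax_l.
  assert (Hm : Rmax b (Rmax b' b'') <= S) by apply Rmax_r.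
  assert (b <= S) by (eapply Rle_trans; [apply Rmax_l | exact Hm]).
  assert (Hm' : Rmax b' b'' <= S) by (eapply Rle_trans; [apply Rmax_r | exact Hm]).
  assert (b' <= S) by (eapply Rle_trans; [apply Rmax_l | exact Hm']).
  assert (b'' <= S) by (eapply Rle_trans; [apply Rmax_r | exact Hm']).
  rewrite (Laplace_Cint f a b S), (Laplace_Cint g a' b' S),
    (Laplace_Cint (fun t => c * f t + g t)%C a'' b'' S) by trivial.
  pose proof (Ccont_Laplace_kernel f z Cf) as Kf. pose proof (Ccont_Laplace_kernel g z Cg) as Kg.
  rewrite <- (Cint_scal c _ 0 S Kf).
  rewrite <- (Cint_plus _ _ 0 S (Ccont_mult _ _ (Ccont_const c) Kf) Kg).
  f_equal. apply functional_extensionality; intro t. unfold Laplace_kernel; ring.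
Qed.

(** On the imaginary axis the Laplace transform is the Fourier transform, so that of each translate
    of f vanishes, and inversion at 0 gives every value of f. *)
Lemma Laplace_eq_0 (f : R -> C) : mem C0inf f -> (forall z, Laplace f z = RtoC 0) ->
  forall t, f t = RtoC 0.
Proof.
  intros Hmem H0 t0. pose proof (C0inf_mem_Ccont f Hmem) as Hf.
  destruct (C0inf_Laplace_Cint f Hmem) as [a [b [S [Ha [Hs [HS [HbS HL]]]]]]].
  destruct (decays_compact a b f Hf Hs) as [M HM].
  set (g := fun t => f (t + t0)).
  assert (Hg : Ccont g) by (apply (Ccont_comp f); [assumption | intro; apply continuous_shift]).
  pose proof (decays_shift M t0 f HM) as Hgd.
  assert (HG : forall x, RtoC 0 = LI (fun t => g t * cis (t * x))%C).
  { intro x.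
    assert (Hfc : Ccont (fun t => f t * cis (t * x))%C) by (apply Ccont_mult; [assumption | apply Ccont_cis_scal]).
    assert (Hfd := decays_mult_cis M x f HM).
    transitivity (cis (- (t0 * x)) * LI (fun t => f t * cis (t * x)))%C.
    - rewrite (LI_compact _ M S) by (trivial; try lra; intros t Ht;
        rewrite (supported_out a b t f Hs) by lra; ring).
      rewrite (Cint_ext _ (Laplace_kernel f (0, - x))).
      + rewrite <- HL, H0. ring.
      + intros t _. unfold Laplace_kernel.
        replace (- (RtoC t * (0%R, (- x)%R)))%C with (RtoC t * (0, x))%C by (apply C_ext; simpl; ring).
        rewrite Cexp_line_cis, Rmult_0_r, exp_0, (Rmult_comm x t). ring.
    - rewrite <- (LI_scal M) by assumption.
      rewrite <- (LI_shift (Cmod (cis (- (t0 * x))) * M) t0).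
      + f_equal. apply functional_extensionality; intro t. unfold g.
        transitivity (f (t + t0)%R * (cis (- (t0 * x)) * cis ((t + t0) * x)))%C; [ring|].
        rewrite <- cis_plus. f_equal. f_equal. ring.
      + apply Ccont_mult; [apply Ccont_const | assumption].
      + apply decays_scal, Hfd. }
  (* The interval [-1, 1] is arbitrary: the transform is identically zero. *)
  pose proof (fourier_inversion g (fun _ => RtoC 0) _ 1 Hg Hgd (Ccont_const 0) HG ltac:(lra) (fun _ _ => eq_refl)) as H.
  rewrite Cint_const in H. unfold g in H. rewrite Rplus_0_l in H.
  apply Cmod_eq_0. pose proof PI_RGT_0.
  apply (f_equal Cmod) in H. rewrite Cmult_0_r, Cmod_0, Cmod_mult, Cmod_R in H.
  symmetry in H. apply Rmult_integral in H. destruct H as [H|H]; [|assumption].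
  rewrite Rabs_pos_eq in H; lra.
Qed.

Lemma Laplace_inj (f g : R -> C) : mem C0inf f -> mem C0inf g -> Laplace f = Laplace g -> f = g.
Proof.
  intros Hf Hg H. apply functional_extensionality; intro t.
  assert (E : (RtoC (-1) * g t + f t)%C = RtoC 0).
  { apply (Laplace_eq_0 (fun t => RtoC (-1) * g t + f t)%C).
    - apply C0inf_lin; assumption.
    - intro z. rewrite Laplace_lin by assumption. rewrite H.
      apply C_ext; simpl; ring. }
  transitivity ((RtoC (-1) * g t + f t) + g t)%C; [apply C_ext; unfold Re, Im; simpl; ring | rewrite E; ring].
Qed.

Lemma C0inf_iLaplace (w : C -> C) : mem Y w -> mem C0inf (iLaplace w).
Proof.
  intros [Hw [rp [rm [c [Hrp Hb]]]]]. split.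
  - apply smooth_iLaplace with rp rm c; assumption.
  - exists (- rp), rm. split; [lra|]. apply supported_iLaplace with c; assumption.
Qed.

Lemma Laplace_iLaplace (w : C -> C) : mem Y w -> Laplace (iLaplace w) = w.
Proof.
  intro HwY. pose proof (C0inf_mem_Ccont _ (C0inf_iLaplace w HwY)) as Hc.
  destruct HwY as [Hw [rp [rm [c [Hrp Hb]]]]].
  pose proof (supported_iLaplace w rp rm c Hw Hb) as Hs.
  apply functional_extensionality; intro z.
  pose proof (Rmax_l 1 rm). pose proof (Rmax_r 1 rm).
  rewrite (Laplace_Cint _ (- rp) rm (Rmax 1 rm)) by (trivial; lra).
  rewrite <- (Cint_iLaplace w rp rm c Hw Hrp Hb z (Rmax 1 rm)) by lra.
  symmetry. apply Cint_supported; try lra.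
  - apply Ccont_Laplace_kernel, Hc.
  - intros t Ht. apply Laplace_kernel_out, (supported_out _ _ t _ Hs). lra.
Qed.

Lemma iLaplace_lin (c : C) (v w : C -> C) : mem Y v -> mem Y w ->
  iLaplace (fun z => c * v z + w z)%C = (fun t => c * iLaplace v t + iLaplace w t)%C.
Proof.
  intros [Hv [rp [rm [cv [Hrp Hb]]]]] [Hw [rp' [rm' [cw [Hrp' Hb']]]]].
  apply functional_extensionality; intro t. unfold iLaplace, iLaplace_n.
  pose proof (Ccont_axis_cis v Hv 0 t) as C1. pose proof (Ccont_axis_cis w Hw 0 t) as C2.
  pose proof (decays_axis_cis v rp rm cv Hb 0 t) as D1.
  pose proof (decays_axis_cis w rp' rm' cw Hb' 0 t) as D2.
  transitivity (RtoC (/ (2 * PI)) * (c * LI (fun y => (0, y) ^ 0 * v (0, y) * cis (y * t))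
     + LI (fun y => (0, y) ^ 0 * w (0, y) * cis (y * t))))%C; [|ring].
  f_equal.
  rewrite <- (LI_scal _ c _ C1 D1).
  rewrite <- (LI_plus _ _ _ _ (Ccont_mult _ _ (Ccont_const c) C1) C2 (decays_scal _ c _ D1) D2).
  f_equal. apply functional_extensionality; intro y. ring.
Qed.

(** * Laplace transforms of test functions belong to Y *)

Lemma Laplace_kernel_Cder (g : R -> C) (dg : C) (z : C) (t : R) : is_Cder g t dg ->
  is_Cder (Laplace_kernel g z) t (- z * Laplace_kernel g z t + Cexp (- (RtoC t * z)) * dg)%C.
Proof.
  intro Hg. unfold Laplace_kernel.
  replace (fun t => Cexp (- (RtoC t * z)) * g t)%C with (fun t => Cexp (RtoC t * - z) * g t)%C
    by (apply functional_extensionality; intro; f_equal; f_equal; ring).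
  replace (- (RtoC t * z))%C with (RtoC t * - z)%C by ring.
  rewrite Cmult_assoc. apply is_Cder_mult; [apply is_Cder_Cexp | exact Hg].
Qed.

(** Integration by parts without boundary terms; each factor z is traded for a derivative of g. *)
Lemma Cint_Laplace_kernel_derive (g dg : R -> C) (z : C) (S : R) :
  (forall t, is_Cder g t (dg t)) -> Ccont dg -> g 0 = RtoC 0 -> g S = RtoC 0 ->
  (z * Cint (Laplace_kernel g z) 0 S)%C = Cint (Laplace_kernel dg z) 0 S.
Proof.
  intros Hg Hdg H0 HS. pose proof (is_Cder_Ccont g dg Hg) as Hgc.
  pose proof (Ccont_Laplace_kernel g z Hgc) as K1. pose proof (Ccont_Laplace_kernel dg z Hdg) as K2.
  assert (E : Cint (fun t => - z * Laplace_kernel g z t + Laplace_kernel dg z t)%C 0 S = RtoC 0).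
  { rewrite (Cint_derive (Laplace_kernel g z)).
    - rewrite !Laplace_kernel_out by assumption. ring.
    - intro t. exact (proj1 (Laplace_kernel_Cder g (dg t) z t (Hg t))).
    - intro t. exact (proj2 (Laplace_kernel_Cder g (dg t) z t (Hg t))).
    - apply Ccont_plus; [apply Ccont_mult; [apply Ccont_const|]|]; assumption. }
  rewrite (Cint_plus _ _ 0 S (Ccont_mult _ _ (Ccont_const (- z)) K1) K2), (Cint_scal (- z) _ 0 S K1) in E.
  rewrite <- (Cplus_0_r (z * _)), <- E. ring.
Qed.

(** Reduces the weight (1 + |z|)^n of Y to 1 and |z|^n, the quantities that integration by parts
    controls. *)
Lemma one_plus_pow_le (x : R) (n : nat) : 0 <= x -> (1 + x) ^ n <= 2 ^ n * (1 + x ^ n).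
Proof.
  intro Hx. pose proof (pow_lt 2 n ltac:(lra)) as H2.
  pose proof (pow_le x n Hx) as Hxn.
  destruct (Rle_dec x 1) as [H|H].
  - apply Rle_trans with (2 ^ n); [apply pow_incr; lra | nra].
  - apply Rle_trans with ((2 * x) ^ n); [apply pow_incr; lra|].
    rewrite Rpow_mult_distr. nra.
Qed.

Section TransformOfTestFunction.
Variables (f : R -> C) (a b S : R).
Hypothesis Hf : smooth f.
Hypothesis Ha : 0 < a.
Hypothesis Hs : supported_in a b f.
Hypothesis HS : 0 < S.
Hypothesis HbS : b < S.

Let L (z : C) : C := Cint (Laplace_kernel f z) 0 S.

Lemma Laplace_pow (n : nat) (z : C) :
  (z ^ n * L z)%C = Cint (Laplace_kernel (Cderive_n f n) z) 0 S.
Proof.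
  induction n as [|n IH].
  - rewrite Cderive_n_0. unfold L. simpl; ring.
  - simpl Cpow. rewrite <- Cmult_assoc, IH. apply Cint_Laplace_kernel_derive.
    + intro t; apply is_Cder_Cderive_n, Hf.
    + apply smooth_Ccont, Hf.
    + apply (supported_out a b _ _ (supported_Cderive_n a b f n Hs)); lra.
    + apply (supported_out a b _ _ (supported_Cderive_n a b f n Hs)); lra.
Qed.

Definition Laplace_const (n : nat) : R := RInt (fun t => Cmod (Cderive_n f n t)) 0 S.

(** The number [r] bounds the exponent over the support and serves both half-planes: it will be -a
    |Re z| on the right and b |Re z| on the left. *)
Lemma Laplace_pow_bound (n : nat) (z : C) (r : R) :
  (forall t, a <= t <= b -> - (t * Re z) <= r) ->
  Cmod (z ^ n * L z) <= Laplace_const n * exp r.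
Proof.
  intro Hr. rewrite Laplace_pow. unfold Laplace_const. rewrite Rmult_comm.
  assert (Hc : forall t, continuous (fun s => Cmod (Cderive_n f n s)) t)
    by (apply Ccont_Cmod, smooth_Ccont, Hf).
  eapply Rle_trans; [apply (Cint_le _ (fun t => exp r * Cmod (Cderive_n f n t)))|].
  - apply Ccont_Laplace_kernel, smooth_Ccont, Hf.
  - intro t. apply (continuous_mult (K := R_AbsRing)); [apply continuous_const | apply Hc].
  - lra.
  - intros t Ht. unfold Laplace_kernel. rewrite Cmod_mult.
    pose proof (supported_Cderive_n a b f n Hs) as Hsn.
    destruct (Rlt_dec t a) as [H1|H1]; [|destruct (Rlt_dec b t) as [H2|H2]].
    + rewrite (supported_out a b t _ Hsn) by lra. rewrite Cmod_0, !Rmult_0_r; lra.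
    + rewrite (supported_out a b t _ Hsn) by lra. rewrite Cmod_0, !Rmult_0_r; lra.
    + apply Rmult_le_compat_r; [apply Cmod_ge_0|]. rewrite Cmod_Cexp. apply exp_le.
      replace (Re (- (RtoC t * z))) with (- (t * Re z)) by (unfold Re; simpl; ring).
      apply Hr; lra.
  - apply Req_le. exact (RInt_scal (V := R_CompleteNormedModule) _ 0 S (exp r) (ex_RInt_cont _ 0 S Hc)).
Qed.

Lemma Laplace_bound (n : nat) (z : C) (r : R) :
  (forall t, a <= t <= b -> - (t * Re z) <= r) ->
  Cmod (L z) <= 2 ^ n * (Laplace_const 0 + Laplace_const n) * / (1 + Cmod z) ^ n * exp r.
Proof.
  intro Hr. pose proof (Cmod_ge_0 z) as Hz.
  assert (Hp : 0 < (1 + Cmod z) ^ n) by (apply pow_lt; lra).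
  pose proof (Laplace_pow_bound 0 z r Hr) as H0. pose proof (Laplace_pow_bound n z r Hr) as Hn.
  simpl Cpow in H0. rewrite Cmult_1_l in H0. rewrite Cmod_mult, Cmod_pow in Hn.
  apply Rmult_le_reg_l with ((1 + Cmod z) ^ n); trivial.
  replace ((1 + Cmod z) ^ n * (2 ^ n * (Laplace_const 0 + Laplace_const n) * / (1 + Cmod z) ^ n * exp r))
    with (2 ^ n * ((Laplace_const 0 + Laplace_const n) * exp r)) by (field; lra).
  apply Rle_trans with (2 ^ n * (1 + Cmod z ^ n) * Cmod (L z)).
  - apply Rmult_le_compat_r; [apply Cmod_ge_0 | apply one_plus_pow_le, Hz].
  - rewrite Rmult_assoc. apply Rmult_le_compat_l; [apply pow_le; lra|]. lra.
Qed.

Lemma Y_bound_Laplace :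
  Y_bound (- a) b (fun n => 2 ^ n * (Laplace_const 0 + Laplace_const n)) L.
Proof.
  intros n z. split; intro Hz; apply Laplace_bound; intros t Ht.
  - rewrite Rabs_pos_eq by assumption. nra.
  - rewrite Rabs_left1 by assumption. nra.
Qed.

Lemma entire_Laplace : entire L.
Proof.
  pose proof (Ccont_smooth f Hf) as Hc.
  destruct (decays_compact a b f Hc Hs) as [M HM].
  pose proof (decays_bounded M f HM) as Hfb. pose proof (decays_pos M f HM) as HM0.
  intro z. exists (Cint (fun t => - RtoC t * Laplace_kernel f z t)%C 0 S).
  (* For |h| <= 1 the exponential remainder at -th is at most S^2 exp(S) |h|^2, the kernel at z is
     at most exp(S |z|) M, and S - 0 is the length of the interval. *)
  apply is_derive_C_quadratic with (S ^ 2 * exp S * (exp (S * Cmod z) * M) * (S - 0)).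
  intros w Hw. set (h := (w - z)%C) in *. replace w with (z + h)%C by (unfold h; ring).
  unfold L.
  rewrite (Cmult_comm h), (Cmult_comm _ h).
  assert (Kc : forall z, Ccont (Laplace_kernel f z)) by (intro; apply Ccont_Laplace_kernel, Hc).
  assert (Kt : Ccont (fun t => - RtoC t * Laplace_kernel f z t)%C)
    by (apply Ccont_mult; [ccont | apply Kc]).
  rewrite <- Cint_scal by assumption.
  rewrite <- Cint_minus by apply Kc.
  rewrite <- (Cint_minus _ _ 0 S (Ccont_minus _ _ (Kc _) (Kc _)) (Ccont_mult _ _ (Ccont_const h) Kt)).
  replace (S ^ 2 * exp S * (exp (S * Cmod z) * M) * (S - 0) * (Cmod h * Cmod h))
    with (S ^ 2 * exp S * (exp (S * Cmod z) * M) * (Cmod h * Cmod h) * (S - 0)) by ring.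
  apply Cint_le_const; [|lra|].
  { apply Ccont_minus; [apply Ccont_minus; apply Kc | apply Ccont_mult; [apply Ccont_const | assumption]]. }
  intros t Ht. unfold Laplace_kernel.
  replace (- (RtoC t * (z + h)))%C with (- (RtoC t * z) + RtoC t * - h)%C by ring.
  rewrite Cexp_plus.
  replace (_ - _)%C with ((Cexp (RtoC t * - h) - 1 - RtoC t * - h) * (Cexp (- (RtoC t * z)) * f t))%C by ring.
  rewrite Cmod_mult. pose proof (Cmod_ge_0 h) as Hh0.
  replace (S ^ 2 * exp S * (exp (S * Cmod z) * M) * (Cmod h * Cmod h))
    with (S * Cmod h * (S * Cmod h * exp S) * (exp (S * Cmod z) * M)) by ring.
  assert (HSh : Cmod (RtoC t * - h) <= S * Cmod h).
  { rewrite Cmod_mult, Cmod_opp, Cmod_R, Rabs_pos_eq by lra. apply Rmult_le_compat_r; lra. }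
  apply Rmult_le_compat; try apply Cmod_ge_0.
  - eapply Rle_trans; [apply Cexp_bound2|].
    pose proof (Cmod_ge_0 (RtoC t * - h)). pose proof (exp_pos (Rabs (Re (RtoC t * - h)))).
    apply Rmult_le_compat; trivial; [apply Rmult_le_pos; lra|].
    apply Rmult_le_compat; trivial; [lra|]. apply exp_le.
    eapply Rle_trans; [apply re_le_Cmod|]. nra.
  - rewrite Cmod_mult. apply Rmult_le_compat; try apply Cmod_ge_0; [|apply Hfb].
    rewrite Cmod_Cexp. apply exp_le. eapply Rle_trans; [apply Re_le_Cmod|].
    rewrite Cmod_opp, Cmod_mult, Cmod_R, Rabs_pos_eq by lra.
    pose proof (Cmod_ge_0 z). apply Rmult_le_compat_r; lra.
Qed.

End TransformOfTestFunction.

Lemma Y_Laplace (f : R -> C) : mem C0inf f -> mem Y (Laplace f).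
Proof.
  intro Hf. destruct (C0inf_Laplace_Cint f Hf) as [a [b [S [Ha [Hs [HS [HbS HL]]]]]]].
  destruct Hf as [Hf _].
  replace (Laplace f) with (fun z => Cint (Laplace_kernel f z) 0 S)
    by (apply functional_extensionality; intro; symmetry; apply HL).
  split.
  - exact (entire_Laplace f a b S Hf Hs HS).
  - exists (- a), b. eexists. split; [lra|].
    exact (Y_bound_Laplace f a b S Hf Ha Hs HS HbS).
Qed.

Lemma iLaplace_Laplace (f : R -> C) : mem C0inf f -> iLaplace (Laplace f) = f.
Proof.
  intro Hf. pose proof (Y_Laplace f Hf) as HY.
  apply Laplace_inj; trivial; [apply C0inf_iLaplace, HY | apply Laplace_iLaplace, HY].
Qed.

(** * Laplace convolution *)

(** The derivative is bounded only at points no farther from t than u, so that the bound may itself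
    depend on |u - t|, as it does in the Taylor estimate. *)
Lemma Cder_lipschitz (g dg : R -> C) (K t u : R) :
  (forall v, is_Cder g v (dg v)) -> Ccont dg ->
  (forall v, Rabs (v - t) <= Rabs (u - t) -> Cmod (dg v) <= K) ->
  Cmod (g u - g t) <= K * Rabs (u - t).
Proof.
  intros Hg Hdg HK.
  assert (E : forall a b, Cint dg a b = (g b - g a)%C).
  { intros a b. apply (Cint_derive g); trivial; intro v; [exact (proj1 (Hg v)) | exact (proj2 (Hg v))]. }
  destruct (Rle_dec t u) as [Htu|Htu].
  - rewrite <- E, (Rabs_pos_eq (u - t)) by lra. apply Cint_le_const; trivial.
    intros v Hv. apply HK. rewrite !Rabs_pos_eq; lra.
  - replace (g u - g t)%C with (- (g t - g u))%C by ring. rewrite Cmod_opp, <- E.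
    replace (Rabs (u - t)) with (t - u) by (rewrite Rabs_left; lra).
    apply Cint_le_const; trivial; [lra|].
    intros v Hv. apply HK. rewrite !Rabs_left1; lra.
Qed.

(** The Lipschitz estimate is applied twice: [phi] has derivative dg u - dg t, which is at most K |u
    - t|. *)
Lemma Cder_taylor (g dg ddg : R -> C) (K t h : R) :
  (forall v, is_Cder g v (dg v)) -> (forall v, is_Cder dg v (ddg v)) -> Ccont ddg ->
  (forall v, Cmod (ddg v) <= K) ->
  Cmod (g (t + h)%R - g t - RtoC h * dg t) <= K * h ^ 2.
Proof.
  intros Hg Hdg Hddg HK.
  set (phi := fun u => (g u + RtoC (u - t) * - dg t)%C).
  replace (g (t + h)%R - g t - RtoC h * dg t)%C with (phi (t + h)%R - phi t)%C.
  - replace (K * h ^ 2) with (K * Rabs (t + h - t) * Rabs (t + h - t)).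
    + apply (Cder_lipschitz phi (fun u => dg u - dg t)%C).
      * intro v. destruct (Hg v) as [H1 H2]. split.
        -- unfold phi.
           apply (is_derive_plus (V := R_NormedModule) (fun u => Re (g u))
             (fun u => (u - t) * - Re (dg t) - 0 * - Im (dg t))); trivial.
           auto_derive; trivial; unfold Re, Im; simpl; ring.
        -- unfold phi.
           apply (is_derive_plus (V := R_NormedModule) (fun u => Im (g u))
             (fun u => (u - t) * - Im (dg t) + 0 * - Re (dg t))); trivial.
           auto_derive; trivial; unfold Re, Im; simpl; ring.
      * apply Ccont_minus; [apply (is_Cder_Ccont dg ddg Hdg) | apply Ccont_const].
      * intros v Hv. eapply Rle_trans; [apply (Cder_lipschitz dg ddg K); trivial; intros; apply HK|].
        apply Rmult_le_compat_l; [|exact Hv].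
        eapply Rle_trans; [apply Cmod_ge_0 | apply (HK 0)].
    + replace (t + h - t) with h by ring. rewrite <- (pow2_abs h). ring.
  - unfold phi. replace (t + h - t) with h by ring. replace (t - t) with 0 by ring. ring.
Qed.

Lemma Cint_conj (f : R -> C) (a b : R) : Ccont f ->
  Cint (fun t => Cconj (f t)) a b = Cconj (Cint f a b).
Proof.
  intro Hf. apply C_ext; simpl; [reflexivity|].
  exact (RInt_opp (V := R_CompleteNormedModule) _ a b (ex_RInt_Im f a b Hf)).
Qed.

Lemma continuous_reflect (t x : R) : continuous (fun s => t - s) x.
Proof.
  apply (continuous_minus (V := R_NormedModule) (fun _ => t) (fun s : R => s));
  [apply continuous_const | apply continuous_id].
Qed.

Section Convolution.
Variables (f : R -> C) (a b S : R).
Hypothesis Hf : smooth f.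
Hypothesis Ha : 0 < a.
Hypothesis Hs : supported_in a b f.
Hypothesis HS : 0 < S.
Hypothesis HbS : b < S.

(** The interval [0, S] replaces [0, t], so that no moving end point interferes with
    differentiation; all derivatives fall on the second factor. *)
Definition conv_n (n : nat) (t : R) : C :=
  Cint (fun s => Cconj (f s) * Cderive_n f n (t - s)%R)%C 0 S.

Lemma Ccont_conv (n : nat) (t : R) : Ccont (fun s => Cconj (f s) * Cderive_n f n (t - s)%R)%C.
Proof.
  apply Ccont_mult; [apply Ccont_conj, Ccont_smooth, Hf|].
  apply (Ccont_comp (Cderive_n f n)); [apply smooth_Ccont, Hf | apply continuous_reflect].
Qed.

Lemma is_Cder_conv_n (n : nat) (t : R) : is_Cder (conv_n n) t (conv_n (Datatypes.S n) t).
Proof.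
  pose proof (Ccont_smooth f Hf) as Hc.
  destruct (decays_compact a b f Hc Hs) as [M HM].
  destruct (decays_compact a b _ (smooth_Ccont f (Datatypes.S (Datatypes.S n)) Hf)
    (supported_Cderive_n a b f (Datatypes.S (Datatypes.S n)) Hs)) as [K HK].
  pose proof (decays_bounded M f HM) as Hb. pose proof (decays_bounded K _ HK) as HbK.
  (* [M] bounds f, [K] bounds its derivative of order n + 2, and [S] is the length of the interval,
     which is why the successor is written [Datatypes.S]. *)
  apply is_Cder_quadratic with (M * K * S). intro h.
  unfold conv_n.
  rewrite <- (Cint_scal (RtoC h) _ 0 S (Ccont_conv (Datatypes.S n) t)).
  rewrite <- (Cint_minus _ _ 0 S (Ccont_conv n (t + h)) (Ccont_conv n t)).
  rewrite <- (Cint_minus _ _ 0 S (Ccont_minus _ _ (Ccont_conv n (t + h)) (Ccont_conv n t))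
    (Ccont_mult _ _ (Ccont_const (RtoC h)) (Ccont_conv (Datatypes.S n) t))).
  replace (M * K * S * h ^ 2) with (M * (K * h ^ 2) * (S - 0)) by ring.
  apply Cint_le_const; [|lra|].
  - apply Ccont_minus; [apply Ccont_minus; apply Ccont_conv|].
    apply Ccont_mult; [apply Ccont_const | apply Ccont_conv].
  - intros s _.
    replace (_ - _)%C with (Cconj (f s) * (Cderive_n f n ((t - s) + h)%R - Cderive_n f n (t - s)%R
       - RtoC h * Cderive_n f (Datatypes.S n) (t - s)%R))%C
      by (replace (t + h - s) with (t - s + h) by ring; ring).
    rewrite Cmod_mult, Cmod_conj. apply Rmult_le_compat; try apply Cmod_ge_0; [apply Hb|].
    apply (Cder_taylor _ (Cderive_n f (Datatypes.S n)) (Cderive_n f (Datatypes.S (Datatypes.S n))));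
    try (intro; apply is_Cder_Cderive_n, Hf); [apply smooth_Ccont, Hf | exact HbK].
Qed.

(** The integrand vanishes for s > t - a and for s > b, so the end point t may be moved to S on
    either side; for t < 0 both integrals are zero. *)
Lemma Laplace_conv_Cint (t : R) : Laplace_conv f f t = conv_n 0 t.
Proof.
  pose proof (Ccont_conv 0 t) as Hc. unfold conv_n. rewrite Cderive_n_0 in *.
  unfold Laplace_conv. rewrite (RInt_Cint _ 0 t Hc).
  set (g := fun s => (Cconj (f s) * f (t - s)%R)%C) in *.
  assert (H0 : forall s, s < a \/ b < s \/ t - a < s -> g s = RtoC 0).
  { intros s Hst. unfold g.
    destruct (Rlt_dec (t - s) a) as [H1|H1].
    - rewrite (supported_out a b (t - s) f Hs) by lra. ring.
    - rewrite (supported_out a b s f Hs) by lra. apply C_ext; simpl; ring. }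
  destruct (Rle_dec 0 t) as [Ht|Ht]; [destruct (Rle_dec t S) as [HtS|HtS]|].
  - rewrite <- (Cint_Chasles g 0 t S Hc), (Cint_zero g t S); [ring|].
    intros s; rewrite Rmin_left by lra; intro; apply H0; lra.
  - rewrite <- (Cint_Chasles g 0 S t Hc), (Cint_zero g S t); [ring|].
    intros s; rewrite Rmin_left by lra; intro; apply H0; lra.
  - rewrite (Cint_zero g 0 t), (Cint_zero g 0 S); trivial.
    + intros s; rewrite Rmin_left by lra; intro; apply H0; lra.
    + intros s; rewrite Rmax_left by lra; intro; apply H0; lra.
Qed.

(** Where the integrand is nonzero, both s and t - s lie in [a, b], hence t lies in [2a, 2b]. *)
Lemma C0inf_conv_n : mem C0inf (conv_n 0).
Proof.
  split; [apply smooth_of_Cder, is_Cder_conv_n|].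
  exists (2 * a), (2 * b). split; [lra|].
  intros t Ht.
  assert (H0 : ~ (t < 2 * a \/ 2 * b < t)).
  { intro Hout. apply Ht. apply Cint_zero. intros s _. rewrite Cderive_n_0.
    destruct (Rlt_dec s a); [|destruct (Rlt_dec b s)];
    try (rewrite (supported_out a b s f Hs) by lra; apply C_ext; simpl; ring).
    rewrite (supported_out a b (t - s) f Hs) by lra. ring. }
  lra.
Qed.

(** A coarser interval, fitted to the rectangle over which the integrals are exchanged next. *)
Lemma supported_conv_n : supported_in a (2 * S) (conv_n 0).
Proof.
  intros t Ht.
  assert (H0 : ~ (t < a \/ 2 * S < t)).
  { intro Hout. apply Ht. apply Cint_zero. intros s. rewrite Rmin_left, Rmax_right by lra. intro Hs0.
    rewrite Cderive_n_0. rewrite (supported_out a b (t - s) f Hs) by lra. ring. }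
  lra.
Qed.

(** The integrals are exchanged over [0, 2S] x [0, S]. For fixed s in (0, S) the substitution t -> t
    + s turns the inner range into [-s, 2S - s], which contains [0, S], so the inner integral is a
    full transform; the conjugated factor is the transform at the conjugate of z, conjugated. *)
Lemma Laplace_conv_n (z : C) :
  Laplace (conv_n 0) z = (star (Laplace f) z * Laplace f z)%C.
Proof.
  pose proof (Ccont_smooth f Hf) as Hc.
  assert (HL : forall z, Laplace f z = Cint (Laplace_kernel f z) 0 S)
    by (intro; apply Laplace_Cint with a b; trivial; lra).
  rewrite (Laplace_Cint (conv_n 0) a (2 * S) (2 * S)); try lra;
    [|apply C0inf_mem_Ccont, C0inf_conv_n | apply supported_conv_n].
  set (F := fun t s => (Cexp (- (RtoC t * z)) * (Cconj (f s) * f (t - s)%R))%C).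
  assert (HF : Ccont2 F).
  { apply (Ccont2_mult (fun t _ => Cexp (- (RtoC t * z)))).
    - apply Ccont2_l. ccont.
    - apply (Ccont2_mult (fun _ s => Cconj (f s)) (fun t s => f (t - s))).
      + apply (Ccont2_r (fun s => Cconj (f s))), Ccont_conj, Hc.
      + apply (Ccont2_comp f (fun t s => t - s)); trivial. intros x y.
        apply continuity_2d_pt_minus; [apply continuity_2d_pt_id1 | apply continuity_2d_pt_id2]. }
  transitivity (Cint (fun t => Cint (F t) 0 S) 0 (2 * S)).
  { f_equal. apply functional_extensionality; intro t. unfold Laplace_kernel, conv_n.
    pose proof (Ccont_conv 0 t) as Hcv. rewrite Cderive_n_0 in *.
    rewrite <- (Cint_scal _ _ 0 S Hcv). reflexivity. }
  rewrite (Cint_exchange F) by exact HF.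
  transitivity (Cint (fun s => Laplace f z * (Cexp (- (RtoC s * z)) * Cconj (f s)))%C 0 S).
  - apply Cint_ext. intros s. rewrite Rmin_left, Rmax_right by lra. intro Hs0.
    pose proof (Ccont_Laplace_kernel f z Hc) as Hk.
    assert (Hks : Ccont (fun t => Laplace_kernel f z (t + - s)))
      by (apply (Ccont_comp (Laplace_kernel f z)); [exact Hk | intro; apply continuous_shift]).
    transitivity (Cint (fun t => (Cexp (- (RtoC s * z)) * Cconj (f s)) * Laplace_kernel f z (t + - s)%R)%C 0 (2 * S)).
    + f_equal. apply functional_extensionality; intro t. unfold F, Laplace_kernel.
      replace (- (RtoC t * z))%C with (- (RtoC s * z) + - (RtoC (t + - s) * z))%C
        by (apply C_ext; simpl; ring).
      rewrite Cexp_plus. unfold Rminus. ring.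
    + rewrite (Cint_scal _ _ 0 (2 * S) Hks).
      rewrite (Cint_comp_plus (Laplace_kernel f z)) by exact Hk.
      rewrite HL, (Cint_supported (Laplace_kernel f z) 0 S (0 + - s) (2 * S + - s)); try lra; [ring | exact Hk |].
      intros t Ht. apply Laplace_kernel_out, (supported_out a b t f Hs). lra.
  - assert (Hk : Ccont (fun s => Cexp (- (RtoC s * z)) * Cconj (f s))%C) by ccont.
    rewrite (Cint_scal _ _ 0 S Hk). rewrite Cmult_comm. f_equal.
    unfold star. rewrite HL, <- Cint_conj by (apply Ccont_Laplace_kernel, Hc).
    f_equal. apply functional_extensionality; intro s. unfold Laplace_kernel.
    rewrite Cmult_conj, <- Cexp_conj. f_equal. f_equal. apply C_ext; simpl; ring.
Qed.

End Convolution.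

Lemma Laplace_conv_C0inf (f : R -> C) : mem C0inf f ->
  mem C0inf (Laplace_conv f f) /\
  Laplace (Laplace_conv f f) = (fun z => star (Laplace f) z * Laplace f z)%C.
Proof.
  intro Hf. destruct (C0inf_Laplace_Cint f Hf) as [a [b [S [Ha [Hs [HS [HbS HL]]]]]]].
  destruct Hf as [Hf _].
  replace (Laplace_conv f f) with (conv_n f S 0).
  - split.
    + apply C0inf_conv_n with a b; assumption.
    + apply functional_extensionality; intro z. apply Laplace_conv_n with a b; assumption.
  - apply functional_extensionality; intro t. symmetry. apply Laplace_conv_Cint with a b; assumption.
Qed.

(** * Continuity of the inverse Laplace transform *)

(** The tails beyond T are controlled by the constants of Y, the part over [-T, T] by the size of w
    on the disc of radius T; the factor 1 / (2 pi) is estimated by 1. *)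
Lemma iLaplace_n_bound (w : C -> C) (rp rm : R) (c : nat -> R) (n : nat) (T eta t : R) :
  entire w -> Y_bound rp rm c w -> 0 < T ->
  (forall z, Cmod z <= T -> Cmod (w z) <= eta) ->
  Cmod (iLaplace_n w n t) <= 4 * c (n + 2)%nat / T + T ^ n * eta * (2 * T).
Proof.
  intros Hw Hb HT Heta. unfold iLaplace_n.
  pose proof (Ccont_axis_cis w Hw n t) as Hc. pose proof (decays_axis_cis w rp rm c Hb n t) as Hd.
  set (g := fun y => ((0, y) ^ n * w (0%R, y) * cis (y * t))%C) in *.
  rewrite Cmod_mult, Cmod_R, Rabs_pos_eq by (apply Rlt_le, inv_2PI_pos).
  assert (H1 : / (2 * PI) <= 1).
  { rewrite <- Rinv_1. apply Rinv_le_contravar; pose proof PI2_1; lra. }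
  assert (H2 : Cmod (LI g) <= 4 * c (n + 2)%nat / T + T ^ n * eta * (2 * T)).
  { replace (LI g) with ((LI g - Cint g (- T) T) + Cint g (- T) T)%C by ring.
    eapply Rle_trans; [apply Cmod_triangle|]. apply Rplus_le_compat; [apply LI_tail; assumption|].
    replace (2 * T) with (T - - T) by ring. apply Cint_le_const; [exact Hc | lra |].
    intros y Hy. unfold g. rewrite !Cmod_mult, Cmod_cis, Rmult_1_r, Cmod_pow.
    assert (Hyy : Cmod (0, y) <= T).
    { eapply Rle_trans; [apply Cmod_le_Re_Im|]. simpl. rewrite Rabs_R0, Rplus_0_l. apply Rabs_le; lra. }
    apply Rmult_le_compat; try apply Cmod_ge_0; [apply pow_le, Cmod_ge_0 | | apply Heta, Hyy].
    apply pow_incr. split; [apply Cmod_ge_0 | exact Hyy]. }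
  pose proof (Cmod_ge_0 (LI g)). pose proof inv_2PI_pos. nra.
Qed.

Lemma iLaplace_continuous (w : nat -> C -> C) : (forall k, mem Y (w k)) -> cvg0 Y w ->
  cvg0 C0inf (fun k => iLaplace (w k)).
Proof.
  intros Hm [[rp [rm [c [Hrp Hb]]]] Hcv].
  assert (He : forall k, entire (w k)) by (intro k; apply Hm).
  split.
  - exists (- rp), rm. split; [lra|]. intro k. apply supported_iLaplace with c; auto.
  - intros n eps Heps.
    pose proof (decays_pos _ _ (decays_axis_cis (w O) rp rm c (Hb O) n 0)) as Hc.
    (* The constants are common to the whole sequence, so T is independent of k and the smallness on
       the disc of radius T is chosen after it; tails and disc get eps / 2 each, uniformly in t. *)
    set (T := 8 * c (n + 2)%nat / eps + 1).
    assert (HT : 0 < T).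
    { unfold T. assert (0 <= 8 * c (n + 2)%nat / eps) by (apply Rdiv_le_0_compat; lra). lra. }
    assert (H1 : 4 * c (n + 2)%nat / T < eps / 2).
    { apply (proj2 (Rlt_div_l _ (eps / 2) T HT)). unfold T. field_simplify; lra. }
    assert (HTn : 0 < T ^ n * (2 * T)) by (apply Rmult_lt_0_compat; [apply pow_lt, HT | lra]).
    assert (Heta : 0 < eps / 2 / (T ^ n * (2 * T))) by (apply Rdiv_lt_0_compat; lra).
    destruct (Hcv T _ Heta) as [N HN]. exists N. intros k Hk t.
    rewrite (Cderive_n_iLaplace (w k) rp rm c) by auto.
    eapply Rle_lt_trans;
    [apply (iLaplace_n_bound (w k) rp rm c n T (eps / 2 / (T ^ n * (2 * T)))); auto|].
    + intros z Hz. apply Rlt_le, (HN k Hk z Hz).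
    + replace (T ^ n * (eps / 2 / (T ^ n * (2 * T))) * (2 * T)) with (eps / 2); [lra|].
      field. split; [lra | apply pow_nonzero; lra].
Qed.

(** * Transport of quadratic forms along linear bijections *)

Section Transport.
Context {A B : Type}.
Variables (X : (A -> C) -> Prop) (Z : (B -> C) -> Prop).
Variables (T : (A -> C) -> B -> C) (T' : (B -> C) -> A -> C).
Variables (q : (A -> C) -> C) (q' : (B -> C) -> C).
Hypothesis HT : forall f, X f -> Z (T f).
Hypothesis HT' : forall f, X f -> T' (T f) = f.
Hypothesis Tlin : forall c f g, X f -> X g ->
  T (fun x => c * f x + g x)%C = (fun y => c * T f y + T g y)%C.
Hypothesis Hq : forall f, X f -> q f = q' (T f).

Definition image (M : (A -> C) -> Prop) (g : B -> C) : Prop := exists f, M f /\ g = T f.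

(** Linearity is given for combinations c f + g only, so 0 is written as -1 times 0 plus 0. *)
Lemma transport_0 : X (fun _ => RtoC 0) -> T (fun _ => RtoC 0) = (fun _ => RtoC 0).
Proof.
  intro H0. pose proof (Tlin (-1) _ _ H0 H0) as H. cbv beta in H.
  replace (fun _ : A => -1 * 0 + 0)%C with (fun _ : A => RtoC 0) in H
    by (apply functional_extensionality; intro; ring).
  rewrite H at 1. apply functional_extensionality; intro y. apply C_ext; simpl; ring.
Qed.

Lemma linear_set_sum (M : (A -> C) -> Prop) (n : nat) (e : nat -> A -> C) (c : nat -> C) :
  linear_set M -> (forall f, M f -> X f) -> (forall i, (1 <= i <= n)%nat -> M (e i)) ->
  M (fun x => sum_n_m (fun i => c i * e i x)%C 1 n) /\
  T (fun x => sum_n_m (fun i => c i * e i x)%C 1 n) =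
  (fun y => sum_n_m (fun i => c i * T (e i) y)%C 1 n).
Proof.
  intros [M0 Ml] HX. induction n as [|n IH]; intro He.
  - replace (fun x : A => sum_n_m (fun i => c i * e i x)%C 1 0) with (fun _ : A => RtoC 0)
      by (apply functional_extensionality; intro; symmetry; etransitivity; [apply sum_n_m_zero; lia | reflexivity]).
    split; trivial. rewrite transport_0 by auto.
    apply functional_extensionality; intro; symmetry; etransitivity; [apply sum_n_m_zero; lia | reflexivity].
  - destruct IH as [H1 H2]; [intros; apply He; lia|].
    assert (HeS : M (e (S n))) by (apply He; lia).
    replace (fun x => sum_n_m (fun i => c i * e i x)%C 1 (S n))
      with (fun x => c (S n) * e (S n) x + sum_n_m (fun i => c i * e i x)%C 1 n)%C.
    + split; [apply Ml; assumption|].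
      rewrite Tlin, H2 by auto. apply functional_extensionality; intro y.
      rewrite sum_n_Sm by lia. apply Cplus_comm.
    + apply functional_extensionality; intro x. rewrite sum_n_Sm by lia. apply Cplus_comm.
Qed.

Lemma linear_set_image (M : (A -> C) -> Prop) : linear_set M -> (forall f, M f -> X f) ->
  linear_set (image M).
Proof.
  intros [M0 Ml] HX. split.
  - exists (fun _ => RtoC 0). split; trivial. symmetry; apply transport_0; auto.
  - intros c _ _ [f [Hf ->]] [g [Hg ->]]. exists (fun x => c * f x + g x)%C.
    split; [auto|]. symmetry; apply Tlin; auto.
Qed.

(** A combination vanishes exactly when its image does: one direction is linearity, the other
    applies the left inverse [T']. *)
Lemma lin_indep_transport (M : (A -> C) -> Prop) (n : nat) (e : nat -> A -> C) :
  linear_set M -> (forall f, M f -> X f) -> (forall i, (1 <= i <= n)%nat -> M (e i)) ->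
  lin_indep n e <-> lin_indep n (fun i => T (e i)).
Proof.
  intros HM HX He. split; intros Hl c Hc; apply Hl.
  - destruct (linear_set_sum M n e c HM HX He) as [H1 H2].
    assert (H0 : (fun x => sum_n_m (fun i => c i * e i x)%C 1 n) = (fun _ => RtoC 0)).
    { rewrite <- (HT' _ (HX _ H1)), H2.
      rewrite <- (HT' (fun _ => RtoC 0)) by (apply HX, HM). rewrite transport_0 by (apply HX, HM).
      f_equal. apply functional_extensionality; exact Hc. }
    intro x. exact (f_equal (fun f => f x) H0).
  - destruct (linear_set_sum M n e c HM HX He) as [H1 H2]. intro y.
    assert (H0 : (fun x => sum_n_m (fun i => c i * e i x)%C 1 n) = (fun _ => RtoC 0))
      by (apply functional_extensionality; exact Hc).
    rewrite H0, transport_0 in H2 by (apply HX, HM).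
    symmetry. exact (f_equal (fun f => f y) H2).
Qed.

Lemma dim_image (M : (A -> C) -> Prop) : linear_set M -> (forall f, M f -> X f) ->
  dim (image M) = dim M.
Proof.
  intros HM HX. apply Rbar_le_antisym; apply Rbar_lub_subset.
  - intros d [n [e [-> [He Hl]]]].
    assert (Hpre : forall i, (1 <= i <= n)%nat -> M (T' (e i)) /\ T (T' (e i)) = e i).
    { intros i Hi. destruct (He i Hi) as [f [Hf ->]]. rewrite (HT' f) by auto. auto. }
    exists n, (fun i => T' (e i)). split; [reflexivity|]. split; [intros; apply Hpre; assumption|].
    apply (lin_indep_transport M n (fun i => T' (e i)) HM HX (fun i Hi => proj1 (Hpre i Hi))).
    intros c Hc. apply Hl. intro y. rewrite <- (Hc y).
    apply sum_n_m_ext_loc. intros i Hi. rewrite (proj2 (Hpre i Hi)). reflexivity.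
  - intros d [n [e [-> [He Hl]]]]. exists n, (fun i => T (e i)).
    split; [reflexivity|]. split; [intros i Hi; exists (e i); auto|].
    apply (lin_indep_transport M n e HM HX He), Hl.
Qed.

(** An inequality, since it rests on a left inverse of [T] alone; equality follows by a second
    application with the two maps exchanged. *)
Lemma N_plus_transport_le : Rbar_le (N_plus q X) (N_plus q' Z).
Proof.
  apply Rbar_lub_subset. intros d [M [HM [HX [Hp ->]]]].
  exists (image M). split; [apply linear_set_image; assumption|]. split; [|split].
  - intros _ [f [Hf ->]]. auto.
  - intros _ [f [Hf ->]] Hnz. rewrite <- Hq by auto. apply Hp; trivial.
    intros ->. apply Hnz, transport_0. auto.
  - symmetry. apply dim_image; assumption.
Qed.

End Transport.

(** Stated for arbitrary functionals so that it covers the forms and their negatives, hence both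
    signs of the index. *)
Lemma N_plus_Laplace (q : (R -> C) -> C) (q' : (C -> C) -> C) :
  (forall f, mem C0inf f -> q f = q' (Laplace f)) ->
  N_plus q (mem C0inf) = N_plus q' (mem Y).
Proof.
  intro Hq. apply Rbar_le_antisym.
  - apply (N_plus_transport_le _ _ Laplace iLaplace); trivial.
    + exact Y_Laplace.
    + exact iLaplace_Laplace.
    + exact Laplace_lin.
  - apply (N_plus_transport_le _ _ iLaplace Laplace).
    + exact C0inf_iLaplace.
    + exact Laplace_iLaplace.
    + exact iLaplace_lin.
    + intros w Hw. rewrite (Hq _ (C0inf_iLaplace w Hw)), Laplace_iLaplace; trivial.
Qed.

Theorem theorem2p5 (h : (R -> C) -> C)
    (h_dual : dual C0inf h) (h_real : real_functional h) :
  (exists sigma : (C -> C) -> C, Laplace_adj_inv h sigma /\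
     forall tau : (C -> C) -> C, Laplace_adj_inv h tau ->
       forall w : C -> C, mem Y w -> tau w = sigma w) /\
  forall sigma : (C -> C) -> C, Laplace_adj_inv h sigma ->
    (N_plus (h_form h) (mem C0inf) = N_plus (sigma_form sigma) (mem Y) /\
     N_minus (h_form h) (mem C0inf) = N_minus (sigma_form sigma) (mem Y)) /\
    ((forall f, mem C0inf f -> Cnonneg (h_form h f)) <->
     (forall w, mem Y w -> Cnonneg (sigma_form sigma w))) /\
    ((forall f, mem C0inf f -> Cnonneg (- h_form h f)%C) <->
     (forall w, mem Y w -> Cnonneg (- sigma_form sigma w)%C)).
Proof.
  split.
  - exists (fun w => h (iLaplace w)). split; [split|].
    + destruct h_dual as [hl hc]. split.
      * intros c v w Hv Hw. rewrite iLaplace_lin by assumption.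
        apply hl; apply C0inf_iLaplace; assumption.
      * intros w Hw Hcv. apply (hc (fun k => iLaplace (w k))).
        -- intro k. apply C0inf_iLaplace, Hw.
        -- apply iLaplace_continuous; assumption.
    + intros F HF. unfold Laplace_adj. rewrite iLaplace_Laplace by assumption. reflexivity.
    + intros tau [_ Htau] w Hw. rewrite <- (Htau _ (C0inf_iLaplace w Hw)).
      unfold Laplace_adj. rewrite Laplace_iLaplace by assumption. reflexivity.
  - intros sigma [_ Hsigma].
    assert (Hq : forall f, mem C0inf f -> h_form h f = sigma_form sigma (Laplace f)).
    { intros f Hf. destruct (Laplace_conv_C0inf f Hf) as [Hc HL].
      unfold h_form, sigma_form. rewrite <- (Hsigma _ Hc). unfold Laplace_adj. rewrite HL. reflexivity. }
    assert (Hq' : forall w, mem Y w -> h_form h (iLaplace w) = sigma_form sigma w).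
    { intros w Hw. rewrite (Hq _ (C0inf_iLaplace w Hw)), Laplace_iLaplace by assumption. reflexivity. }
    split; [split|split].
    + apply N_plus_Laplace, Hq.
    + apply N_plus_Laplace. intros f Hf. rewrite (Hq f Hf). reflexivity.
    + split; intros H; [intros w Hw; rewrite <- (Hq' w Hw) | intros f Hf; rewrite (Hq f Hf)]; apply H.
      * apply C0inf_iLaplace, Hw.
      * apply Y_Laplace, Hf.
    + split; intros H; [intros w Hw; rewrite <- (Hq' w Hw) | intros f Hf; rewrite (Hq f Hf)]; apply H.
      * apply C0inf_iLaplace, Hw.
      * apply Y_Laplace, Hf.
Qed.
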